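(* Let $q\ge 2$ and $0<H\le 1-\frac1{2q}$, let $B^H$ be a fractional Brownian motion with Hurst index $H$, and for $n\ge1$ set $V_n=\sum_{k=0}^{n-1}H_q(B^H_{k+1}-B^H_k)$ and $$G_n=\begin{cases}V_n/(\sigma_n\sqrt n)&\text{if }H<1-\frac1{2q},\\ V_n/(\sigma_n\sqrt{n\log n})&\text{if }H=1-\frac1{2q},\end{cases}$$ where $\sigma_n>0$ is the constant such that $E[G_n^2]=1$. Then almost surely, for every continuous and bounded $\varphi:\mathbb R\to\mathbb R$, $$\frac1{\log n}\sum_{k=1}^n\frac1k\,\varphi(G_k)\longrightarrow E[\varphi(N)]\quad\text{as }n\to\infty,$$ where $N\sim\mathscr N(0,1)$.
   Context: A fractional Brownian motion with Hurst index $H\in(0,1)$ is a centered Gaussian process $(B^H_t)_{t\ge0}$ with continuous paths and covariance $E[B^H_tB^H_s]=\frac12(t^{2H}+s^{2H}-|t-s|^{2H})$. $H_q(x)=(-1)^qe^{x^2/2}\frac{d^q}{dx^q}e^{-x^2/2}$ is the $q$-th Hermite polynomial (e.g. $H_2(x)=x^2-1$, $H_3(x)=x^3-3x$). (In the log-normalized case, $G_1$ is not defined by the formula; the statement concerns the terms for which $G_k$ is defined, the finitely many initial terms being irrelevant to the limit.) *)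

(* Defs.v *)
From HB Require Import structures.
From mathcomp Require Import all_boot all_order all_algebra.
From mathcomp Require Import all_classical all_reals all_analysis.
Set Implicit Arguments. Unset Strict Implicit. Unset Printing Implicit Defensive.
Import Order.TTheory GRing.Theory Num.Theory.
Import numFieldNormedType.Exports.
Local Open Scope classical_set_scope.
Local Open Scope ring_scope.

Section defs.
Context {R : realType} {d : measure_display} {Omega : measurableType d}.

Definition centered_gaussian (P : probability Omega R) (X : Omega -> R) (v : R) :=
  measurable_fun setT X /\ 0 <= v /\
  (if v == 0 then P [set w | X w != 0] = 0%E
   else forall A : set R, measurable A ->
          P (X @^-1` A) = normal_prob 0 (Num.sqrt v) A).

Definition fBm_cov (H t s : R) : R :=
  (t `^ (2 * H) + s `^ (2 * H) - `|t - s| `^ (2 * H)) / 2.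

Definition is_fBm (P : probability Omega R) (H : R) (B : R -> Omega -> R) :=
  0 < H < 1 /\
  (forall t, 0 <= t -> measurable_fun setT (B t)) /\
  (forall w, {within `[0, +oo[, continuous (fun t => B t w)}) /\
  (forall (m : nat) (ts a : 'I_m -> R), (forall i, 0 <= ts i) ->
     centered_gaussian P (fun w => \sum_(i < m) a i * B (ts i) w)
       (\sum_(i < m) \sum_(j < m) a i * a j * fBm_cov H (ts i) (ts j))).

End defs.

Definition hermite {R : realType} (q : nat) (x : R) : R :=
  (-1) ^+ q * expR (x ^+ 2 / 2) * derive1n q (fun y : R => expR (- (y ^+ 2) / 2)) x.

Definition Vn {R : realType} {Omega : Type} (q : nat) (B : R -> Omega -> R)
  (n : nat) (w : Omega) : R :=
  \sum_(k < n) hermite q (B k.+1%:R w - B k%:R w).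

Definition Hcrit {R : realType} (q : nat) : R := 1 - (2 * q%:R)^-1.

Definition Gn {R : realType} {Omega : Type} (q : nat) (H : R) (B : R -> Omega -> R)
  (sigma : nat -> R) (n : nat) (w : Omega) : R :=
  if H < Hcrit q then Vn q B n w / (sigma n * Num.sqrt n%:R)
  else Vn q B n w / (sigma n * Num.sqrt (n%:R * ln n%:R)).

(* Main.v *)
Require Import Defs.
From HB Require Import structures.
From mathcomp Require Import all_boot all_order all_algebra.
From mathcomp Require Import all_classical all_reals all_analysis.
From mathcomp Require Import measurable_realfun.
From mathcomp Require Import ring lra zify.
Set Implicit Arguments. Unset Strict Implicit. Unset Printing Implicit Defensive.
Import Order.TTheory GRing.Theory Num.Theory.
Import numFieldNormedType.Exports.
Local Open Scope classical_set_scope.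
Local Open Scope ring_scope.

Notation Ex mu f := (Rintegral mu setT f).
Notation intg mu f := (mu.-integrable setT (EFin \o f)).

(* Let q = p + 1, X_k = B_{k+1} - B_k, V_n the sum of the H_q(X_k), and G_n = c_n V_n.
   Gaussian integration by parts (Malliavin calculus by hand) gives, for f and g of
   class C^1,
     E[G_k f(G_k) g(G_l)] = E[f'(G_k) g(G_l) T_kk + f(G_k) g'(G_l) T_kl],
   where T_kl = q c_k c_l sum_{a<k, b<l} rho(a - b) H_{q-1}(X_a) H_{q-1}(X_b) has mean
   E[G_k G_l].  If f solves Stein's equation f'(y) - y f(y) = h(y) - E[h(N)], then
   xi_k = h(G_k) - E[h(N)] satisfies
     |E[xi_k xi_l]| <= C (E|T_kk - 1| + E|T_kl|)  for k <= l,
   and bounds on Var T_kl, obtained from a recursion for four-point Hermite moments,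
   turn this into C (h_k^(-1/2) + (k/l)^(1/4)), with h_k the k-th harmonic number.  So
   the sum S_n of the xi_k / k has E[S_n^2] <= C h_n^(3/2), and S_n / h_n tends to 0
   almost surely: first along h_n ~ j^4, by summability, then along all n.  Countably many
   smooth steps h suffice to reach every bounded continuous function. *)

(** * Expectation and moments *)

(** Only the laws of linear combinations of the X_k are given, and their covariance matrix is never
    inverted. Integration by parts therefore rests on the regression X_j = C_kj X_k + residual: the
    residuals are independent of X_k, and the one-dimensional formula in X_k suffices. Independence
    is read off from characteristic functions, by approximating indicators with polynomials in
    cosines.

    The bound on |E[xi_k xi_l]| must serve both regimes. At the critical H the variance of V_n has
    order n log n, and the normalized variance of T_kk is controlled only by a multiple of 1 / h_k,
    whence h_k^(-1/2). Logarithmic averaging tolerates this rate, as the sum of 1 / (k h_k^(1/2))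
    has order h_n^(1/2). The exponent 1/4 of k / l leaves room for a ratio of logarithms. Then
    E[(S_n / h_n)^2] = O(h_n^(-1/2)), which is O(j^(-2)) at h_n ~ j^4.

    The exceptional null set may not depend on phi, and there are uncountably many phi. Hence the
    countable family of steps, from which tightness of the random averages must be drawn as well. *)

Section expectation.
Context {d : measure_display} {T : measurableType d} {R : realType}.
Variable mu : probability T R.
Implicit Types f g : T -> R.

Lemma intg_meas f : intg mu f -> measurable_fun setT f.
Proof. by move=> /measurable_int/measurable_EFinP. Qed.

Lemma intg_cst (c : R) : intg mu (fun=> c).
Proof. exact: finite_measure_integrable_cst. Qed.

Lemma intgD f g : intg mu f -> intg mu g -> intg mu (fun x => f x + g x).
Proof. by move=> If Ig; apply: (integrableD measurableT If Ig). Qed.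

Lemma intgZ (c : R) f : intg mu f -> intg mu (fun x => c * f x).
Proof. by move=> If; apply: (integrableZl measurableT c If). Qed.

Lemma intgB f g : intg mu f -> intg mu g -> intg mu (fun x => f x - g x).
Proof. by move=> If Ig; apply: (integrableB measurableT If Ig). Qed.

Lemma le_intg f g : measurable_fun setT f ->
  (forall x, `|f x| <= `|g x|) -> intg mu g -> intg mu f.
Proof.
move=> mf fg; apply: le_integrable => //; first exact/measurable_EFinP.
by move=> x _; rewrite /= lee_fin.
Qed.

Lemma intg_bounded f K : measurable_fun setT f ->
  (forall x, `|f x| <= K) -> intg mu f.
Proof.
move=> mf fK; apply: (@le_intg _ (fun=> K)) => //; last exact: intg_cst.
by move=> x; rewrite (le_trans (fK x))// ler_norm.
Qed.

Lemma Ex_cst (c : R) : Ex mu (fun=> c) = c.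
Proof. rewrite Rintegral_cst// [X in fine X](_ : _ = 1%E) ?mulr1//. exact: probability_setT. Qed.

Lemma ExD f g : intg mu f -> intg mu g ->
  Ex mu (fun x => f x + g x) = Ex mu f + Ex mu g.
Proof. exact: RintegralD. Qed.

Lemma ExB f g : intg mu f -> intg mu g ->
  Ex mu (fun x => f x - g x) = Ex mu f - Ex mu g.
Proof. exact: RintegralB. Qed.

Lemma ExZ (c : R) f : intg mu f -> Ex mu (fun x => c * f x) = c * Ex mu f.
Proof. by move=> If; rewrite RintegralZl. Qed.

Lemma eq_Ex f g : f =1 g -> Ex mu f = Ex mu g.
Proof. by move=> fg; apply: eq_Rintegral => x _. Qed.

Lemma intg_sum (I : Type) (s : seq I) (Q : pred I) (F : I -> T -> R) :
  (forall i, intg mu (F i)) -> intg mu (fun x => \sum_(i <- s | Q i) F i x).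
Proof.
move=> IF; elim: s => [|i s IH].
  by under eq_fun do rewrite big_nil; exact: intg_cst.
under eq_fun do rewrite big_cons; case: (Q i) => //; exact: intgD.
Qed.

Lemma Ex_sum (I : Type) (s : seq I) (Q : pred I) (F : I -> T -> R) :
  (forall i, intg mu (F i)) ->
  Ex mu (fun x => \sum_(i <- s | Q i) F i x) = \sum_(i <- s | Q i) Ex mu (F i).
Proof.
move=> IF; elim: s => [|i s IH].
  by under eq_Rintegral do rewrite big_nil; rewrite Ex_cst big_nil.
under eq_Rintegral do rewrite big_cons; rewrite big_cons; case: (Q i) => //.
by rewrite ExD ?IH//; exact: intg_sum.
Qed.

Lemma le_Ex f g : intg mu f -> intg mu g -> (forall x, f x <= g x) ->
  Ex mu f <= Ex mu g.
Proof. by move=> If Ig fg; apply: le_Rintegral. Qed.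

Lemma Ex_ge0 f : (forall x, 0 <= f x) -> 0 <= Ex mu f.
Proof. by move=> f0; apply: Rintegral_ge0. Qed.

Lemma intg_norm f : intg mu f -> intg mu (fun x => `|f x|).
Proof. by move=> If; apply: (integrable_norm If). Qed.

Lemma normr_Ex f : intg mu f -> `|Ex mu f| <= Ex mu (fun x => `|f x|).
Proof. by move=> If; apply: le_normr_Rintegral. Qed.

Lemma EFin_Ex f : intg mu f -> ((Ex mu f)%:E = \int[mu]_x (f x)%:E)%E.
Proof. by move=> If; rewrite /Rintegral fineK//; exact: integrable_fin_num. Qed.

Lemma intg_mul_bounded f g K : measurable_fun setT f ->
  (forall x, `|f x| <= K) -> intg mu g -> intg mu (fun x => f x * g x).
Proof.
move=> mf fK Ig; apply: (@le_intg _ (fun x => K * g x)).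
- by apply: measurable_funM => //; exact: intg_meas.
- by move=> x; rewrite !normrM ler_wpM2r// (le_trans (fK x))// ler_norm.
- exact: intgZ.
Qed.

(** Finiteness of all absolute moments, in place of integrability, because it is stable under
    products: integrability of polynomials in Gaussian variables then follows by closure. *)
Definition allmom f :=
  measurable_fun setT f /\ forall M, intg mu (fun x => `|f x| ^+ M).

Lemma allmom_meas f : allmom f -> measurable_fun setT f.
Proof. by case. Qed.

Lemma allmom_intg f : allmom f -> intg mu f.
Proof.
move=> [mf /(_ 1%N) If]; apply: le_intg If => // x.
by rewrite expr1 normr_id.
Qed.

Lemma allmom_bounded f K : measurable_fun setT f ->
  (forall x, `|f x| <= K) -> allmom f.
Proof.
move=> mf fK; split=> // M; apply: (@intg_bounded _ (K ^+ M)).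
  by apply/measurable_funX; exact: measurableT_comp.
by move=> x; rewrite normrX normr_id lerXn2r// nnegrE (le_trans _ (fK x)).
Qed.

Lemma allmom_cst (c : R) : allmom (fun=> c).
Proof. by apply: (@allmom_bounded _ `|c|). Qed.

(** With [a = |f|^M] and [b = |g|^M], the bound [a b <= a^2 + b^2] trades the moment of order [M] of
    the product for moments of order [2 M] of the factors. *)
Lemma allmomM f g : allmom f -> allmom g -> allmom (fun x => f x * g x).
Proof.
move=> [mf If] [mg Ig]; split=> [|M]; first exact: measurable_funM.
apply: (@le_intg _ (fun x => `|f x| ^+ (M + M) + `|g x| ^+ (M + M))).
- by apply/measurable_funX; apply: measurableT_comp => //; exact: measurable_funM.
- move=> x; rewrite normrX normr_id normrM exprMn.
  set a := `|f x| ^+ M; set b := `|g x| ^+ M; rewrite !exprD -/a -/b.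
  have a0 : 0 <= a by rewrite exprn_ge0. have b0 : 0 <= b by rewrite exprn_ge0.
  rewrite ger0_norm; nra.
- exact: intgD.
Qed.

Lemma allmomD f g : allmom f -> allmom g -> allmom (fun x => f x + g x).
Proof.
move=> [mf If] [mg Ig]; split=> [|M]; first exact: measurable_funD.
apply: (@le_intg _ (fun x => 2 ^+ M * (`|f x| ^+ M + `|g x| ^+ M))).
- by apply/measurable_funX; apply: measurableT_comp => //; exact: measurable_funD.
- move=> x; rewrite normrX normr_id.
  rewrite [leRHS]ger0_norm ?mulr_ge0 ?addr_ge0 ?exprn_ge0//.
  have [ab|/ltW ab] := leP `|f x| `|g x|.
    apply: (@le_trans _ _ ((2 * `|g x|) ^+ M)).
      rewrite lerXn2r ?nnegrE ?mulr_ge0// (le_trans (ler_normD _ _))//; lra.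
    by rewrite exprMn ler_wpM2l ?exprn_ge0// lerDr exprn_ge0.
  apply: (@le_trans _ _ ((2 * `|f x|) ^+ M)).
    rewrite lerXn2r ?nnegrE ?mulr_ge0// (le_trans (ler_normD _ _))//; lra.
  by rewrite exprMn ler_wpM2l ?exprn_ge0// lerDl exprn_ge0.
- by apply: intgZ; exact: intgD.
Qed.

Lemma allmomN f : allmom f -> allmom (fun x => - f x).
Proof.
move=> Af; have := allmomM (allmom_cst (-1)) Af.
by under eq_fun do rewrite mulN1r.
Qed.

Lemma allmomB f g : allmom f -> allmom g -> allmom (fun x => f x - g x).
Proof. by move=> Af Ag; apply: allmomD => //; exact: allmomN. Qed.

Lemma allmomX f n : allmom f -> allmom (fun x => f x ^+ n).
Proof.
move=> Af; elim: n => [|n IH].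
  by under eq_fun do rewrite expr0; exact: allmom_cst.
by under eq_fun do rewrite exprS; exact: allmomM.
Qed.

Lemma allmom_sum (I : Type) (s : seq I) (Q : pred I) (F : I -> T -> R) :
  (forall i, allmom (F i)) -> allmom (fun x => \sum_(i <- s | Q i) F i x).
Proof.
move=> IF; elim: s => [|i s IH].
  by under eq_fun do rewrite big_nil; exact: allmom_cst.
under eq_fun do rewrite big_cons; case: (Q i) => //; exact: allmomD.
Qed.

(** The inequality [2 m |f| <= m^2 + f^2] at [m = E|f|], once integrated, gives [m^2 <= E[f^2]]. *)
Lemma Ex_norm_le_sqrt f : allmom f ->
  Ex mu (fun x => `|f x|) <= Num.sqrt (Ex mu (fun x => f x ^+ 2)).
Proof.
move=> Af; have If := allmom_intg Af; have Inf := intg_norm If.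
have I2 := allmom_intg (allmomX 2 Af).
set m := Ex mu _; have m0 : 0 <= m by apply: Ex_ge0.
rewrite -(ger0_norm m0) -sqrtr_sqr ler_sqrt ?Ex_ge0//; last first.
  by move=> x; exact: sqr_ge0.
have : Ex mu (fun x => 2 * m * `|f x|) <= Ex mu (fun x => m ^+ 2 + f x ^+ 2).
  apply: le_Ex => [||x]; first exact: intgZ.
    by apply: intgD => //; exact: intg_cst.
  rewrite -(real_normK (num_real (f x))) -subr_ge0.
  rewrite (_ : _ - _ = (m - `|f x|) ^+ 2) ?sqr_ge0//; ring.
rewrite ExZ// -/m ExD ?Ex_cst//; last exact: intg_cst.
by lra.
Qed.

End expectation.

(** * One-dimensional Gaussian integrals *)

Section normal_density.
Variables (R : realType) (s : R).
Local Notation mu := (@lebesgue_measure R).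
Local Notation gam := (normal_prob (0 : R) s).
Local Notation pdf := (normal_pdf (0 : R) s).

(** Change of variables holds for the Radon-Nikodym derivative, which agrees almost everywhere with
    the density because both have the same integral over every measurable set. *)
Lemma ge0_integral_normal_prob (f : R -> \bar R) :
  measurable_fun setT f -> (forall x, 0 <= f x)%E ->
  (\int[gam]_x f x = \int[mu]_x (f x * (pdf x)%:E))%E.
Proof.
move=> mf f0; rewrite -(Radon_Nikodym_SigmaFinite.change_of_variables
  (normal_prob_dominates 0 s))//.
have dom := normal_prob_dominates (0 : R) s.
have mRN : measurable_fun setT (Radon_Nikodym_SigmaFinite.f gam mu).
  exact: (measurable_int _ (Radon_Nikodym_SigmaFinite.f_integrable dom)).
have mp : measurable_fun setT (fun x => (pdf x)%:E).
  by apply/measurable_EFinP; exact: measurable_normal_pdf.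
have : ae_eq mu setT (Radon_Nikodym_SigmaFinite.f gam mu) (fun x => (pdf x)%:E).
  apply: integral_ae_eq => //.
    exact: (Radon_Nikodym_SigmaFinite.f_integrable dom).
  by move=> E _ mE; rewrite -Radon_Nikodym_SigmaFinite.f_integral.
move=> [N [mN N0 H]]; apply: ae_eq_integral => //.
- exact: emeasurable_funM.
- exact: emeasurable_funM.
- exists N; split => //; apply: subset_trans H; apply: subsetC => x /= Hx _.
  by rewrite Hx.
Qed.

Lemma intg_normal_probP (f : R -> R) : measurable_fun setT f ->
  intg gam f <-> mu.-integrable setT (fun x => (f x * pdf x)%:E).
Proof.
move=> mf.
have mfp : measurable_fun setT (fun x => f x * pdf x).
  by apply: measurable_funM => //; exact: measurable_normal_pdf.
have H : (\int[gam]_x `|(f x)%:E| = \int[mu]_x `|(f x * pdf x)%:E|)%E.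
  rewrite ge0_integral_normal_prob//; last first.
    by apply: measurableT_comp => //; exact/measurable_EFinP.
  apply: eq_integral => x _; rewrite /= -EFinM normrM.
  by rewrite (ger0_norm (normal_pdf_ge0 _ _ _)).
split=> /integrableP[_ Hf]; apply/integrableP; split;
  rewrite ?H// -?H//; exact/measurable_EFinP.
Qed.

Lemma Ex_normal_prob (f : R -> R) : intg gam f ->
  Ex gam f = Rintegral mu setT (fun x => f x * pdf x).
Proof.
move=> If; have mf := intg_meas If.
have Ifp := (intg_normal_probP mf).1 If.
congr fine; rewrite integralE [RHS]integralE.
have mfE : measurable_fun setT (EFin \o f) by exact/measurable_EFinP.
rewrite ge0_integral_normal_prob//; last exact: measurable_funepos.
rewrite ge0_integral_normal_prob//; last exact: measurable_funeneg.
have p0 x : 0 <= pdf x by exact: normal_pdf_ge0.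
congr (_ - _)%E; apply: eq_integral => x _.
- by rewrite !funeposE -!EFin_max -EFinM maxr_pMl// mul0r.
- by rewrite !funenegE -!EFinN -!EFin_max -EFinM maxr_pMl// mul0r mulNr.
Qed.

End normal_density.

Section zero_mean_derivative.
Variable R : realType.
Local Notation mu := (@lebesgue_measure R).

(** The integral over [[-(n + 1), n + 1]] is a difference of boundary values of [F], and dominated
    convergence passes to the whole line. The shift to [n + 1] keeps the interval nondegenerate at
    [n = 0]. *)
Lemma integral_derivative_eq0 (F h : R -> R) :
  (forall x : R, is_derive x (1 : R) F (h x)) -> continuous h ->
  mu.-integrable setT (EFin \o h) ->
  F n%:R @[n --> \oo] --> 0 -> F (- n%:R) @[n --> \oo] --> 0 ->
  (\int[mu]_x (h x)%:E = 0)%E.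
Proof.
move=> dF ch Ih Fp Fm.
have mh : measurable_fun setT (EFin \o h) by exact: (measurable_int _ Ih).
have cF : continuous F.
  by move=> x; apply/differentiable_continuous/derivable1_diffP; have [] := dF x.
pose D (n : nat) : set R := `[- (n.+1%:R : R), n.+1%:R]%classic.
pose f_ n := (EFin \o h) \_ (D n).
have mf_ n : measurable_fun setT (f_ n).
  by apply: (measurable_restrictT _ _).1; [exact: measurable_itv|exact: measurable_funTS].
have f_h : {ae mu, forall x : R, setT x -> f_ ^~ x @ \oo --> (EFin \o h) x}.
  apply: aeW => x _; apply: cvg_near_cst.
  exists (Num.bound `|x|) => // n /= xn; rewrite /f_ patchE ifT//.
  rewrite inE /D/= in_itv/= -ler_norml ltW// (lt_trans (archi_boundP _))// ltr_nat.
  exact: leq_ltn_trans xn _.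
have f_le : {ae mu, forall (x : R) n, setT x -> (`|f_ n x| <= (abse \o (EFin \o h)) x)%E}.
  apply: aeW => x n _; rewrite /f_ patchE; case: ifP => //= _.
  by rewrite normr0 lee_fin.
have [_ _] := @dominated_convergence _ _ _ mu _ measurableT _ _ _ mf_ mh f_h (integrable_abse Ih) f_le.
have -> : [sequence \int[mu]_(x in setT) f_ n x]_n%E =
   (fun n => ((F n.+1%:R - F (- n.+1%:R))%:E)).
  apply/funext => n /=; rewrite /f_ -integral_mkcond EFinB.
  apply: continuous_FTC2.
  - by apply: (@lt_trans _ _ 0); rewrite ?oppr_lt0 ltr0Sn.
  - by apply: continuous_subspaceT.
  - split.
    + by move=> x _; have [] := dF x.
    + by apply: cvg_at_right_filter; exact: cF.
    + by apply: cvg_at_left_filter; exact: cF.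
  - by move=> x _; rewrite derive1E; apply: derive_val.
have : (F n.+1%:R - F (- n.+1%:R))%:E @[n --> \oo] --> (0 : R)%:E.
  apply: cvg_EFin; first exact: nearW.
  have := cvgB Fp Fm; rewrite subr0 => /(_ _) H.
  by rewrite -(@cvg_shiftS _ (fun n : nat => F n%:R - F (- n%:R))) in H.
by move=> /cvg_lim L0 /cvg_lim L1; rewrite -L1// L0.
Qed.

End zero_mean_derivative.

Section gaussian_ibp.
Variables (R : realType) (s : R).
Hypothesis s0 : s != 0.
Local Notation mu := (@lebesgue_measure R).
Local Notation gam := (normal_prob (0 : R) s).
Local Notation pdf := (normal_pdf (0 : R) s).

(** [(1 + y)^M <= K^M (1 + y / K)^M <= K^M e^(M y / K)], and [K = 1 + M / a] makes [M / K <= a]. *)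
Lemma poly_le_expR (a : R) (M : nat) : 0 < a ->
  exists2 K : R, 0 <= K & forall y, 0 <= y -> (1 + y) ^+ M <= K * expR (a * y).
Proof.
move=> a0; pose K := 1 + M%:R / a.
have K1 : 1 <= K by rewrite lerDl divr_ge0// ltW.
have K0 : 0 < K by apply: lt_le_trans K1.
exists (K ^+ M) => [|y y0]; first by rewrite exprn_ge0// ltW.
apply: (@le_trans _ _ ((K * (1 + y / K)) ^+ M)).
  rewrite lerXn2r// ?nnegrE ?addr_ge0// ?mulr_ge0 ?addr_ge0 ?divr_ge0// ?(ltW K0) ?(ltW a0)//.
  by rewrite mulrDr mulr1 mulrCA divff ?gt_eqF// mulr1 lerD2r.
rewrite exprMn ler_wpM2l ?exprn_ge0 ?(ltW K0)//.
apply: (@le_trans _ _ (expR (y / K) ^+ M)).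
  by rewrite lerXn2r ?nnegrE ?expR_ge0 ?addr_ge0 ?divr_ge0 ?(ltW K0)// expR_ge1Dx.
rewrite -expRM_natl ler_expR mulrCA mulrC ler_wpM2r//.
rewrite ler_pdivrMr// /K mulrDr mulr1 mulrCA divff ?gt_eqF// mulr1 lerDr ltW//.
Qed.

Lemma normal_pdf0E (x : R) : pdf x = normal_peak s * expR (- x ^+ 2 / (s ^+ 2 *+ 2)).
Proof. by rewrite normal_pdfE// /normal_fun subr0. Qed.

(** The exponential splits into two equal factors [e^(- x^2 / (4 s^2))]: one absorbs the polynomial,
    the other is, up to its peak, the density with doubled variance. This gives integrability and
    decay at infinity at once. *)
Lemma poly_pdf_le (M : nat) : exists2 K : R, 0 <= K & forall x,
  (1 + x ^+ 2) ^+ M * pdf x <= K * normal_pdf 0 (Num.sqrt 2 * s) x.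
Proof.
have s20 : 0 < s ^+ 2 by rewrite exprn_even_gt0.
have [K K0 HK] := @poly_le_expR ((s ^+ 2 *+ 4)^-1) M ltac:(by rewrite invr_gt0 pmulrn_lgt0).
have r0 : Num.sqrt 2 * s != 0 :> R by rewrite mulf_neq0// sqrtr_eq0 -ltNge.
have p0 := normal_peak_gt0 r0; have q0 := normal_peak_gt0 s0.
exists (K * (normal_peak s / normal_peak (Num.sqrt 2 * s))).
  by rewrite mulr_ge0// divr_ge0// ltW.
move=> x; rewrite normal_pdf0E (normal_pdfE _ r0)/= /normal_fun subr0.
rewrite -!mulrA [X in _ <= _ * (_ * X)]mulrA mulVf ?gt_eqF// mul1r.
rewrite mulrCA [leRHS]mulrCA ler_wpM2l ?(ltW q0)//.
rewrite exprMn sqr_sqrtr//.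
apply: le_trans (ler_wpM2r (expR_ge0 _) (HK (x ^+ 2) (sqr_ge0 _))) _.
rewrite -mulrA ler_wpM2l// -expRD ler_expR le_eqVlt; apply/orP; left; apply/eqP.
rewrite -!(mulr_natr (s ^+ 2)) -(mulr_natr (_ * s ^+ 2)); field; exact: s0.
Qed.

Lemma intg_poly_normal (M : nat) : intg gam (fun x => (1 + x ^+ 2) ^+ M).
Proof.
have mq : measurable_fun setT (fun x : R => (1 + x ^+ 2) ^+ M).
  by apply: measurable_funX; apply: measurable_funD => //; exact: measurable_funX.
apply/intg_normal_probP => //.
have [K K0 HK] := poly_pdf_le M.
have r0 : Num.sqrt 2 * s != 0 :> R by rewrite mulf_neq0// sqrtr_eq0 -ltNge.
have := integrableZl measurableT K (integrable_normal_pdf 0 (Num.sqrt 2 * s)).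
apply: le_integrable => //.
  apply/measurable_EFinP/measurable_funM => //; exact: measurable_normal_pdf.
move=> x _; rewrite -EFinM/= !lee_fin.
rewrite !ger0_norm ?HK// ?mulr_ge0 ?normal_pdf_ge0// exprn_ge0// addr_ge0 ?sqr_ge0//.
Qed.

Definition polygrowth (f : R -> R) :=
  exists K M, forall x, `|f x| <= K * (1 + x ^+ 2) ^+ M.

Lemma intg_polygrowth f : measurable_fun setT f -> polygrowth f -> intg gam f.
Proof.
move=> mf [K [M HK]]; apply: le_intg (intgZ K (intg_poly_normal M)) => // x.
by rewrite (le_trans (HK x))// ler_norm.
Qed.

(** The function [(s^2 G' - x G) pdf] is the derivative of [s^2 G pdf], which vanishes at infinity,
    so its integral is 0. *)
Lemma normal_ibp (G G' : R -> R) :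
  (forall x : R, is_derive x (1 : R) G (G' x)) -> continuous G' ->
  polygrowth G -> polygrowth G' ->
  Ex gam (fun x => x * G x) = s ^+ 2 * Ex gam G'.
Proof.
move=> dG cG' [K [M HK]] [K' [M' HK']].
have cG : continuous G.
  by move=> x; apply/differentiable_continuous/derivable1_diffP; have [] := dG x.
have mG : measurable_fun setT G by exact: continuous_measurable_fun.
have mG' : measurable_fun setT G' by exact: continuous_measurable_fun.
have IG' : intg gam G' by apply: intg_polygrowth => //; exists K', M'.
have IxG : intg gam (fun x => x * G x).
  apply: intg_polygrowth; first exact: measurable_funM.
  exists K, M.+1 => x; rewrite normrM exprS mulrCA ler_pM// ?normr_ge0//.
  by rewrite -(real_normK (num_real x)); have := normr_ge0 x; nra.
have Ih : intg gam (fun x => s ^+ 2 * G' x - x * G x).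
  by apply: intgB => //; exact: intgZ.
apply/eqP; rewrite -subr_eq0 -oppr_eq0 opprB -ExZ// -ExB//; last exact: intgZ.
rewrite Ex_normal_prob//.
have s20 : 0 < s ^+ 2 by rewrite exprn_even_gt0.
(* The factor [1 + x^2] is gained from one extra power in [poly_pdf_le]. As [1 + n^2 >= n + 1], it
   makes the boundary values [O(1 / (n + 1))]. *)
have bnd : exists2 C : R, 0 <= C & forall x, `|s ^+ 2 * (G x * pdf x)| <= C / (1 + x ^+ 2).
  have [C C0 HC] := poly_pdf_le M.+1.
  have r0 : Num.sqrt 2 * s != 0 :> R by rewrite mulf_neq0// sqrtr_eq0 -ltNge.
  exists (s ^+ 2 * (`|K| * (C * normal_peak (Num.sqrt 2 * s)))).
    by apply: mulr_ge0 (sqr_ge0 _) _; do 2!apply: mulr_ge0 => //; exact: normal_peak_ge0.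
  move=> x; have x1 : 0 < 1 + x ^+ 2 by rewrite ltr_pwDl// sqr_ge0.
  rewrite ler_pdivlMr// normrM (normrM (G x)) (ger0_norm (sqr_ge0 s)) -(mulrA (s ^+ 2)).
  apply: (ler_wpM2l (sqr_ge0 s)); rewrite -(mulrA `|G x|).
  rewrite (ger0_norm (normal_pdf_ge0 _ _ _)).
  apply: (@le_trans _ _ ((`|K| * (1 + x ^+ 2) ^+ M) * (pdf x * (1 + x ^+ 2)))).
    rewrite ler_wpM2r ?mulr_ge0 ?normal_pdf_ge0 ?(ltW x1)// (le_trans (HK x))//.
    by rewrite ler_wpM2r ?exprn_ge0 ?(ltW x1)// ler_norm.
  rewrite -mulrA ler_wpM2l// [X in _ * X]mulrC mulrA -exprSr.
  by rewrite (le_trans (HC x))// ler_wpM2l// normal_pdf_ub.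
have [C C0 HC] := bnd.
have lim0 : C * harmonic n @[n --> \oo] --> (0 : R).
  by rewrite -[X in _ --> X](mulr0 C); apply: cvgMr; exact: cvg_harmonic.
have HCn n (x : R) : `|x| = n%:R -> `|s ^+ 2 * (G x * pdf x)| <= C * harmonic n.
  move=> xn; rewrite (le_trans (HC x))// ler_wpM2l// /harmonic/= lef_pV2 ?posrE//.
    by rewrite -(real_normK (num_real x)) xn -natr1 addrC lerD2l -natrX ler_nat;
      case: n {xn} => // n; rewrite expnS leq_pmulr.
  by rewrite ltr_pwDl// sqr_ge0.
rewrite /Rintegral.
suff -> : (\int[mu]_x ((s ^+ 2 * G' x - x * G x) * pdf x)%:E = 0)%E by [].
refine (@integral_derivative_eq0 _ (fun x => s ^+ 2 * (G x * pdf x))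
  (fun x => (s ^+ 2 * G' x - x * G x) * pdf x) _ _ _ _ _).
- move=> x.
  have dp : is_derive x (1 : R) pdf (- x / s ^+ 2 * pdf x).
    rewrite (_ : pdf = fun y => normal_peak s * expR (- y ^+ 2 / (s ^+ 2 *+ 2))); last first.
      by apply/funext => y; rewrite normal_pdf0E.
    apply: is_derive_eq; rewrite /GRing.scale/=.
    by rewrite -(mulr_natr (s ^+ 2)); field; exact: s0.
  by apply: is_derive_eq; rewrite /GRing.scale/=; field; exact: s0.
- move=> x; apply: cvgM; last exact: continuous_normal_pdf.
  by apply: cvgB; apply: cvgM; [exact: cvg_cst|exact: cG'|exact: cvg_id|exact: cG].
- by apply/intg_normal_probP => //; exact: intg_meas Ih.
- apply/norm_cvg0P; apply: squeeze_cvgr lim0; last exact: cvg_cst.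
  by apply: nearW => n; rewrite normr_ge0 HCn ?normr_nat.
- apply/norm_cvg0P; apply: squeeze_cvgr lim0; last exact: cvg_cst.
  by apply: nearW => n; rewrite normr_ge0 HCn// normrN normr_nat.
Qed.

End gaussian_ibp.

Lemma continuous_is_derive (R : realType) (f f' : R -> R) :
  (forall x : R, is_derive x (1 : R) f (f' x)) -> continuous f.
Proof.
by move=> df x; apply/differentiable_continuous/derivable1_diffP; have [] := df x.
Qed.

Lemma measurable_cosD d (T : measurableType d) (R : realType) (X : T -> R) (c : R) :
  measurable_fun setT X -> measurable_fun setT (fun w => cos (X w + c)).
Proof.
move=> mX; apply: (@measurableT_comp _ _ _ _ _ _ (fun x : R => cos (x + c))) => //.
apply: continuous_measurable_fun => x.
by apply: continuous_comp; [apply: cvgD; [exact: cvg_id|exact: cvg_cst]|exact: continuous_cos].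
Qed.

Lemma measurable_sinD d (T : measurableType d) (R : realType) (X : T -> R) (c : R) :
  measurable_fun setT X -> measurable_fun setT (fun w => sin (X w + c)).
Proof.
move=> mX; apply: (@measurableT_comp _ _ _ _ _ _ (fun x : R => sin (x + c))) => //.
apply: continuous_measurable_fun => x.
by apply: continuous_comp; [apply: cvgD; [exact: cvg_id|exact: cvg_cst]|exact: continuous_sin].
Qed.

Lemma measurable_normX (R : realType) M : measurable_fun setT (fun x : R => `|x| ^+ M).
Proof.
by apply: measurable_funX; apply: continuous_measurable_fun; exact: norm_continuous.
Qed.

Section gaussian_chf.
Variables (R : realType) (s : R).
Hypothesis s0 : s != 0.
Local Notation gam := (normal_prob (0 : R) s).

Lemma cos_sum_bounded (x : R) : `|cos x| <= 1.
Proof. by rewrite ler_norml cos_geN1 cos_le1. Qed.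

(** Differentiating under the integral and integrating by parts give [w' = - s^2 t w], so
    [w(t) e^(s^2 t^2 / 2)] is constant. The phase [c] lets one real identity stand for the complex
    characteristic function. *)
Lemma normal_chf (t c : R) :
  Ex gam (fun x => cos (t * x + c)) = cos c * expR (- (s ^+ 2 * t ^+ 2 / 2)).
Proof.
pose w t := Ex gam (fun x => cos (t * x + c)).
have mcos r : measurable_fun setT (fun x : R => cos (r * x + c)).
  by apply: measurable_cosD; exact: measurable_funM.
have Icos r : intg gam (fun x => cos (r * x + c)).
  by apply: (@intg_bounded _ _ _ _ _ 1) => [|x]; [exact: mcos|exact: cos_sum_bounded].
have dcos (x r : R) : is_derive r (1 : R) (fun r => cos (r * x + c)) (- (x * sin (r * x + c))).
  by apply: is_derive_eq; rewrite /GRing.scale/=; ring.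
have Ix : intg gam (fun x => `|x|).
  apply: intg_norm; apply: intg_polygrowth => //.
  exists 1, 1%N => x; rewrite mul1r expr1 -(real_normK (num_real x)).
  by have := normr_ge0 x; nra.
have dw r : is_derive r (1 : R) w (- (s ^+ 2 * r) * w r).
  have H1 : r \in `]r - 1, r + 1[ by rewrite in_itv/=; apply/andP; split; lra.
  have D x y : derivable ((fun r x => cos (r * x + c)) ^~ y) x (1 : R).
    by have [] := dcos y x.
  have E x y : partial1of2 (fun r x => cos (r * x + c)) x y = - (y * sin (x * y + c)).
    by rewrite partial1of2E; apply: derive_val.
  have ub x y : `|partial1of2 (fun r x => cos (r * x + c)) x y| <= `|y|.
    by rewrite E normrN normrM ler_piMr// ler_norml sin_geN1 sin_le1.
  apply: DeriveDef.
    exact: (derivable_under_integral measurableT H1 (fun x _ => Icos x)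
      (fun x y _ _ => D x y) (@normr_ge0 _ _) Ix (fun x y _ _ => ub x y)).
  rewrite -derive1E (differentiation_under_integral measurableT H1 (fun x _ => Icos x)
      (fun x y _ _ => D x y) (@normr_ge0 _ _) Ix (fun x y _ _ => ub x y)).
  under eq_Rintegral do rewrite E.
  have -> : Ex gam (fun x => - (x * sin (r * x + c))) =
     - Ex gam (fun x => x * sin (r * x + c)).
    under eq_Rintegral do rewrite -mulN1r.
    rewrite ExZ ?mulN1r//; apply: le_intg Ix.
      by apply: measurable_funM => //; apply: measurable_sinD; exact: measurable_funM.
    by move=> x; rewrite normr_id normrM ler_piMr// ler_norml sin_geN1 sin_le1.
  have -> : Ex gam (fun x => x * sin (r * x + c)) =
      s ^+ 2 * Ex gam (fun x => r * cos (r * x + c)).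
    apply: (@normal_ibp _ _ s0).
  - by move=> x; apply: is_derive_eq; rewrite /GRing.scale/=; ring.
  - move=> x; apply: cvgM; first exact: cvg_cst.
    apply: continuous_comp; last exact: continuous_cos.
    by apply: cvgD; [apply: cvgM; [exact: cvg_cst|exact: cvg_id]|exact: cvg_cst].
  - exists 1, 0%N => x; by rewrite mulr1 ler_norml sin_geN1 sin_le1.
  - by exists `|r|, 0%N => x; rewrite mulr1 normrM ler_piMr// cos_sum_bounded.
  by rewrite ExZ//; rewrite /w; ring.
pose g t := w t * expR (s ^+ 2 * t ^+ 2 / 2).
have dg r : is_derive r (1 : R) g 0.
  have H := dw r.
  by apply: is_derive_eq; rewrite /GRing.scale/=; field.
have : g t = g 0 by exact: is_derive_0_is_cst.
rewrite /g expr0n/= mulr0 mul0r expR0 mulr1 => H.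
rewrite expRN -/(w t) -(mulfK (lt0r_neq0 (expR_gt0 (s ^+ 2 * t ^+ 2 / 2))) (w t)) H.
congr (_ / _); rewrite /w; under eq_Rintegral do rewrite mul0r add0r.
exact: Ex_cst.
Qed.

End gaussian_chf.

(** * Integrals against a law, and centered Gaussian variables *)

Section transfer.
Context {R : realType} {d d' : measure_display}.
Context {Omega : measurableType d} {T : measurableType d'}.
Variable P : probability Omega R.

Definition mfun_of (X : Omega -> T) (mX : measurable_fun setT X) : {mfun Omega >-> T} :=
  MeasurableFun.Pack (MeasurableFun.Class (isMeasurableFun.Build _ _ _ _ _ mX)).

(* [Q] is the law of [X] under [P]. *)
Lemma law_integral (Q : {measure set T -> \bar R}) (X : Omega -> T) (f : T -> R) :
  measurable_fun setT X -> (forall A, measurable A -> P (X @^-1` A) = Q A) ->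
  measurable_fun setT f ->
  (intg P (fun w => f (X w)) <-> intg Q f) /\
  (intg Q f -> Ex P (fun w => f (X w)) = Ex Q f).
Proof.
move=> mX HX mf; pose D := distribution P (mfun_of mX).
have mfE : measurable_fun setT (EFin \o f) by exact/measurable_EFinP.
have HD (g : T -> \bar R) : (\int[Q]_x g x = \int[D]_x g x)%E.
  by apply: eq_measure_integral => A mA _; exact: (esym (HX A mA)).
have I1 : intg P (fun w => f (X w)) <-> intg Q f.
  have H : (\int[P]_w `|(f (X w))%:E| = \int[Q]_x `|(f x)%:E|)%E.
    by rewrite HD ge0_integral_distribution//; exact: measurableT_comp.
  split=> /integrableP[_ Hf]; apply/integrableP; split; rewrite ?H// -?H//.
  by apply/measurable_EFinP; exact: measurableT_comp.
split=> // If; congr fine; rewrite HD integral_distribution//.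
exact/I1.
Qed.

End transfer.

Section centered_gaussian_law.
Context {R : realType} {d : measure_display} {Omega : measurableType d}.
Variable P : probability Omega R.

Lemma gaussian_integral (X : Omega -> R) (v : R) (f : R -> R) :
  centered_gaussian P X v -> v != 0 -> measurable_fun setT f ->
  intg (normal_prob 0 (Num.sqrt v)) f ->
  intg P (fun w => f (X w)) /\
  Ex P (fun w => f (X w)) = Ex (normal_prob 0 (Num.sqrt v)) f.
Proof.
move=> [mX [v0 +]] vn0; rewrite (negbTE vn0) => HX mf If.
have [I1 I2] := law_integral (Q := normal_prob 0 (Num.sqrt v)) mX HX mf.
by split; [exact/I1|exact: I2].
Qed.

(** The degenerate case [v = 0] is included, since it occurs for the linear combination with zero
    coefficients; there [X] vanishes almost surely and both sides are [cos c]. *)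
Lemma gaussian_chf (X : Omega -> R) (v : R) (c : R) :
  centered_gaussian P X v ->
  Ex P (fun w => cos (X w + c)) = cos c * expR (- (v / 2)).
Proof.
move=> GX; have [v0|v0] := eqVneq v 0.
  case: GX => mX [_]; rewrite v0 eqxx => HX.
  rewrite mul0r oppr0 expR0 mulr1 -[RHS](Ex_cst P).
  have mc (Y : Omega -> R) : measurable_fun setT Y -> measurable_fun setT (fun w => (cos (Y w + c))%:E).
    move=> mY; apply/measurable_EFinP; exact: measurable_cosD.
  congr fine; apply: ae_eq_integral => //; first exact: mc.
  exists [set w | X w != 0]; split => //.
    rewrite (_ : mkset _ = X @^-1` [set~ 0]); last first.
      by apply/seteqP; split=> x /eqP.
    by rewrite -[_ @^-1` _]setTI; apply: mX => //; exact: measurableC.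
  move=> w /= /not_implyP[_ H]; apply/eqP => Xw; apply: H.
  by rewrite Xw add0r.
have s0 : Num.sqrt v != 0 :> R.
  by rewrite sqrtr_eq0 -ltNge lt0r v0/=; case: GX => _ [].
have mc : measurable_fun setT (fun x : R => cos (1 * x + c)).
  by apply: measurable_cosD; exact: measurable_funM.
have [] := gaussian_integral GX v0 mc _.
  by apply: (@intg_bounded _ _ _ _ _ 1) => // x; exact: cos_sum_bounded.
move=> _; under eq_Rintegral do rewrite mul1r.
move=> ->; rewrite normal_chf// expr1n mulr1 sqr_sqrtr//.
by case: GX => _ [].
Qed.

Lemma gaussian_allmom (X : Omega -> R) (v : R) :
  centered_gaussian P X v -> allmom P X.
Proof.
move=> GX; have mX : measurable_fun setT X by case: GX.
split=> // M; have mM : measurable_fun setT (fun x : R => `|x| ^+ M).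
  exact: measurable_normX.
have [v0|v0] := eqVneq v 0; last first.
  have s0 : Num.sqrt v != 0 :> R.
    by rewrite sqrtr_eq0 -ltNge lt0r v0/=; case: GX => _ [].
  apply: (gaussian_integral GX v0 mM _).1.
  apply: intg_polygrowth => //; exists 1, M => x.
  rewrite normrX normr_id mul1r lerXn2r ?nnegrE ?addr_ge0 ?sqr_ge0//.
  by rewrite -(real_normK (num_real x)); have := normr_ge0 x; nra.
case: GX => _ [_]; rewrite v0 eqxx => HX.
have mXM : measurable_fun setT (fun w => (`|X w| ^+ M)%:E).
  by apply/measurable_EFinP; exact: measurableT_comp mM mX.
apply/integrableP; split => //.
rewrite (@ae_eq_integral _ _ _ P _ (fun w => (`|(0 : R)| ^+ M)%:E)) //.
- by rewrite integral_cst// [X in (_ * X)%E](_ : _ = 1%E) ?mule1 ?ltry//; exact: probability_setT.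
- exact: measurableT_comp mXM.
- exists [set w | X w != 0]; split => //.
    rewrite (_ : mkset _ = X @^-1` [set~ 0]); last first.
      by apply/seteqP; split=> x /eqP.
    by rewrite -[_ @^-1` _]setTI; apply: mX => //; exact: measurableC.
  move=> w /= /not_implyP[_ H]; apply/eqP => Xw; apply: H.
  by rewrite /= Xw normr0 ger0_norm// exprn_ge0.
Qed.

End centered_gaussian_law.

Lemma cvgn_le_cst (R : realType) (u : nat -> R) (l K : R) :
  u @ \oo --> l -> (forall m, u m <= K) -> l <= K.
Proof.
move=> cu uK; rewrite -(cvg_lim _ cu)//.
by apply: limr_le; [exact: cvgP cu|exact: nearW].
Qed.

(** * Gaussian integration by parts for a Gaussian sequence *)

Section threshold.
Variable R : realType.
Implicit Types (c x : R).

Lemma bernoulli_le (z : R) m : 0 <= z -> 1 + m%:R * z <= (1 + z) ^+ m.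
Proof.
move=> z0; elim: m => [|m IH]; first by rewrite mul0r addr0 expr0.
rewrite exprS; apply: le_trans (ler_wpM2l (addr_ge0 ler01 z0) IH).
by rewrite -natr1; have := mulr_ge0 (ler0n R m) (mulr_ge0 z0 z0); nra.
Qed.

Lemma bernoulli_sub_le x m : 0 <= x <= 1 -> 1 - m%:R * x <= (1 - x) ^+ m.
Proof.
move=> /andP[x0 x1]; elim: m => [|m IH]; first by rewrite mul0r subr0 expr0.
rewrite exprS; apply: le_trans (ler_wpM2l _ IH); last by rewrite subr_ge0.
by rewrite -natr1; have := mulr_ge0 (ler0n R m) (mulr_ge0 x0 x0); nra.
Qed.

(** With [y = sqrt x] and [1 / y = 1 + z], Bernoulli's inequality bounds [m y^m] by [1 / z], and the
    remaining factor [y^m] tends to 0. *)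
Lemma cvg_natM_geom x : 0 <= x < 1 -> m%:R * x ^+ m @[m --> \oo] --> (0 : R).
Proof.
move=> /andP[x0 x1]; have [->|xn0] := eqVneq x 0.
  apply: cvg_near_cst; apply: nearW => -[|m]; first by rewrite mul0r.
  by rewrite exprS mul0r mulr0.
have xp : 0 < x by rewrite lt0r xn0.
pose y := Num.sqrt x; have y0 : 0 < y by rewrite sqrtr_gt0.
have yy : y ^+ 2 = x by rewrite sqr_sqrtr.
have y1 : y < 1 by rewrite -sqrtr1 ltr_sqrt.
pose z := y^-1 - 1; have z0 : 0 < z by rewrite subr_gt0 invf_gt1.
have cy : z^-1 * y ^+ m @[m --> \oo] --> (0 : R).
  rewrite -[X in _ --> X](mulr0 z^-1); apply: cvgMr; apply: cvg_expr.
  by rewrite ger0_norm// ltW.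
apply: squeeze_cvgr cy; last exact: cvg_cst.
apply: nearW => m; rewrite mulr_ge0 ?exprn_ge0//=.
rewrite -yy -exprM mul2n -addnn exprD mulrA ler_wpM2r ?exprn_ge0 ?(ltW y0)//.
rewrite -[leRHS]mulr1 ler_pdivlMl//.
apply: (@le_trans _ _ ((1 + z) ^+ m * y ^+ m)); last first.
  by rewrite -exprMn /z addrC subrK mulVf ?gt_eqF// expr1n.
rewrite mulrA ler_wpM2r ?exprn_ge0 ?(ltW y0)//.
by apply: le_trans (bernoulli_le m (ltW z0)); rewrite mulrC lerDr.
Qed.

(* The exponent [m 2^m], rather than [2^m], makes the limit vanish at the threshold itself. *)
Lemma cvg_threshold c : 0 <= c <= 1 ->
  (1 - c ^+ m) ^+ (m * 2 ^ m) @[m --> \oo] --> (((c < 1 / 2)%R)%:R : R).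
Proof.
move=> /andP[c0 c1].
have cm m : 0 <= c ^+ m <= 1 by rewrite exprn_ge0 ?exprn_ile1.
have sub0 m : 0 <= 1 - c ^+ m by have := cm m; lra.
(* Below the threshold, Bernoulli's inequality gives the lower bound [1 - m (2 c)^m]. From the
   threshold on, [1 - t <= e^(-t)] and [(2 c)^m >= 1] give the upper bound [e^(-m)]. *)
have [c2|c2] := ltP c (1 / 2).
  have H : 1 - m%:R * (2 * c) ^+ m @[m --> \oo] --> (1 : R).
    rewrite -[X in _ --> X](subr0 1); apply: cvgB; first exact: cvg_cst.
    by apply: cvg_natM_geom; apply/andP; split; lra.
  apply: squeeze_cvgr H (cvg_cst _).
  apply: nearW => m; apply/andP; split; last first.
    by rewrite exprn_ile1//; have := cm m; lra.
  apply: le_trans (bernoulli_sub_le _ (cm m)).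
  by rewrite natrM natrX exprMn mulrA.
have H : (expR (-1)) ^+ m @[m --> \oo] --> (0 : R).
  by apply: cvg_expr; rewrite ger0_norm ?expR_ge0// expR_lt1 oppr_lt0.
apply: squeeze_cvgr H; last exact: cvg_cst.
apply: nearW => m; rewrite exprn_ge0//=.
apply: (@le_trans _ _ (expR (- c ^+ m) ^+ (m * 2 ^ m))).
  by rewrite lerXn2r ?nnegrE ?expR_ge0// expR_ge1Dx.
rewrite -!expRM_natl ler_expR mulrN mulrN1 lerN2 natrM -mulrA ler_peMr//.
rewrite natrX -exprMn exprn_ege1//; lra.
Qed.

(** For large [m] the argument lies in []-1, 1[], inside []-pi, pi[], where the sine has the sign of
    its argument. *)
Lemma cvg_sin_sign (u : R) :
  (((0 < sin (m.+1%:R^-1 * u))%R)%:R : R) @[m --> \oo] --> (((0 < u)%R)%:R : R).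
Proof.
apply: cvg_near_cst; exists (Num.bound `|u|) => // m /= um.
have m0 : 0 < m.+1%:R^-1 :> R by rewrite invr_gt0.
have um1 : `|m.+1%:R^-1 * u| < 1.
  rewrite normrM gtr0_norm// mulrC ltr_pdivrMr// mul1r.
  by rewrite (lt_trans (archi_boundP _))// ltr_nat; exact: leq_ltn_trans um _.
move: um1; rewrite ltr_norml => /andP[u1 u2].
have pi1 : (1 : R) < pi by rewrite (lt_le_trans _ (pi_ge2 R))// ltr1n.
congr ((nat_of_bool _)%:R); have [u0|u0|->] := ltgtP u 0; move: u1 pi1.
- move=> u1 pi1; apply/negbTE; rewrite -leNgt -[X in sin X]opprK sinN oppr_le0 sin_ge0_pi//.
  move: u1 pi1; set v := _ * u => u1 pi1; apply/andP; split; last by lra.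
  by rewrite oppr_ge0 pmulr_rle0// ltW.
- set v := _ * u => u1 pi1; rewrite sin_gt0_pi//; apply/andP; split; [exact: mulr_gt0|].
  exact: lt_trans u2 pi1.
- by rewrite mulr0 sin0 ltxx.
Qed.

End threshold.

(** * From cosines to indicators: orthogonality to a generated sigma-algebra *)

Section trigonometric_orthogonality.
Context {R : realType} {d : measure_display} {Omega : measurableType d}.
Variables (P : probability Omega R) (Y : nat -> Omega -> R).
Hypothesis mY : forall j, measurable_fun setT (Y j).
Implicit Types W : Omega -> R.

Definition lincomb n (th : nat -> R) w := \sum_(j < n) th j * Y j w.

(** Zero correlation with every trigonometric polynomial in the [Y j]. The free phase [c] covers
    sines and closes the class under multiplication by cosines; [n = 0] with [c = 0] says that [W]
    has mean 0. The bound on [W] serves to pass to pointwise limits. *)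
Definition trig_orth W := [/\ measurable_fun setT W, exists K : R, forall w, `|W w| <= K &
  forall n th c, Ex P (fun w => W w * cos (lincomb n th w + c)) = 0].

Lemma measurable_lincomb n th : measurable_fun setT (lincomb n th).
Proof. by apply: measurable_sum => j; exact: measurable_funM. Qed.

Lemma intg_mul_cos W n th c : measurable_fun setT W ->
  (exists K : R, forall w, `|W w| <= K) -> intg P (fun w => W w * cos (lincomb n th w + c)).
Proof.
move=> mW [K WK]; apply: (@intg_bounded _ _ _ _ _ K).
  by apply: measurable_funM => //; apply: measurable_cosD; exact: measurable_lincomb.
by move=> w; rewrite normrM (le_trans _ (WK w))// ler_piMr// cos_sum_bounded.
Qed.

Lemma trig_orthB W1 W2 : trig_orth W1 -> trig_orth W2 -> trig_orth (fun w => W1 w - W2 w).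
Proof.
move=> [m1 b1 H1] [m2 b2 H2]; split; first exact: measurable_funB.
  case: b1 b2 => [K1 b1] [K2 b2]; exists (K1 + K2) => w.
  by rewrite (le_trans (ler_normB _ _))// lerD.
move=> n th c; under eq_Rintegral do rewrite mulrBl.
by rewrite ExB ?H1 ?H2 ?subrr//; exact: intg_mul_cos.
Qed.

Lemma trig_orthZ (k : R) W : trig_orth W -> trig_orth (fun w => k * W w).
Proof.
move=> [mW [K WK] H]; split; first exact: measurable_funM.
  by exists (`|k| * K) => w; rewrite normrM ler_wpM2l.
move=> n th c; under eq_Rintegral do rewrite -mulrA.
by rewrite ExZ ?H ?mulr0//; apply: intg_mul_cos => //; exists K.
Qed.

(** A product of two cosines is half the sum of the cosines of the sum and of the difference. Both
    arguments are again linear combinations of the [Y j] plus a phase, of length [N] so that the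
    index [j] fits in. *)
Lemma trig_orth_cos W j (b a : R) : trig_orth W ->
  trig_orth (fun w => W w * cos (b * Y j w + a)).
Proof.
move=> [mW [K WK] H]; split.
- by apply: measurable_funM => //; apply: measurable_cosD; exact: measurable_funM.
- by exists K => w; rewrite normrM (le_trans _ (WK w))// ler_piMr// cos_sum_bounded.
move=> n th c.
pose N := maxn n j.+1.
pose th' (s : R) := fun i => (if (i < n)%N then th i else 0) + (if i == j then s * b else 0).
have E s w : lincomb N (th' s) w = lincomb n th w + s * (b * Y j w).
  rewrite /lincomb /th'; under eq_bigr do rewrite mulrDl; rewrite big_split/=; congr (_ + _).
    rewrite [RHS](big_ord_widen N (fun i => th i * Y i w)) ?leq_maxl// [RHS]big_mkcond/=.
    by apply: eq_bigr => i _; case: ifP; rewrite ?mul0r.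
  have jN : (j < N)%N by rewrite leq_maxr.
  rewrite (bigD1 (Ordinal jN))//= eqxx big1 ?addr0 ?mulrA// => i ij.
  by rewrite ifF ?mul0r//; apply: contra_neqF ij => /eqP ij; apply/val_inj.
rewrite (@eq_Ex _ _ _ _ _ (fun w => 2^-1 * (W w * cos (lincomb N (th' 1) w + (c + a)) +
    W w * cos (lincomb N (th' (-1)) w + (c - a))))).
  by rewrite ExZ ?ExD ?H ?addr0 ?mulr0//; try apply: intgD; apply: intg_mul_cos => //; exists K.
move=> w; rewrite !E.
set A := lincomb n th w; set B := b * Y j w.
have -> : A + 1 * B + (c + a) = (A + c) + (B + a) by ring.
have -> : A + -1 * B + (c - a) = (A + c) - (B + a) by ring.
by rewrite (cosD (A + c)) (cosB (A + c)); field.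
Qed.

Lemma trig_orth_lim (W_ : nat -> Omega -> R) W K : (forall m, trig_orth (W_ m)) ->
  (forall m w, `|W_ m w| <= K) -> (forall w, W_ ^~ w @ \oo --> W w) -> trig_orth W.
Proof.
move=> HW HK cW.
have mW : measurable_fun setT W.
  by apply: (measurable_fun_cvg (h := W_)) => [m|w _]; [by case: (HW m)|exact: cW].
split=> //.
  exists K => w; have : `|W_ m w| @[m --> \oo] --> `|W w| by apply: cvg_norm; exact: cW.
  by move=> /cvgn_le_cst; apply => m; exact: HK.
move=> n th c; have mc : measurable_fun setT (fun w => cos (lincomb n th w + c)).
  by apply: measurable_cosD; exact: measurable_lincomb.
have m_ m : measurable_fun setT (fun w => (W_ m w * cos (lincomb n th w + c))%:E).
  by apply/measurable_EFinP; apply: measurable_funM => //; case: (HW m).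
have m0 : measurable_fun setT (fun w => (W w * cos (lincomb n th w + c))%:E).
  by apply/measurable_EFinP; apply: measurable_funM.
have cv : {ae P, forall w, setT w -> (fun m => (W_ m w * cos (lincomb n th w + c))%:E) @ \oo -->
    (W w * cos (lincomb n th w + c))%:E}.
  by apply: aeW => w _; apply: cvg_EFin; [exact: nearW|apply: cvgM (cW w) (cvg_cst _)].
have bd : {ae P, forall w m, setT w -> (`|(W_ m w * cos (lincomb n th w + c))%:E| <= K%:E)%E}.
  apply: aeW => w m _; rewrite /= lee_fin normrM (le_trans _ (HK m w))//.
  by rewrite ler_piMr// cos_sum_bounded.
have [_ _] := dominated_convergence measurableT m_ m0 cv (intg_cst P K) bd.
have -> : [sequence \int[P]_x (W_ m x * cos (lincomb n th x + c))%:E]_m%E = (fun=> 0%E).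
  apply/funext => m/=; have [mm bm Hm] := HW m.
  by rewrite -(EFin_Ex (intg_mul_cos _ _ _ mm bm)) Hm.
by move=> /(cvg_lim (@ereal_hausdorff R)) L; rewrite /Rintegral -L lim_cst.
Qed.

(** One factor of the threshold polynomial [(1 - q^m)^(m 2^m)], where [q = (1 + cos) / 2] takes its
    values in [[0, 1]]. *)
Lemma trig_orth_sub_mul W j (b a : R) m : trig_orth W ->
  trig_orth (fun w => W w * (1 - ((1 + cos (b * Y j w + a)) / 2) ^+ m)).
Proof.
move=> HW.
have H k : trig_orth (fun w => W w * ((1 + cos (b * Y j w + a)) / 2) ^+ k).
  elim: k => [|k IH]; first by under eq_fun do rewrite expr0 mulr1.
  have /(trig_orthZ (- 2^-1)) H := trig_orth_cos j b a IH.
  have := trig_orthB (trig_orthZ 2^-1 IH) H.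
  by congr trig_orth; apply/funext => w; rewrite exprS; field.
have := trig_orthB HW (H m).
by congr trig_orth; apply/funext => w; ring.
Qed.

(** Two limits. Threshold polynomials in [q = (1 + cos) / 2] converge to the indicator of [q < 1/2],
    that is of a negative cosine. A phase [pi / 2] turns this into the indicator of
    [sin ((Y j - b) / (m + 1)) > 0], which for large [m] is that of [Y j > b]. *)
Lemma trig_orth_gt W j (b : R) : trig_orth W ->
  trig_orth (fun w => W w * ((b < Y j w)%R)%:R).
Proof.
move=> HW; have [mW [K WK] _] := HW.
have bnd w (y : R) : 0 <= y <= 1 -> `|W w * y| <= K.
  by move=> /andP[y0 y1]; rewrite normrM (le_trans _ (WK w))// ler_piMr// ger0_norm.
have H1 (s a : R) : trig_orth (fun w => W w * ((cos (s * Y j w + a) < 0)%R)%:R).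
  pose q w := (1 + cos (s * Y j w + a)) / 2.
  have q01 w : 0 <= q w <= 1.
    have := cos_sum_bounded (s * Y j w + a); rewrite ler_norml /q => /andP[h1 h2].
    by apply/andP; split; lra.
  apply: (@trig_orth_lim (fun m w => W w * (1 - q w ^+ m) ^+ (m * 2 ^ m)) _ K).
  - move=> m; elim: (m * 2 ^ m)%N => [|k IH]; first by under eq_fun do rewrite expr0 mulr1.
    under eq_fun do rewrite exprSr mulrA.
    exact: trig_orth_sub_mul.
  - move=> m w; apply: bnd; have /andP[q0 q1] := q01 w.
    have : 0 <= 1 - q w ^+ m <= 1 by rewrite subr_ge0 exprn_ile1//= lerBlDr lerDl exprn_ge0.
    by move=> /andP[h1 h2]; rewrite exprn_ge0// exprn_ile1.
  - move=> w; apply: cvgM; first exact: cvg_cst.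
    have := cvg_threshold (q01 w); rewrite (_ : (q w < 1 / 2) = (cos (s * Y j w + a) < 0))//.
    by rewrite /q; apply/idP/idP => ?; lra.
apply: (@trig_orth_lim (fun m w => W w *
   ((cos (m.+1%:R^-1 * Y j w + (pi / 2 - m.+1%:R^-1 * b)) < 0)%R)%:R) _ K).
- by move=> m; exact: H1.
- by move=> m w; apply: bnd; case: (_ < _); rewrite ?lexx ler01.
- move=> w; apply: cvgM; first exact: cvg_cst.
  rewrite -[b < _]subr_gt0.
  have E : (fun m : nat => ((cos (m.+1%:R^-1 * Y j w + (pi / 2 - m.+1%:R^-1 * b)) < 0)%R)%:R : R) =
      (fun m => ((0 < sin (m.+1%:R^-1 * (Y j w - b)))%R)%:R).
    apply/funext => m; congr ((nat_of_bool _)%:R).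
    rewrite (_ : _ + _ = m.+1%:R^-1 * (Y j w - b) + pi / 2); last by ring.
    by rewrite cosDpihalf oppr_lt0.
  by rewrite E; exact: cvg_sin_sign.
Qed.

Definition trig_gen : set (set Omega) :=
  [set A | exists j b, A = [set w | b < Y j w]].

(** The sets [G] whose indicator may multiply every [W] of the class form a sigma-algebra.
    Quantifying over all [W] is what makes the property multiplicative, so that intersections of
    generators are included. *)
Lemma trig_orth_indic (G : set Omega) W : <<s trig_gen >> G -> trig_orth W ->
  measurable G /\ trig_orth (fun w => W w * \1_G w).
Proof.
move=> sG; suff: <<s trig_gen >> `<=` [set G | measurable G /\
    forall W, trig_orth W -> trig_orth (fun w => W w * \1_G w)].
  by move=> /(_ _ sG)[mG H] HW; split => //; exact: H.
apply: smallest_sub; last first.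
  move=> _ [j [b ->]]; split.
    have : measurable ([set: Omega] `&` Y j @^-1` `]b, +oo[%classic) by exact: mY.
    rewrite setTI; congr measurable; by apply/seteqP; split=> w /=; rewrite in_itv/= andbT.
  move=> V HV; have := trig_orth_gt j b HV; congr trig_orth.
  apply/funext => w; rewrite indicE; congr (_ * (nat_of_bool _)%:R).
  by apply/idP/idP; rewrite inE.
split.
- split; first exact: measurable0.
  move=> V HV; have := trig_orthB HV HV; congr trig_orth.
  by apply/funext => w; rewrite indic0 mulr0 subrr.
- move=> A [mA HA]; split; first exact: measurableD.
  move=> V HV; have := trig_orthB HV (HA _ HV); congr trig_orth.
  apply/funext => w; rewrite -{1}[V w]mulr1 -mulrBr setTD; congr (_ * _).
  by rewrite !indicE in_setC; case: (w \in A); rewrite ?subrr ?subr0.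
- move=> F HF; have mF k : measurable (F k) by case: (HF k).
  split; first exact: bigcup_measurable.
  move=> V HV; have [mV [K VK] _] := HV.
  (* The indicator of the complement of the union is the limit of these finite products, each of
     which stays in the class after multiplication by [V]. *)
  pose U m w : R := \prod_(k < m) (1 - \1_(F k) w).
  have U01 m w : 0 <= U m w <= 1.
    rewrite /U; elim: m => [|m IH]; first by rewrite big_ord0 ler01 lexx.
    rewrite big_ord_recr/= indicE; case: (_ \in _); rewrite ?subrr ?mulr0 ?lexx ?ler01//.
    by rewrite subr0 mulr1.
  have HU m : trig_orth (fun w => V w * U m w).
    elim: m => [|m IH]; first by under eq_fun do rewrite /U big_ord0 mulr1.
    have := trig_orthB IH ((HF m).2 _ IH); congr trig_orth.
    by apply/funext => w; rewrite /U big_ord_recr/=; ring.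
  have HC : trig_orth (fun w => V w * (1 - \1_(\bigcup_k F k) w)).
    apply: (@trig_orth_lim _ _ K) HU _ _ => [m w|w].
      have /andP[u0 u1] := U01 m w.
      by rewrite normrM (le_trans _ (VK w))// ler_piMr// ger0_norm.
    apply: cvgM; first exact: cvg_cst.
    rewrite indicE; have [wF|wF] := boolP (w \in _).
      move: wF; rewrite inE => -[k _ Fkw]; rewrite subrr.
      apply: cvg_near_cst; exists k.+1 => // m /= km.
      rewrite /U (bigD1 (Ordinal km))//= indicE mem_set// subrr mul0r//.
    rewrite subr0; apply: cvg_near_cst; apply: nearW => m.
    rewrite /U big1// => k _; rewrite indicE memNset ?subr0// => Fkw.
    by move/negP: wF; apply; rewrite inE; exists k.
  have := trig_orthB HV HC; congr trig_orth; apply/funext => w; ring.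
Qed.

End trigonometric_orthogonality.

Lemma measurable_trig_gen (R : realType) d (Omega : measurableType d)
    (Y : nat -> Omega -> R) j :
  measurable_fun setT (Y j : g_sigma_algebraType (trig_gen Y) -> R).
Proof.
apply: (measurability _ (RGenOInfty.measurableE R)) => _ [_ [b ->] <-].
rewrite setTI; apply: sub_sigma_algebra; exists j, b.
by apply/seteqP; split=> w /=; rewrite in_itv/= andbT.
Qed.

(** * Regression on one coordinate and integration by parts *)

Section gaussian_family.
Context {R : realType} {d : measure_display} {Omega : measurableType d}.
Variables (P : probability Omega R) (X : nat -> Omega -> R) (C : nat -> nat -> R).
Hypothesis gaussX : forall n th, centered_gaussian P (lincomb X n th)
  (\sum_(i < n) \sum_(j < n) th i * th j * C i j).
Hypothesis Csym : forall i j, C i j = C j i.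
Hypothesis Cdiag : forall i, C i i = 1.

Lemma gaussian_family_coord k : centered_gaussian P (X k) 1.
Proof.
have := gaussX k.+1 (fun i => (i == k)%:R).
have E w : lincomb X k.+1 (fun i => (i == k)%:R) w = X k w.
  rewrite /lincomb big_ord_recr/= eqxx mul1r big1 ?add0r// => i _.
  by rewrite (ltn_eqF (ltn_ord i)) mul0r.
rewrite (_ : lincomb _ _ _ = X k); last exact/funext.
congr centered_gaussian; rewrite big_ord_recr/= [X in X + _]big1 ?add0r.
  rewrite big_ord_recr/= eqxx big1 ?add0r ?Cdiag ?mulr1// => i _.
  by rewrite (ltn_eqF (ltn_ord i)) mulr0 mul0r.
by move=> i _; rewrite big1// => j _; rewrite (ltn_eqF (ltn_ord i)) !mul0r.
Qed.

Lemma gaussian_family_allmom k : allmom P (X k).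
Proof. exact: gaussian_allmom (gaussian_family_coord k). Qed.

Lemma gaussian_family_meas k : measurable_fun setT (X k).
Proof. exact: allmom_meas (gaussian_family_allmom k). Qed.

Let mX := gaussian_family_meas.

Section residual.
Variable k : nat.

(** What regression of [X j] on [X k] leaves over; the coefficient is the covariance itself because
    [X k] has variance 1. *)
Definition residual j w := X j w - C k j * X k w.

Lemma measurable_residual j : measurable_fun setT (residual j).
Proof. by apply: measurable_funB => //; exact: measurable_funM. Qed.

Lemma sum_if_eq N (j : 'I_N) (t : R) (f : nat -> R) :
  \sum_(i < N) (if i == j :> nat then t else 0) * f i = t * f j.
Proof.
rewrite (bigD1 j)//= eqxx big1 ?addr0// => i ij.
by rewrite ifF ?mul0r//; apply: contra_neqF ij => /eqP ij; apply/val_inj.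
Qed.

(* Linear combinations of the residuals are uncorrelated with [X k]. *)
Lemma residual_chf n th : exists Q : R, forall s c,
  Ex P (fun w => cos (lincomb residual n th w + s * X k w + c)) =
  cos c * expR (- (Q / 2)) * expR (- (s ^+ 2 / 2)).
Proof.
pose N := maxn n k.+1; have kN : (k < N)%N by rewrite leq_maxr.
pose K := Ordinal kN.
pose a i := if (i < n)%N then th i else 0.
pose m := \sum_(i < N) a i * C i k.
pose A := \sum_(i < N) \sum_(j < N) a i * a j * C i j.
(* [A] is the variance of the combination of the [X i], and [m] its covariance with [X k]. Rewritten
   in the [X i] alone, the argument gives [X k] an extra coefficient [s - m], and its variance is
   [(A - m^2) + s^2]. *)
exists (A - m ^+ 2) => s c.
pose tau i := a i + (if i == k then s - m else 0).
have sumN (f : nat -> R) : \sum_(i < n) th i * f i = \sum_(i < N) a i * f i.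
  rewrite (big_ord_widen N (fun i => th i * f i)) ?leq_maxl// big_mkcond/=.
  by apply: eq_bigr => i _; rewrite /a; case: ifP; rewrite ?mul0r.
have E w : lincomb residual n th w + s * X k w = lincomb X N tau w.
  rewrite {1}/lincomb (sumN (fun i => residual i w)) /lincomb /tau /residual.
  under [RHS]eq_bigr do rewrite mulrDl.
  rewrite big_split/= (sum_if_eq K (s - m) (fun i => X i w))/=.
  under eq_bigr do rewrite mulrBr.
  rewrite sumrB mulrBl -/m.
  have -> : \sum_(i < N) a i * (C k i * X k w) = m * X k w.
    by rewrite mulr_suml; apply: eq_bigr => i _; rewrite (Csym k) mulrA.
  by ring.
have Q : \sum_(i < N) \sum_(j < N) tau i * tau j * C i j = A - m ^+ 2 + s ^+ 2.
  have H i : \sum_(j < N) tau i * tau j * C i j =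
      tau i * (\sum_(j < N) a j * C i j + (s - m) * C i k).
    rewrite -(sum_if_eq K (s - m) (fun j => C i j)) -big_split/= mulr_sumr.
    by apply: eq_bigr => j _; rewrite /tau -mulrDl mulrA.
  under eq_bigr do rewrite H /tau mulrDl.
  rewrite big_split/= (sum_if_eq K (s - m)
    (fun i => \sum_(j < N) a j * C i j + (s - m) * C i k))/= Cdiag.
  under eq_bigr do rewrite mulrDr.
  rewrite big_split/=.
  have -> : \sum_(i < N) a i * ((s - m) * C i k) = (s - m) * m.
    by rewrite mulr_sumr; apply: eq_bigr => i _; ring.
  have -> : \sum_(j < N) a j * C k j = m.
    by apply: eq_bigr => j _; rewrite Csym.
  have -> : \sum_(i < N) a i * (\sum_(j < N) a j * C i j) = A.
    by apply: eq_bigr => i _; rewrite mulr_sumr; apply: eq_bigr => j _; rewrite mulrA.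
  by ring.
under eq_Rintegral do rewrite E.
by rewrite (gaussian_chf c (gaussX N tau)) Q -mulrA -expRD; congr (_ * expR _); field.
Qed.

Lemma intg_indic (A : set Omega) : measurable A -> intg P (\1_A : Omega -> R).
Proof. by move=> mA; apply: integrable_indic. Qed.

Lemma Ex_indic (A : set Omega) : measurable A -> (Ex P \1_A)%:E = P A.
Proof. by move=> mA; rewrite EFin_Ex; [rewrite integral_indic// setIT|exact: intg_indic]. Qed.

(** The joint characteristic function factorizes, and indicators are introduced one side at a time.
    A centered cosine of the residuals is orthogonal to cosines of [X k], hence to the indicator of
    [G]. So the centered indicator of [G] is orthogonal to cosines of the residuals, hence to the
    indicator of [F]. *)
Lemma residual_indep (A : set R) (F : set Omega) : measurable A ->
  <<s trig_gen residual >> F ->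
  P (X k @^-1` A `&` F) = (P (X k @^-1` A) * P F)%E.
Proof.
move=> mA sF; set G := X k @^-1` A.
have mG : measurable G by rewrite -[G]setTI; exact: mX.
have sG : <<s trig_gen (fun _ : nat => X k) >> G.
  rewrite -[G]setTI.
  exact: (@measurable_trig_gen _ _ _ (fun=> X k) 0%N measurableT A mA).
have [pG pG0] : exists p, Ex P \1_G = p by eexists.
have bcos n th c : measurable_fun setT (fun w => cos (lincomb residual n th w + c)).
  by apply: measurable_cosD; apply: measurable_lincomb; exact: measurable_residual.
have Icos n th c : intg P (fun w => cos (lincomb residual n th w + c)).
  by apply: (@intg_bounded _ _ _ _ _ 1) => [|w]; [exact: bcos|exact: cos_sum_bounded].
have cosM (x y : R) : cos x * cos y = 2^-1 * (cos (x + y) + cos (x - y)).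
  by rewrite cosD cosB; field.
(* The constant family [X k] plays the role of [Y]. The product-to-sum formula leads to
   [residual_chf] at [s] and [-s], where the factor depending on [s] is the same. *)
have step1 n th c : trig_orth P (fun _ : nat => X k) (fun w =>
    cos (lincomb residual n th w + c) - Ex P (fun w => cos (lincomb residual n th w + c))).
  split.
  - by apply: measurable_funB.
  - by eexists => w; exact: le_trans (ler_normB _ _) (lerD (cos_sum_bounded _) (lexx _)).
  move=> n' th' c'.
  pose s := \sum_(i < n') th' i.
  have Es w : lincomb (fun=> X k) n' th' w = s * X k w by rewrite /lincomb mulr_suml.
  have [Q HQ] := residual_chf n th.
  have E1 : Ex P (fun w => cos (lincomb residual n th w + c)) = cos c * expR (- (Q / 2)).
    have := HQ 0 c; rewrite expr0n mul0r oppr0 expR0 mulr1 => <-.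
    by apply: eq_Ex => w; rewrite mul0r addr0.
  have mcos' : measurable_fun setT (fun w => cos (s * X k w + c')).
    by apply: measurable_cosD; exact: measurable_funM.
  have E2 : Ex P (fun w => cos (s * X k w + c')) = cos c' * expR (- (s ^+ 2 / 2)).
    (* With no residuals, [residual_chf] is the characteristic function of [X k] alone; its unknown
       [Q'] is eliminated by evaluating at [s = 0] and phase 0. *)
    have [Q' HQ'] := residual_chf 0 th.
    have H0 := HQ' 0 0; have Hs := HQ' s c'.
    have e1 : cos 0 * expR (- (Q' / 2)) * expR (- (0 ^+ 2 / 2)) = (1 : R).
      rewrite -H0 -(Ex_cst P 1); apply: eq_Ex => w.
      by rewrite /lincomb big_ord0 mul0r !addr0 cos0.
    move: e1; rewrite cos0 mul1r expr0n mul0r oppr0 expR0 mulr1 => e1.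
    move: Hs; rewrite e1 mulr1 => <-; apply: eq_Ex => w.
    by rewrite /lincomb big_ord0 add0r.
  have Icos' : intg P (fun w => cos (s * X k w + c')).
    by apply: (@intg_bounded _ _ _ _ _ 1) => [|w]; [exact: mcos'|exact: cos_sum_bounded].
  have mcs (t b : R) : measurable_fun setT (fun w => cos (lincomb residual n th w + t * X k w + b)).
    apply: measurable_cosD; apply: measurable_funD; last exact: measurable_funM.
    by apply: measurable_lincomb; exact: measurable_residual.
  have Ics (t b : R) : intg P (fun w => cos (lincomb residual n th w + t * X k w + b)).
    by apply: (@intg_bounded _ _ _ _ _ 1) => [|w]; [exact: mcs|exact: cos_sum_bounded].
  rewrite E1 (@eq_Ex _ _ _ _ _ (fun w =>
    2^-1 * (cos (lincomb residual n th w + s * X k w + (c + c')) +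
            cos (lincomb residual n th w + (- s) * X k w + (c - c'))) -
    cos c * expR (- (Q / 2)) * cos (s * X k w + c'))); last first.
    move=> w; rewrite Es mulrBl cosM; congr (_ * (cos _ + cos _) - _); ring.
  rewrite ExB; [|by apply: intgZ; exact: intgD|exact: intgZ].
  rewrite (ExZ 2^-1 (intgD (Ics s (c + c')) (Ics (- s) (c - c')))) (ExD (Ics _ _) (Ics _ _)).
  by rewrite (ExZ _ Icos') !HQ E2 sqrrN cosD cosB; field.
have mI (B : set Omega) : measurable B -> measurable_fun setT (\1_B : Omega -> R).
  by move=> mB; exact: measurable_indic.
have I01 (B : set Omega) w : `|\1_B w| <= 1 :> R.
  by rewrite indicE; case: (_ \in _); rewrite ?normr0 ?normr1.
have cos00 (Y : nat -> Omega -> R) th w : cos (lincomb Y 0 th w + 0) = 1.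
  by rewrite /lincomb big_ord0 addr0 cos0.
have step2 : trig_orth P residual (fun w => \1_G w - Ex P \1_G).
  split.
  - by apply: measurable_funB => //; exact: mI.
  - by eexists => w; exact: le_trans (ler_normB _ _) (lerD (I01 _ _) (lexx _)).
  move=> n th c; set e := Ex P \1_G.
  have [_ [_ _ /(_ 0%N (fun=> 0) 0)]] := trig_orth_indic (fun=> mX k) sG (step1 n th c).
  rewrite (@eq_Ex _ _ _ _ _ (fun w => \1_G w * cos (lincomb residual n th w + c) -
     Ex P (fun w => cos (lincomb residual n th w + c)) * \1_G w)); last first.
    by move=> w; rewrite cos00; ring.
  have IG := intg_indic mG.
  have I1 : intg P (fun w => \1_G w * cos (lincomb residual n th w + c)).
    by apply: (@intg_mul_bounded _ _ _ _ _ _ 1) => //; exact: mI.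
  rewrite ExB//; last exact: intgZ.
  rewrite ExZ// => /eqP; rewrite subr_eq0 => /eqP H.
  under eq_Rintegral do rewrite mulrBl.
  by rewrite ExB//; [rewrite ExZ// H mulrC subrr|exact: intgZ].
have [mF [_ _ /(_ 0%N (fun=> 0) 0)]] := trig_orth_indic measurable_residual sF step2.
rewrite (@eq_Ex _ _ _ _ _ (fun w => \1_(G `&` F) w - Ex P \1_G * \1_F w)); last first.
  move=> w; rewrite cos00 mulr1 mulrBl; congr (_ - _).
  by rewrite indicI.
have mGF : measurable (G `&` F) by exact: measurableI.
rewrite ExB; [|exact: intg_indic|by apply: intgZ; exact: intg_indic].
rewrite ExZ; last exact: intg_indic.
move=> /eqP; rewrite subr_eq0 => /eqP H.
by rewrite -!Ex_indic// H EFinM.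
Qed.

End residual.

(** Measurability of [g] along every measurable sequence of coordinates, on every space: it is
    evaluated on [Omega], on a product space and along lines in sequence space. *)
Definition bmeas (g : (nat -> R) -> R) := forall d' (T : measurableType d') (z : nat -> T -> R),
  (forall j, measurable_fun setT (z j)) -> measurable_fun setT (fun t => g (z ^~ t)).

Definition sqsum n (x : nat -> R) : R := 1 + \sum_(j < n) x j ^+ 2.

Definition fgrowth (g : (nat -> R) -> R) :=
  exists n K M, forall x, `|g x| <= K * sqsum n x ^+ M.

Definition shift (x c : nat -> R) (t : R) : nat -> R := fun j => x j + t * c j.

(* [dg c] is the derivative of [g] in the direction [c]. *)
Record smooth (g : (nat -> R) -> R) (dg : (nat -> R) -> (nat -> R) -> R) := {
  smooth_meas : bmeas g;
  smooth_dmeas : forall c, bmeas (dg c);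
  smooth_growth : fgrowth g;
  smooth_dgrowth : forall c, fgrowth (dg c);
  smooth_der : forall c x (t : R), is_derive t (1 : R) (fun t => g (shift x c t)) (dg c (shift x c t));
  smooth_cont : forall c x, continuous (fun t => dg c (shift x c t)) }.

Lemma sqsum_ge1 n x : 1 <= sqsum n x.
Proof. by rewrite lerDl sumr_ge0// => j _; exact: sqr_ge0. Qed.

Lemma allmom_fgrowth g : bmeas g -> fgrowth g -> allmom P (fun w => g (X ^~ w)).
Proof.
move=> mg [n [K [M HK]]]; have mgX : measurable_fun setT (fun w => g (X ^~ w)) by exact: mg.
have AS : allmom P (fun w => K * sqsum n (X ^~ w) ^+ M).
  apply: allmomM; first exact: allmom_cst.
  apply: allmomX; apply: allmomD; first exact: allmom_cst.
  by apply: allmom_sum => j; apply: allmomX; exact: gaussian_family_allmom.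
split=> // m; case: AS => _ /(_ m); apply: le_intg.
  by apply: measurable_funX; exact: measurableT_comp.
move=> w; rewrite !normrX !normr_id lerXn2r ?nnegrE//.
by rewrite (le_trans (HK _))// ler_norm.
Qed.

Lemma sqsum_shift n x c : exists2 K : R, 0 <= K & forall t,
  sqsum n (shift x c t) <= K * (1 + t ^+ 2).
Proof.
exists (1 + 2 * \sum_(j < n) x j ^+ 2 + 2 * \sum_(j < n) c j ^+ 2).
  by rewrite !addr_ge0// mulr_ge0// sumr_ge0// => j _; exact: sqr_ge0.
move=> t; rewrite /sqsum /shift.
have sx : 0 <= \sum_(j < n) x j ^+ 2 by rewrite sumr_ge0// => j _; exact: sqr_ge0.
have sc : 0 <= \sum_(j < n) c j ^+ 2 by rewrite sumr_ge0// => j _; exact: sqr_ge0.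
have H : \sum_(j < n) (x j + t * c j) ^+ 2 <=
    2 * (\sum_(j < n) x j ^+ 2) + 2 * t ^+ 2 * (\sum_(j < n) c j ^+ 2).
  rewrite !mulr_sumr -big_split/=; apply: ler_sum => j _.
  rewrite -subr_ge0 (_ : _ - _ = (x j - t * c j) ^+ 2) ?sqr_ge0//; ring.
apply: (@le_trans _ _ (1 + (2 * (\sum_(j < n) x j ^+ 2) + 2 * t ^+ 2 * (\sum_(j < n) c j ^+ 2)))).
  by rewrite lerD2l.
have t2 := sqr_ge0 t; move: sx sc t2 {H}.
set u := \sum_(j < n) x j ^+ 2; set v := \sum_(j < n) c j ^+ 2; set s := t ^+ 2.
move=> u0 v0 s0; have := mulr_ge0 u0 s0; have := mulr_ge0 v0 s0; nra.
Qed.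

Lemma polygrowth_shift g x c : fgrowth g -> polygrowth (fun t => g (shift x c t)).
Proof.
move=> [n [K [M HK]]]; have [L L0 HL] := sqsum_shift n x c.
exists (`|K| * L ^+ M), M => t; rewrite (le_trans (HK _))// -mulrA -exprMn.
apply: (@le_trans _ _ (`|K| * sqsum n (shift x c t) ^+ M)).
  by rewrite ler_wpM2r ?ler_norm// exprn_ge0// (le_trans ler01)// sqsum_ge1.
rewrite ler_wpM2l// lerXn2r// ?nnegrE; first by rewrite (le_trans ler01)// sqsum_ge1.
by rewrite mulr_ge0// addr_ge0// sqr_ge0.
Qed.

(** Given the residuals, the sequence [X] moves along the line with direction [C k] as [X k] varies.
    Since [X k] is independent of the residuals, Fubini reduces the claim to [normal_ibp] on each
    such line. No density of the whole vector enters, so [C] may be singular. *)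
Theorem gaussian_family_ibp k g dg : smooth g dg ->
  Ex P (fun w => X k w * g (X ^~ w)) = Ex P (fun w => dg (C k) (X ^~ w)).
Proof.
move=> sg.
(* [Omega] itself, with the smaller sigma-algebra of the residuals, replaces the space of residual
   sequences; the law of [w |-> (X k w, w)] is then a product measure. *)
pose T2 := g_sigma_algebraType (trig_gen (residual k)).
have mid : measurable_fun setT (id : Omega -> T2).
  move=> _ A mA; rewrite setTI.
  (* Applied to [W = 0] for its first conclusion only: the generated sigma-algebra consists of
     measurable sets. *)
  have [] // := @trig_orth_indic _ _ _ P _ (measurable_residual k) A (fun=> 0) mA _.
  split=> //; first by exists 0 => w; rewrite normr0.
  by move=> n th c; under eq_Rintegral do rewrite mul0r; rewrite Ex_cst.
pose PY : probability T2 R := distribution P (mfun_of mid).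
pose gam : probability (measurableTypeR R) R := normal_prob 0 1.
have lawXk (A : set R) : measurable A -> P (X k @^-1` A) = normal_prob 0 1 A.
  move=> mA; have [_ [_]] := gaussian_family_coord k.
  by rewrite oner_eq0 sqrtr1 => ->.
pose phi (w : Omega) : measurableTypeR R * T2 := (X k w, w).
have mphi : measurable_fun setT phi by apply: measurable_fun_pair => //; exact: mX.
pose D : probability (measurableTypeR R * T2)%type R := distribution P (mfun_of mphi).
have lawphi A : measurable A -> P (phi @^-1` A) = (gam \x PY)%E A.
  move=> mA; apply/esym.
  rewrite (@product_measure_unique _ _ _ _ _ gam PY D)// => U V mU mV.
  have := residual_indep mU mV; rewrite (lawXk _ mU); exact: etrans.
pose z j (p : measurableTypeR R * T2) := residual k j p.2 + p.1 * C k j.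
have mz j : measurable_fun setT (z j).
  apply: measurable_funD.
    by apply: measurableT_comp measurable_snd; exact: measurable_trig_gen.
  by apply: measurable_funM => //; exact: measurable_fst.
have zX w : (z ^~ (phi w)) = X ^~ w.
  by apply/funext => j; rewrite /z /phi/= /residual; ring.
pose F1 (p : measurableTypeR R * T2) := p.1 * g (z ^~ p).
pose F2 (p : measurableTypeR R * T2) := dg (C k) (z ^~ p).
have mF1 : measurable_fun setT F1.
  by apply: measurable_funM; [exact: measurable_fst|exact: smooth_meas sg _ _ _ mz].
have mF2 : measurable_fun setT F2 by exact: smooth_dmeas sg _ _ _ _ mz.
have I1 : intg P (fun w => F1 (phi w)).
  rewrite /F1; under eq_fun do rewrite zX; apply: allmom_intg.
  apply: allmomM; first exact: gaussian_family_allmom.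
  by apply: allmom_fgrowth; [exact: smooth_meas sg|exact: smooth_growth sg].
have I2 : intg P (fun w => F2 (phi w)).
  rewrite /F2; under eq_fun do rewrite zX; apply: allmom_intg.
  by apply: allmom_fgrowth; [exact: smooth_dmeas sg _|exact: smooth_dgrowth sg _].
have -> : (fun w => X k w * g (X ^~ w)) = (fun w => F1 (phi w)).
  by apply/funext => w; rewrite /F1 zX.
have -> : (fun w => dg (C k) (X ^~ w)) = (fun w => F2 (phi w)).
  by apply/funext => w; rewrite /F2 zX.
have [J1 /(_ _) E1] := law_integral (Q := (gam \x PY)%E) mphi lawphi mF1.
have [J2 /(_ _) E2] := law_integral (Q := (gam \x PY)%E) mphi lawphi mF2.
rewrite E1 ?E2; [|exact/J2|exact/J1].
congr fine.
rewrite -(@integral21_prod_meas1 _ _ _ _ _ gam PY (EFin \o F1)); last exact/J1.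
rewrite -(@integral21_prod_meas1 _ _ _ _ _ gam PY (EFin \o F2)); last exact/J2.
apply: eq_integral => w _; rewrite /fubini_G/= /F1 /F2/=.
pose x j := residual k j w.
have Hz t : (z ^~ (t, w)) = shift x (C k) t by apply/funext.
have m1 : polygrowth (fun t => g (shift x (C k) t)).
  by apply: polygrowth_shift; exact: smooth_growth sg.
have m2 : polygrowth (fun t => dg (C k) (shift x (C k) t)).
  by apply: polygrowth_shift; exact: smooth_dgrowth sg _.
have := @normal_ibp R 1 (oner_neq0 _) (fun t => g (shift x (C k) t))
  (fun t => dg (C k) (shift x (C k) t)) (fun t => smooth_der sg _ _ _)
  (@smooth_cont _ _ sg (C k) x) m1 m2.
have mt (j : nat) : measurable_fun setT (fun t : R => x j + t * C k j).
  by apply: measurable_funD => //; exact: measurable_funM.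
have K1 : intg gam (fun t => t * g (shift x (C k) t)).
  apply: intg_polygrowth; first exact: oner_neq0.
    apply: measurable_funM => //; exact: smooth_meas sg _ _ _ mt.
  case: m1 => [K [M HK]]; exists K, M.+1 => t.
  rewrite normrM exprS mulrCA ler_pM// ?normr_ge0//.
  by rewrite -(real_normK (num_real t)); have := normr_ge0 t; nra.
have K2 : intg gam (fun t => dg (C k) (shift x (C k) t)).
  apply: intg_polygrowth; first exact: oner_neq0.
    exact: smooth_dmeas sg _ _ _ _ mt.
  exact: m2.
rewrite expr1n mul1r => H.
transitivity (Ex gam (fun t => t * g (shift x (C k) t)))%:E.
  by rewrite EFin_Ex//; apply: eq_integral => t _; rewrite Hz.
rewrite H EFin_Ex//; apply: eq_integral => t _; rewrite Hz//.
Qed.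

End gaussian_family.

(** * Hermite polynomials and their mixed moments *)

Section smooth_calculus.
Variable R : realType.
Implicit Types (g h : (nat -> R) -> R) (dg dh : (nat -> R) -> (nat -> R) -> R).

(** Since [sqsum] is at least 1 and increases with the number of coordinates, both parameters may be
    enlarged; two functions can thus be bounded by a common power. *)
Lemma fgrowth_nneg g : fgrowth g -> exists2 nM : nat * nat, True &
  exists2 K : R, 0 <= K & forall N M x, (nM.1 <= N)%N -> (nM.2 <= M)%N -> `|g x| <= K * sqsum N x ^+ M.
Proof.
move=> [n [K [M HK]]]; exists (n, M) => //; exists `|K| => // N M' x /= nN MM.
have S1 := sqsum_ge1 n x; have S0 : 0 <= sqsum n x by apply: le_trans S1.
have SS : sqsum n x <= sqsum N x.
  rewrite /sqsum lerD2l (big_ord_widen N (fun j => x j ^+ 2) nN) big_mkcond/=.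
  by apply: ler_sum => j _; case: ifP => // _; exact: sqr_ge0.
apply: le_trans (HK x) _.
apply: (@le_trans _ _ (`|K| * sqsum n x ^+ M)).
  by rewrite ler_wpM2r ?exprn_ge0// ler_norm.
rewrite ler_wpM2l//; apply: (@le_trans _ _ (sqsum n x ^+ M')).
  by rewrite ler_weXn2l.
by rewrite lerXn2r ?nnegrE// (le_trans S0).
Qed.

Lemma fgrowth_cst (a : R) : fgrowth (fun=> a).
Proof. by exists 0%N, `|a|, 0%N => x; rewrite mulr1. Qed.

Lemma fgrowth_coord j : fgrowth (fun x : nat -> R => x j).
Proof.
exists j.+1, 1, 1%N => x; rewrite mul1r expr1 /sqsum big_ord_recr/=.
have : 0 <= \sum_(i < j) x i ^+ 2 by apply: sumr_ge0 => i _; exact: sqr_ge0.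
by rewrite -(real_normK (num_real (x j))); have := normr_ge0 (x j); nra.
Qed.

Lemma fgrowthD g h : fgrowth g -> fgrowth h -> fgrowth (fun x => g x + h x).
Proof.
move=> /fgrowth_nneg[[n M] _ [K K0 HK]] /fgrowth_nneg[[n' M'] _ [K' K'0 HK']].
exists (maxn n n'), (K + K'), (maxn M M') => x.
rewrite (le_trans (ler_normD _ _))// mulrDl lerD//.
  by apply: HK; rewrite leq_maxl.
by apply: HK'; rewrite leq_maxr.
Qed.

Lemma fgrowthM g h : fgrowth g -> fgrowth h -> fgrowth (fun x => g x * h x).
Proof.
move=> /fgrowth_nneg[[n M] _ [K K0 HK]] /fgrowth_nneg[[n' M'] _ [K' K'0 HK']].
exists (maxn n n'), (K * K'), (M + M')%N => x.
rewrite normrM exprD mulrACA ler_pM//.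
  by apply: HK; rewrite ?leq_maxl.
by apply: HK'; rewrite ?leq_maxr.
Qed.

Lemma fgrowth_comp (f : R -> R) g : polygrowth f -> fgrowth g -> fgrowth (fun x => f (g x)).
Proof.
move=> [L [m HL]] /fgrowth_nneg[[n M] _ [K K0 HK]].
exists n, (`|L| * (1 + K ^+ 2) ^+ m), ((M + M) * m)%N => x.
apply: le_trans (HL _) _; rewrite exprM -mulrA -exprMn.
have S1 := sqsum_ge1 n x; have S0 : 0 <= sqsum n x by apply: le_trans S1.
apply: (@le_trans _ _ (`|L| * (1 + g x ^+ 2) ^+ m)).
  by rewrite ler_wpM2r ?ler_norm// exprn_ge0// addr_ge0// sqr_ge0.
rewrite ler_wpM2l// lerXn2r// ?nnegrE ?addr_ge0 ?sqr_ge0//.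
  by rewrite mulr_ge0 ?addr_ge0 ?sqr_ge0// exprn_ge0.
have := HK n M x (leqnn _) (leqnn _); rewrite exprD.
rewrite -(real_normK (num_real (g x))).
have : 1 <= sqsum n x ^+ M by rewrite exprn_ege1.
have := normr_ge0 (g x).
set s := _ ^+ M; set u := `|g x|; move: s u => s u u0 s1 us.
have : u ^+ 2 <= (K * s) ^+ 2 by rewrite lerXn2r// nnegrE mulr_ge0// (le_trans ler01).
have : 1 <= s * s by rewrite -[1]mulr1 ler_pM.
by have := sqr_ge0 K; nra.
Qed.

Lemma smooth_fun_cont g dg c x : smooth g dg -> continuous (fun t => g (shift x c t)).
Proof. by move=> sg; apply: continuous_is_derive => t; exact: smooth_der sg c x t. Qed.

Lemma smooth_cst (a : R) : smooth (fun=> a) (fun _ _ => 0).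
Proof.
split=> //.
- by move=> c d T z mz; exact: measurable_cst.
- exact: fgrowth_cst.
- by move=> c; exact: fgrowth_cst.
- by move=> c x t; exact: is_derive_cst.
- by move=> c x t; apply: cvg_cst.
Qed.

Lemma smooth_coord j : smooth (fun x : nat -> R => x j) (fun c _ => c j).
Proof.
split=> //.
- by move=> c d T z mz; exact: measurable_cst.
- exact: fgrowth_coord.
- by move=> c; exact: fgrowth_cst.
- by move=> c x t; rewrite /shift; apply: is_derive_eq; rewrite /GRing.scale/=; ring.
- by move=> c x t; apply: cvg_cst.
Qed.

Lemma smoothD g dg h dh : smooth g dg -> smooth h dh ->
  smooth (fun x => g x + h x) (fun c x => dg c x + dh c x).
Proof.
move=> sg sh; split.
- move=> d T z mz; apply: measurable_funD; [exact: (smooth_meas sg)|exact: (smooth_meas sh)].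
- move=> c d T z mz; apply: measurable_funD; [exact: (smooth_dmeas sg)|exact: (smooth_dmeas sh)].
- apply: fgrowthD; [exact: smooth_growth sg|exact: smooth_growth sh].
- move=> c; apply: fgrowthD; [exact: smooth_dgrowth sg c|exact: smooth_dgrowth sh c].
- move=> c x t; have H1 := smooth_der sg c x t; have H2 := smooth_der sh c x t.
  by apply: is_derive_eq.
- move=> c x t; apply: cvgD; [exact: (@smooth_cont _ _ _ sg)|exact: (@smooth_cont _ _ _ sh)].
Qed.

Lemma smoothM g dg h dh : smooth g dg -> smooth h dh ->
  smooth (fun x => g x * h x) (fun c x => dg c x * h x + g x * dh c x).
Proof.
move=> sg sh; split.
- move=> d T z mz; apply: measurable_funM; [exact: (smooth_meas sg)|exact: (smooth_meas sh)].
- move=> c d T z mz; apply: measurable_funD; apply: measurable_funM;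
  [exact: (smooth_dmeas sg)|exact: (smooth_meas sh)|exact: (smooth_meas sg)|exact: (smooth_dmeas sh)].
- apply: fgrowthM; [exact: smooth_growth sg|exact: smooth_growth sh].
- move=> c; apply: fgrowthD; apply: fgrowthM;
  [exact: smooth_dgrowth sg c|exact: smooth_growth sh|exact: smooth_growth sg|exact: smooth_dgrowth sh c].
- move=> c x t; have H1 := smooth_der sg c x t; have H2 := smooth_der sh c x t.
  by apply: is_derive_eq; rewrite /GRing.scale/=; ring.
- move=> c x t; apply: cvgD; apply: cvgM;
  [exact: (@smooth_cont _ _ _ sg)|exact: (smooth_fun_cont sh)|
   exact: (smooth_fun_cont sg)|exact: (@smooth_cont _ _ _ sh)].
Qed.

Lemma smooth_comp (f f' : R -> R) g dg : (forall y : R, is_derive y (1 : R) f (f' y)) ->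
  continuous f' -> polygrowth f -> polygrowth f' -> smooth g dg ->
  smooth (fun x => f (g x)) (fun c x => f' (g x) * dg c x).
Proof.
move=> df cf' gf gf' sg; have cf := continuous_is_derive df.
split.
- move=> d T z mz; apply: measurableT_comp; first exact: continuous_measurable_fun.
  exact: (smooth_meas sg).
- move=> c d T z mz; apply: measurable_funM; last exact: (smooth_dmeas sg).
  apply: measurableT_comp; first exact: continuous_measurable_fun.
  exact: (smooth_meas sg).
- by apply: fgrowth_comp => //; exact: smooth_growth sg.
- move=> c; apply: fgrowthM; last exact: smooth_dgrowth sg c.
  by apply: fgrowth_comp => //; exact: smooth_growth sg.
- move=> c x t; have H1 := smooth_der sg c x t; have H2 := df (g (shift x c t)).
  have := @is_derive1_comp R f (fun t => g (shift x c t)) t _ _ H2 H1.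
  by rewrite /comp.
- move=> c x t; apply: cvgM; last exact: (@smooth_cont _ _ _ sg).
  apply: (@continuous_comp _ _ _ (fun t => g (shift x c t)) f'); last exact: cf'.
  exact: (smooth_fun_cont sg).
Qed.

Lemma eq_smooth g g' dg dg' : g =1 g' -> (forall c, dg c =1 dg' c) -> smooth g dg -> smooth g' dg'.
Proof.
move=> /funext <- H sg; suff <- : dg = dg' by [].
by apply/funext => c; apply/funext => x; exact: H.
Qed.

Lemma smoothZ (a : R) g dg : smooth g dg -> smooth (fun x => a * g x) (fun c x => a * dg c x).
Proof.
by move=> sg; apply: eq_smooth (smoothM (smooth_cst a) sg) => [x|c x] //; rewrite mul0r add0r.
Qed.

Lemma smooth_sum (I : Type) (s : seq I) (Q : pred I) (g : I -> (nat -> R) -> R)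
    (dg : I -> (nat -> R) -> (nat -> R) -> R) : (forall i, smooth (g i) (dg i)) ->
  smooth (fun x => \sum_(i <- s | Q i) g i x) (fun c x => \sum_(i <- s | Q i) dg i c x).
Proof.
move=> sg; elim: s => [|i s IH].
  by apply: eq_smooth (smooth_cst 0) => [x|c x]; rewrite big_nil.
case E : (Q i).
  by apply: eq_smooth (smoothD (sg i) IH) => [x|c x]; rewrite big_cons E.
by apply: eq_smooth IH => [x|c x]; rewrite big_cons E.
Qed.

Lemma polygrowth_horner (p : {poly R}) : polygrowth (fun x => p.[x]).
Proof.
elim/poly_ind: p => [|p c [K [M HK]]].
  by exists 0, 0%N => x; rewrite horner0 normr0 mul0r.
exists (`|K| + `|c|), M.+1 => x; rewrite hornerMXaddC.
have x1 : 1 <= 1 + x ^+ 2 by rewrite lerDl sqr_ge0.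
have xM : 1 <= (1 + x ^+ 2) ^+ M.+1 by rewrite exprn_ege1.
apply: le_trans (ler_normD _ _) _; rewrite mulrDl lerD//; last by rewrite ler_peMr.
rewrite normrM exprSr mulrA ler_pM//.
  apply: le_trans (HK x) _; rewrite ler_wpM2r ?ler_norm// exprn_ge0//.
  by rewrite (le_trans ler01).
by rewrite -(real_normK (num_real x)); have := normr_ge0 x; nra.
Qed.

Lemma smooth_horner (p : {poly R}) j :
  smooth (fun x : nat -> R => p.[x j]) (fun c x => (p^`()).[x j] * c j).
Proof.
apply: (@smooth_comp (fun y => p.[y]) (fun y => (p^`()).[y]) _ _ _ _ _ _ (smooth_coord j)).
- by move=> y; exact: is_derive_poly.
- by move=> y; apply: continuous_horner.
- exact: polygrowth_horner.
- exact: polygrowth_horner.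
Qed.

End smooth_calculus.

Section hermite_polynomials.
Variable R : realType.

Fixpoint He q : {poly R} := if q is q'.+1 then 'X * He q' - (He q')^`() else 1.

(** Differentiating [He_(q+2) = X He_(q+1) - He_(q+1)'] leaves [He_(q+1) + (q + 1) (X He_q - He_q')
    = (q + 2) He_(q+1)]; the induction is strong because the degrees [q + 1] and [q] both occur. *)
Lemma He_deriv q : (He q)^`() = q%:R *: He q.-1.
Proof.
have [m] := ubnP q; elim: m q => // m IH [|[|q]] /ltnSE qm.
- by rewrite /= derivC scale0r.
- by rewrite /= derivC subr0 mulr1 derivX scale1r.
rewrite [He q.+2]/= derivB derivM derivX mul1r -/(He q.+1) (IH q.+1)//=.
rewrite derivZ (IH q) ?(ltn_trans _ qm)//= -[in q.+2%:R]natr1 scalerDl scale1r addrC.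
by rewrite -!mul_polyC; ring.
Qed.

(** Each derivative of [(-1)^q He_q(y) e^(- y^2 / 2)] reproduces the recursion of [He]; the two
    signs and the two exponentials then cancel. *)
Lemma hermiteE q (x : R) : hermite q x = (He q).[x].
Proof.
have H : derive1n q (fun y : R => expR (- (y ^+ 2) / 2)) =
    fun y => (-1) ^+ q * (He q).[y] * expR (- (y ^+ 2) / 2).
  elim: q => [|q IH]; first by apply/funext => y; rewrite derive1n0 expr0 /= hornerC !mul1r.
  rewrite derive1nS IH; apply/funext => y; rewrite derive1E.
  have H1 := is_derive_poly (He q) y.
  have H2 : is_derive y (1 : R) (fun y : R => expR (- (y ^+ 2) / 2)) (- y * expR (- (y ^+ 2) / 2)).
    by apply: is_derive_eq; rewrite /GRing.scale/=; field.
  have : is_derive y (1 : R) (fun y => (-1) ^+ q * (He q).[y] * expR (- (y ^+ 2) / 2))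
     ((-1) ^+ q.+1 * (He q.+1).[y] * expR (- (y ^+ 2) / 2)).
    by apply: is_derive_eq; rewrite /GRing.scale/= (exprS (-1)) hornerD hornerN hornerM hornerX; ring.
  by move=> ?; rewrite derive_val.
rewrite /hermite H.
rewrite (_ : _ * _ = ((-1) ^+ q * (-1) ^+ q) * (expR (x ^+ 2 / 2) * expR (- (x ^+ 2) / 2)) * (He q).[x]); last by ring.
rewrite -expRD -mulrDl subrr mul0r expR0 mulr1.
by rewrite -exprD addnn -mul2n exprM sqrrN !expr1n mul1r.
Qed.

End hermite_polynomials.

(** * Wick recursions for two-point and four-point Hermite moments *)

Section gaussian_hermite.
Context {R : realType} {d : measure_display} {Omega : measurableType d}.
Variables (P : probability Omega R) (X : nat -> Omega -> R) (C : nat -> nat -> R).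
Hypothesis gaussX : forall n th, centered_gaussian P (lincomb X n th)
  (\sum_(i < n) \sum_(j < n) th i * th j * C i j).
Hypothesis Csym : forall i j, C i j = C j i.
Hypothesis Cdiag : forall i, C i i = 1.

Local Notation ibp := (gaussian_family_ibp gaussX Csym Cdiag).
Local Notation amom := (allmom_fgrowth gaussX Cdiag).

Definition hm q (x : R) := (He R q).[x].

Lemma smooth_hm q j : smooth (fun x : nat -> R => hm q (x j))
  (fun c x => q%:R * hm q.-1 (x j) * c j).
Proof.
by apply: eq_smooth (smooth_horner (He R q) j) => [x|c x] //; rewrite He_deriv hornerZ.
Qed.

(** Integration by parts for [He_p(X_a) g] yields two terms; the one with [He_p'] combines with
    [X_a He_p] into [He_(p+1)], because [C a a = 1]. *)
Lemma hm_ibp p a g dg : smooth g dg ->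
  Ex P (fun w => hm p.+1 (X a w) * g (X ^~ w)) =
  Ex P (fun w => hm p (X a w) * dg (C a) (X ^~ w)).
Proof.
move=> sg; have sh := smooth_hm p a; have sM := smoothM sh sg.
have AH : allmom P (fun w => hm p (X a w)) by apply: (amom (smooth_meas sh) (smooth_growth sh)).
have Ag : allmom P (fun w => g (X ^~ w)) by apply: (amom (smooth_meas sg) (smooth_growth sg)).
have AX : allmom P (X a) by exact: (gaussian_family_allmom gaussX Cdiag).
have A1 : allmom P (fun w => p%:R * hm p.-1 (X a w) * C a a * g (X ^~ w)).
  by apply: allmomM => //; exact: (amom (smooth_dmeas sh _) (smooth_dgrowth sh _)).
have A2 : allmom P (fun w => hm p (X a w) * dg (C a) (X ^~ w)).
  by apply: allmomM => //; exact: (amom (smooth_dmeas sg _) (smooth_dgrowth sg _)).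
have := ibp a sM; rewrite ExD; [|exact: allmom_intg|exact: allmom_intg].
move=> /eqP; rewrite addrC -subr_eq => /eqP <-.
rewrite -ExB; [|by apply: allmom_intg; do 2!apply: allmomM => //|exact: allmom_intg].
apply: eq_Ex => w; rewrite Cdiag mulr1 /hm /= hornerD hornerN hornerM hornerX He_deriv hornerZ.
ring.
Qed.

Definition H4 p1 p2 p3 p4 a b c e := Ex P (fun w =>
  hm p1 (X a w) * (hm p2 (X b w) * (hm p3 (X c w) * hm p4 (X e w)))).

Lemma smooth_H4 p1 p2 p3 p4 a b c e : smooth (fun x : nat -> R =>
  hm p1 (x a) * (hm p2 (x b) * (hm p3 (x c) * hm p4 (x e))))
  (fun k x => p1%:R * hm p1.-1 (x a) * k a * (hm p2 (x b) * (hm p3 (x c) * hm p4 (x e))) +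
    hm p1 (x a) * (p2%:R * hm p2.-1 (x b) * k b * (hm p3 (x c) * hm p4 (x e)) +
     hm p2 (x b) * (p3%:R * hm p3.-1 (x c) * k c * hm p4 (x e) +
       hm p3 (x c) * (p4%:R * hm p4.-1 (x e) * k e)))).
Proof. by do 3!(apply: smoothM; first exact: smooth_hm); exact: smooth_hm. Qed.

Lemma intg_H4 p1 p2 p3 p4 a b c e : intg P (fun w =>
  hm p1 (X a w) * (hm p2 (X b w) * (hm p3 (X c w) * hm p4 (X e w)))).
Proof.
have s4 := smooth_H4 p1 p2 p3 p4 a b c e.
exact: (allmom_intg (amom (smooth_meas s4) (smooth_growth s4))).
Qed.

Lemma hm0 x : hm 0 x = 1. Proof. by rewrite /hm /= hornerC. Qed.

(** One leg at [a] is contracted with a leg at [b], [c] or [e]. An exponent 0 comes with the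
    coefficient 0, so the truncated predecessor does no harm. *)
Lemma H4_rec p1 p2 p3 p4 a b c e :
  H4 p1.+1 p2 p3 p4 a b c e = p2%:R * C a b * H4 p1 p2.-1 p3 p4 a b c e +
    p3%:R * C a c * H4 p1 p2 p3.-1 p4 a b c e + p4%:R * C a e * H4 p1 p2 p3 p4.-1 a b c e.
Proof.
(* The dummy factor [hm 0], equal to 1, gives the three remaining factors the shape of
   [smooth_H4]. *)
have s4 := smooth_H4 0 p2 p3 p4 a b c e.
rewrite /H4 (@eq_Ex _ _ _ _ _ (fun w => hm p1.+1 (X a w) * (hm 0 (X a w) *
  (hm p2 (X b w) * (hm p3 (X c w) * hm p4 (X e w)))))); last first.
  by move=> w; rewrite hm0 mul1r.
rewrite (hm_ibp p1 a s4) -!ExZ; try exact: intg_H4.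
rewrite -!ExD; try (by do ?apply: intgD; apply: intgZ; exact: intg_H4).
by apply: eq_Ex => w; rewrite !hm0; ring.
Qed.

Lemma H4_0 p2 p3 p4 a b c e : H4 0 p2 p3 p4 a b c e = H4 p2 p3 p4 0 b c e a.
Proof. by apply: eq_Ex => w; rewrite !hm0 mul1r mulr1. Qed.

Lemma H4_0rec p2 p3 p4 a b c e :
  H4 0 p2.+1 p3 p4 a b c e = p3%:R * C b c * H4 0 p2 p3.-1 p4 a b c e +
    p4%:R * C b e * H4 0 p2 p3 p4.-1 a b c e.
Proof. by rewrite !H4_0 H4_rec !mul0r addr0. Qed.

Lemma H4_00rec p3 p4 a b c e :
  H4 0 0 p3.+1 p4 a b c e = p4%:R * C c e * H4 0 0 p3 p4.-1 a b c e.
Proof. by rewrite !H4_0 H4_rec !mul0r !addr0. Qed.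

Lemma H4_000S p4 a b c e : H4 0 0 0 p4.+1 a b c e = 0.
Proof. by rewrite !H4_0 H4_rec !mul0r !addr0. Qed.

Lemma H4_0000 a b c e : H4 0 0 0 0 a b c e = 1.
Proof. by rewrite /H4 -(Ex_cst P 1); apply: eq_Ex => w; rewrite !hm0 !mulr1. Qed.

Definition H2 p1 p2 a b := Ex P (fun w => hm p1 (X a w) * hm p2 (X b w)).

Lemma H2E p1 p2 a b c e : H2 p1 p2 a b = H4 p1 p2 0 0 a b c e.
Proof. by apply: eq_Ex => w; rewrite !hm0 !mulr1. Qed.

Lemma H2_rec p1 p2 a b : H2 p1.+1 p2 a b = p2%:R * C a b * H2 p1 p2.-1 a b.
Proof. by rewrite !(H2E _ _ a b a a) H4_rec !mul0r !addr0. Qed.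

Lemma H2_0S p2 a b : H2 0 p2.+1 a b = 0.
Proof. by rewrite (H2E _ _ a b a a) H4_0rec !mul0r !addr0. Qed.

Lemma H2_diag p a b : H2 p p a b = p`!%:R * C a b ^+ p.
Proof.
elim: p => [|p IH]; last by rewrite H2_rec/= IH factS natrM exprS; ring.
by rewrite (H2E _ _ a b a a) H4_0000 mulr1.
Qed.

Section monomial_bounds.
Variables (a b c e : nat).

(** Absolute weight of a pairing of the legs at four points, where [nij] counts the edges between
    the points [i] and [j]; [adm] states that each point has its prescribed degree. Edges from a
    point to itself do not occur for Hermite polynomials. *)
Definition mon (n12 n13 n14 n23 n24 n34 : nat) : R :=
  `|C a b| ^+ n12 * `|C a c| ^+ n13 * `|C a e| ^+ n14 *
  `|C b c| ^+ n23 * `|C b e| ^+ n24 * `|C c e| ^+ n34.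

Definition adm p1 p2 p3 p4 n12 n13 n14 n23 n24 n34 :=
  [&& n12 + n13 + n14 == p1, n12 + n23 + n24 == p2,
      n13 + n23 + n34 == p3 & n14 + n24 + n34 == p4]%N.

End monomial_bounds.

(** For [p = 0] both sides vanish; for [p > 0] the predecessor of [p] is genuine, as the degree
    count requires. *)
Lemma natM_le (p : nat) (x y : R) : ((0 < p)%N -> x <= y) -> p%:R * x <= p%:R * y.
Proof. by case: p => [|p] H; rewrite ?mul0r// ler_wpM2l// H. Qed.

Lemma ge0_mulr_norm (W u : R) : 0 <= W -> 0 <= W * `|u|.
Proof. by move=> W0; rewrite mulr_ge0. Qed.

(* Wick's formula bounds the expectation by a sum of products of covariances over
   the pairings; testing against all [W] and [Phi] avoids enumerating them. *)
Lemma H4_bound p1 p2 p3 p4 : exists2 K : R, 0 <= K & forall a b c e (W Phi : R),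
  0 <= W -> 0 <= Phi -> (forall n12 n13 n14 n23 n24 n34,
    adm p1 p2 p3 p4 n12 n13 n14 n23 n24 n34 -> W * mon a b c e n12 n13 n14 n23 n24 n34 <= Phi) ->
  W * `|H4 p1 p2 p3 p4 a b c e| <= K * Phi.
Proof.
elim: p1 p2 p3 p4 => [|p1 IH1] p2 p3 p4; last first.
  have [K2 K20 HK2] := IH1 p2.-1 p3 p4.
  have [K3 K30 HK3] := IH1 p2 p3.-1 p4.
  have [K4 K40 HK4] := IH1 p2 p3 p4.-1.
  exists (p2%:R * K2 + p3%:R * K3 + p4%:R * K4); first by rewrite !addr_ge0// mulr_ge0.
  move=> a b c e W Phi W0 Phi0 HPhi; rewrite H4_rec.
  have B2 : p2%:R * (W * `|C a b| * `|H4 p1 p2.-1 p3 p4 a b c e|) <= p2%:R * (K2 * Phi).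
    apply: natM_le => p0; apply: HK2 => //; first exact: ge0_mulr_norm.
    move=> n12 n13 n14 n23 n24 n34 H.
    apply: le_trans (HPhi n12.+1 n13 n14 n23 n24 n34 _); last by move: H; rewrite /adm; lia.
    by rewrite /mon !exprS -!mulrA.
  have B3 : p3%:R * (W * `|C a c| * `|H4 p1 p2 p3.-1 p4 a b c e|) <= p3%:R * (K3 * Phi).
    apply: natM_le => p0; apply: HK3 => //; first exact: ge0_mulr_norm.
    move=> n12 n13 n14 n23 n24 n34 H.
    apply: le_trans (HPhi n12 n13.+1 n14 n23 n24 n34 _); last by move: H; rewrite /adm; lia.
    by rewrite le_eqVlt; apply/orP; left; apply/eqP; rewrite /mon !exprS; ring.
  have B4 : p4%:R * (W * `|C a e| * `|H4 p1 p2 p3 p4.-1 a b c e|) <= p4%:R * (K4 * Phi).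
    apply: natM_le => p0; apply: HK4 => //; first exact: ge0_mulr_norm.
    move=> n12 n13 n14 n23 n24 n34 H.
    apply: le_trans (HPhi n12 n13 n14.+1 n23 n24 n34 _); last by move: H; rewrite /adm; lia.
    by rewrite le_eqVlt; apply/orP; left; apply/eqP; rewrite /mon !exprS; ring.
  apply: (@le_trans _ _ (W * (p2%:R * `|C a b| * `|H4 p1 p2.-1 p3 p4 a b c e| +
    p3%:R * `|C a c| * `|H4 p1 p2 p3.-1 p4 a b c e| +
    p4%:R * `|C a e| * `|H4 p1 p2 p3 p4.-1 a b c e|))).
    rewrite ler_wpM2l//; apply: le_trans (ler_normD _ _) _; apply: lerD.
      by apply: le_trans (ler_normD _ _) _; rewrite !normrM !normr_nat.
    by rewrite !normrM normr_nat.
  by move: B2 B3 B4; rewrite !mulrDl !mulrDr; lra.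
elim: p2 p3 p4 => [|p2 IH2] p3 p4; last first.
  have [K3 K30 HK3] := IH2 p3.-1 p4.
  have [K4 K40 HK4] := IH2 p3 p4.-1.
  exists (p3%:R * K3 + p4%:R * K4); first by rewrite !addr_ge0// mulr_ge0.
  move=> a b c e W Phi W0 Phi0 HPhi; rewrite H4_0rec.
  have B3 : p3%:R * (W * `|C b c| * `|H4 0 p2 p3.-1 p4 a b c e|) <= p3%:R * (K3 * Phi).
    apply: natM_le => p0; apply: HK3 => //; first exact: ge0_mulr_norm.
    move=> n12 n13 n14 n23 n24 n34 H.
    apply: le_trans (HPhi n12 n13 n14 n23.+1 n24 n34 _); last by move: H; rewrite /adm; lia.
    by rewrite le_eqVlt; apply/orP; left; apply/eqP; rewrite /mon !exprS; ring.
  have B4 : p4%:R * (W * `|C b e| * `|H4 0 p2 p3 p4.-1 a b c e|) <= p4%:R * (K4 * Phi).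
    apply: natM_le => p0; apply: HK4 => //; first exact: ge0_mulr_norm.
    move=> n12 n13 n14 n23 n24 n34 H.
    apply: le_trans (HPhi n12 n13 n14 n23 n24.+1 n34 _); last by move: H; rewrite /adm; lia.
    by rewrite le_eqVlt; apply/orP; left; apply/eqP; rewrite /mon !exprS; ring.
  apply: (@le_trans _ _ (W * (p3%:R * `|C b c| * `|H4 0 p2 p3.-1 p4 a b c e| +
    p4%:R * `|C b e| * `|H4 0 p2 p3 p4.-1 a b c e|))).
    by rewrite ler_wpM2l//; apply: le_trans (ler_normD _ _) _; rewrite !normrM !normr_nat.
  by move: B3 B4; rewrite !mulrDl !mulrDr; lra.
elim: p3 p4 => [|p3 IH3] p4; last first.
  have [K4 K40 HK4] := IH3 p4.-1.
  exists (p4%:R * K4); first by rewrite mulr_ge0.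
  move=> a b c e W Phi W0 Phi0 HPhi; rewrite H4_00rec.
  have B4 : p4%:R * (W * `|C c e| * `|H4 0 0 p3 p4.-1 a b c e|) <= p4%:R * (K4 * Phi).
    apply: natM_le => p0; apply: HK4 => //; first exact: ge0_mulr_norm.
    move=> n12 n13 n14 n23 n24 n34 H.
    apply: le_trans (HPhi n12 n13 n14 n23 n24 n34.+1 _); last by move: H; rewrite /adm; lia.
    by rewrite le_eqVlt; apply/orP; left; apply/eqP; rewrite /mon !exprS; ring.
  by move: B4; rewrite !normrM normr_nat; lra.
exists 1 => // a b c e W Phi W0 Phi0 HPhi; rewrite mul1r.
case: p4 HPhi => [|p4] HPhi; last by rewrite H4_000S normr0 mulr0.
rewrite H4_0000 normr1.
by apply: le_trans (HPhi 0 0 0 0 0 0 isT)%N; rewrite /mon !expr0 !mulr1.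
Qed.

Definition cov4 p1 p2 p3 p4 a b c e := H4 p1 p2 p3 p4 a b c e - H2 p1 p2 a b * H2 p3 p4 c e.

(* In the covariance, the pairings without edge between [{a, b}] and [{c, e}] cancel. *)
Lemma cov4_bound p1 p2 p3 p4 : exists2 K : R, 0 <= K & forall a b c e (W Phi : R),
  0 <= W -> 0 <= Phi -> (forall n12 n13 n14 n23 n24 n34,
    adm p1 p2 p3 p4 n12 n13 n14 n23 n24 n34 -> (0 < n13 + n14 + n23 + n24)%N ->
    W * mon a b c e n12 n13 n14 n23 n24 n34 <= Phi) ->
  W * `|cov4 p1 p2 p3 p4 a b c e| <= K * Phi.
Proof.
elim: p1 p2 p3 p4 => [|p1 IH1] p2 p3 p4; last first.
  have [K2 K20 HK2] := IH1 p2.-1 p3 p4.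
  have [K3 K30 HK3] := H4_bound p1 p2 p3.-1 p4.
  have [K4 K40 HK4] := H4_bound p1 p2 p3 p4.-1.
  exists (p2%:R * K2 + p3%:R * K3 + p4%:R * K4); first by rewrite !addr_ge0// mulr_ge0.
  move=> a b c e W Phi W0 Phi0 HPhi.
  have -> : cov4 p1.+1 p2 p3 p4 a b c e = p2%:R * C a b * cov4 p1 p2.-1 p3 p4 a b c e +
    p3%:R * C a c * H4 p1 p2 p3.-1 p4 a b c e + p4%:R * C a e * H4 p1 p2 p3 p4.-1 a b c e.
    by rewrite /cov4 H4_rec H2_rec; ring.
  have B2 : p2%:R * (W * `|C a b| * `|cov4 p1 p2.-1 p3 p4 a b c e|) <= p2%:R * (K2 * Phi).
    apply: natM_le => p0; apply: HK2 => //; first exact: ge0_mulr_norm.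
    move=> n12 n13 n14 n23 n24 n34 H H'.
    apply: le_trans (HPhi n12.+1 n13 n14 n23 n24 n34 _ _) => //; last by move: H; rewrite /adm; lia.
    by rewrite /mon !exprS -!mulrA.
  have B3 : p3%:R * (W * `|C a c| * `|H4 p1 p2 p3.-1 p4 a b c e|) <= p3%:R * (K3 * Phi).
    apply: natM_le => p0; apply: HK3 => //; first exact: ge0_mulr_norm.
    move=> n12 n13 n14 n23 n24 n34 H.
    apply: le_trans (HPhi n12 n13.+1 n14 n23 n24 n34 _ _) => //; last by move: H; rewrite /adm; lia.
    by rewrite le_eqVlt; apply/orP; left; apply/eqP; rewrite /mon !exprS; ring.
  have B4 : p4%:R * (W * `|C a e| * `|H4 p1 p2 p3 p4.-1 a b c e|) <= p4%:R * (K4 * Phi).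
    apply: natM_le => p0; apply: HK4 => //; first exact: ge0_mulr_norm.
    move=> n12 n13 n14 n23 n24 n34 H.
    apply: le_trans (HPhi n12 n13 n14.+1 n23 n24 n34 _ _); [|by move: H; rewrite /adm; lia|by lia].
    by rewrite le_eqVlt; apply/orP; left; apply/eqP; rewrite /mon !exprS; ring.
  apply: (@le_trans _ _ (W * (p2%:R * `|C a b| * `|cov4 p1 p2.-1 p3 p4 a b c e| +
    p3%:R * `|C a c| * `|H4 p1 p2 p3.-1 p4 a b c e| +
    p4%:R * `|C a e| * `|H4 p1 p2 p3 p4.-1 a b c e|))).
    rewrite ler_wpM2l//; apply: le_trans (ler_normD _ _) _; apply: lerD.
      by apply: le_trans (ler_normD _ _) _; rewrite !normrM !normr_nat.
    by rewrite !normrM normr_nat.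
  by move: B2 B3 B4; rewrite !mulrDl !mulrDr; lra.
case: p2 => [|p2].
  exists 0 => // a b c e W Phi W0 Phi0 _.
  rewrite mul0r /cov4 (_ : H2 0 0 a b = 1) ?mul1r; last by rewrite (H2E _ _ a b a a) H4_0000.
  rewrite (H2E _ _ c e a b) !H4_0.
  by rewrite subrr normr0 mulr0.
have [K3 K30 HK3] := H4_bound 0 p2 p3.-1 p4.
have [K4 K40 HK4] := H4_bound 0 p2 p3 p4.-1.
exists (p3%:R * K3 + p4%:R * K4); first by rewrite !addr_ge0// mulr_ge0.
move=> a b c e W Phi W0 Phi0 HPhi; rewrite /cov4 H2_0S mul0r subr0 H4_0rec.
have B3 : p3%:R * (W * `|C b c| * `|H4 0 p2 p3.-1 p4 a b c e|) <= p3%:R * (K3 * Phi).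
  apply: natM_le => p0; apply: HK3 => //; first exact: ge0_mulr_norm.
  move=> n12 n13 n14 n23 n24 n34 H.
  apply: le_trans (HPhi n12 n13 n14 n23.+1 n24 n34 _ _); [|by move: H; rewrite /adm; lia|by lia].
  by rewrite le_eqVlt; apply/orP; left; apply/eqP; rewrite /mon !exprS; ring.
have B4 : p4%:R * (W * `|C b e| * `|H4 0 p2 p3 p4.-1 a b c e|) <= p4%:R * (K4 * Phi).
  apply: natM_le => p0; apply: HK4 => //; first exact: ge0_mulr_norm.
  move=> n12 n13 n14 n23 n24 n34 H.
  apply: le_trans (HPhi n12 n13 n14 n23 n24.+1 n34 _ _); [|by move: H; rewrite /adm; lia|by lia].
  by rewrite le_eqVlt; apply/orP; left; apply/eqP; rewrite /mon !exprS; ring.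
apply: (@le_trans _ _ (W * (p3%:R * `|C b c| * `|H4 0 p2 p3.-1 p4 a b c e| +
  p4%:R * `|C b e| * `|H4 0 p2 p3 p4.-1 a b c e|))).
  by rewrite ler_wpM2l//; apply: le_trans (ler_normD _ _) _; rewrite !normrM !normr_nat.
by move: B3 B4; rewrite !mulrDl !mulrDr; lra.
Qed.

(* The diagonal pairings all have the form [x^al y^be z^ga] with [al + be + ga = p + 1]. *)
Lemma cov4_diag_bound p : exists2 K : R, 0 <= K & forall a b c e,
  `|C a b * C c e| * `|cov4 p p p p a b c e| <= K *
  \sum_(1 <= r < p.+1) `|C a b * C c e| ^+ r *
    (`|C a c * C b e| ^+ (p.+1 - r) + `|C a e * C b c| ^+ (p.+1 - r)).
Proof.
have [K K0 HK] := cov4_bound p p p p; exists K => // a b c e.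
set x := `|C a b * C c e|; set y := `|C a c * C b e|; set z := `|C a e * C b c|.
have [x0 y0 z0] : [/\ 0 <= x, 0 <= y & 0 <= z] by split; exact: normr_ge0.
have t0 r : 0 <= x ^+ r * (y ^+ (p.+1 - r) + z ^+ (p.+1 - r)).
  by rewrite mulr_ge0 ?exprn_ge0// addr_ge0// exprn_ge0.
apply: HK => //; first by rewrite sumr_ge0.
move=> n12 n13 n14 n23 n24 n34 /and4P[/eqP h1 /eqP h2 /eqP h3 /eqP h4] hp.
(* Equal degrees at the four points force opposite edges to have equal multiplicities. *)
have e1 : n34 = n12 by lia.
have e2 : n24 = n13 by lia.
have e3 : n23 = n14 by lia.
have -> : x * mon a b c e n12 n13 n14 n23 n24 n34 = x ^+ n12.+1 * (y ^+ n13 * z ^+ n14).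
  by rewrite /mon e1 e2 e3 exprS /x /y /z !normrM !exprMn; ring.
(* The exponent [r] is [n12 + 1]: the extra factor [x] gives [r >= 1], and the presence of a cross
   edge gives [r < p + 1]. *)
have n12p : (1 <= n12.+1 < p.+1)%N by lia.
apply: (@le_trans _ _ (x ^+ n12.+1 * (y ^+ (p.+1 - n12.+1) + z ^+ (p.+1 - n12.+1)))); last first.
  rewrite (bigD1_seq n12.+1) ?mem_index_iota ?iota_uniq//= lerDl sumr_ge0//.
rewrite ler_wpM2l ?exprn_ge0// (_ : (p.+1 - n12.+1 = n13 + n14)%N); last by lia.
rewrite !exprD; have [yz|/ltW zy] := leP y z.
  apply: (@le_trans _ _ (z ^+ n13 * z ^+ n14)); last by rewrite lerDr mulr_ge0// exprn_ge0.
  by rewrite ler_wpM2r ?exprn_ge0// lerXn2r.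
apply: (@le_trans _ _ (y ^+ n13 * y ^+ n14)); last by rewrite lerDl mulr_ge0// exprn_ge0.
by rewrite ler_wpM2l ?exprn_ge0// lerXn2r.
Qed.

End gaussian_hermite.

(** * Stein's bound for pairs of Hermite sums *)

Section quadruple_sums.
Variable R : realType.

Lemma young_pow (x y : R) q r : 0 <= x -> 0 <= y -> (r <= q)%N ->
  x ^+ r * y ^+ (q - r) <= x ^+ q + y ^+ q.
Proof.
move=> x0 y0 rq; have [xy|/ltW yx] := leP x y.
  apply: (@le_trans _ _ (y ^+ r * y ^+ (q - r))).
    by rewrite ler_wpM2r ?exprn_ge0// lerXn2r.
  by rewrite -exprD subnKC// lerDr exprn_ge0.
apply: (@le_trans _ _ (x ^+ r * x ^+ (q - r))).
  by rewrite ler_wpM2l ?exprn_ge0// lerXn2r.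
by rewrite -exprD subnKC// lerDl exprn_ge0.
Qed.

Variables (c : nat -> nat -> R) (q r k l : nat) (Uq Ur Us : R).
Hypothesis c0 : forall i j, 0 <= c i j.
Hypothesis csym : forall i j, c i j = c j i.
Hypothesis rq : (r <= q)%N.
Hypothesis kl : (k <= l)%N.
Hypothesis HUq : forall i, (i < l)%N -> \sum_(j < l) c i j ^+ q <= Uq.
Hypothesis HUr : forall i, (i < l)%N -> \sum_(j < l) c i j ^+ r <= Ur.
Hypothesis HUs : forall i, (i < l)%N -> \sum_(j < l) c i j ^+ (q - r) <= Us.

Let sum_le n (f : nat -> R) : (forall j, 0 <= f j) -> (n <= l)%N ->
  \sum_(j < n) f j <= \sum_(j < l) f j.
Proof.
move=> f0 nl; rewrite (big_ord_widen l f nl) big_mkcond/=.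
by apply: ler_sum => j _; case: ifP.
Qed.

Let row_ge0 s n i : 0 <= \sum_(j < n) c i j ^+ s.
Proof. by apply: sumr_ge0 => j _; rewrite exprn_ge0. Qed.

Let HUr' i : (i < l)%N -> \sum_(j < k) c i j ^+ r <= Ur.
Proof. move=> il; apply: le_trans (HUr il).
by apply: (sum_le (f := fun j => c i j ^+ r)) => // j; rewrite exprn_ge0. Qed.

Let HUs' i : (i < l)%N -> \sum_(j < k) c i j ^+ (q - r) <= Us.
Proof. move=> il; apply: le_trans (HUs il).
by apply: (sum_le (f := fun j => c i j ^+ (q - r))) => // j; rewrite exprn_ge0. Qed.

Let young_row i i' : (i < l)%N -> (i' < l)%N ->
  \sum_(b < l) c i b ^+ r * c i' b ^+ (q - r) <= Uq + Uq.
Proof.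
move=> il il'; apply: le_trans (_ : \sum_(b < l) (c i b ^+ q + c i' b ^+ q) <= _).
  by apply: ler_sum => b _; exact: young_pow.
by rewrite big_split/= lerD// HUq.
Qed.

(** Young's inequality bounds the sum over [b] by [2 Uq]; of the sums over [a'] and [b'], one then
    costs [Ur] and the other [Us], and the sum over [a] only [k]. Two such terms account for the
    factor 4. Keeping [a] for last makes the bound linear in the smaller length [k]. *)
Lemma quadruple_sum_le :
  \sum_(a < k) \sum_(b < l) \sum_(a' < k) \sum_(b' < l)
    (c a b * c a' b') ^+ r *
    ((c a a' * c b b') ^+ (q - r) + (c a b' * c b a') ^+ (q - r)) <=
  4 * k%:R * Uq * Ur * Us.
Proof.
have [l0|lp] := posnP l.
  rewrite big1; first by move: kl; rewrite l0 leqn0 => /eqP ->; rewrite mulr0 !mul0r.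
  by move=> a _; rewrite big1// => b; case: b => /= b; rewrite l0.
have Uq0 : 0 <= Uq by apply: le_trans (HUq lp).
have Ur0 : 0 <= Ur by apply: le_trans (HUr lp).
have Us0 : 0 <= Us by apply: le_trans (HUs lp).
have ltl (i : 'I_k) : (i < l)%N by exact: leq_trans (ltn_ord i) kl.
have T1 : \sum_(a < k) \sum_(b < l) \sum_(a' < k) \sum_(b' < l)
    (c a b ^+ r * c b' b ^+ (q - r)) * (c a' b' ^+ r * c a a' ^+ (q - r)) <=
    k%:R * ((Uq + Uq) * (Ur * Us)).
  rewrite (_ : k%:R * _ = \sum_(a < k) (Uq + Uq) * (Ur * Us)); last first.
    by rewrite sumr_const card_ord mulr_natl.
  apply: ler_sum => a _.
  rewrite exchange_big/=; under eq_bigr do rewrite exchange_big/=.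
  apply: (@le_trans _ _ (\sum_(a' < k) \sum_(b' < l) (Uq + Uq) * (c a' b' ^+ r * c a a' ^+ (q - r)))).
    apply: ler_sum => a' _; apply: ler_sum => b' _; rewrite -mulr_suml.
    by rewrite ler_wpM2r ?young_row// mulr_ge0// exprn_ge0.
  apply: (@le_trans _ _ (\sum_(a' < k) (Uq + Uq) * (Ur * c a a' ^+ (q - r)))).
    apply: ler_sum => a' _; rewrite -mulr_sumr ler_wpM2l ?addr_ge0// -mulr_suml.
    by rewrite ler_wpM2r ?exprn_ge0// HUr.
  by rewrite -mulr_sumr ler_wpM2l ?addr_ge0// -mulr_sumr ler_wpM2l// HUs'.
have T2 : \sum_(a < k) \sum_(b < l) \sum_(a' < k) \sum_(b' < l)
    (c a b ^+ r * c a' b ^+ (q - r)) * (c b' a' ^+ r * c a b' ^+ (q - r)) <=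
    k%:R * ((Uq + Uq) * (Ur * Us)).
  rewrite (_ : k%:R * _ = \sum_(a < k) (Uq + Uq) * (Ur * Us)); last first.
    by rewrite sumr_const card_ord mulr_natl.
  apply: ler_sum => a _.
  rewrite exchange_big/=; under eq_bigr do rewrite exchange_big/=.
  apply: (@le_trans _ _ (\sum_(a' < k) \sum_(b' < l) (Uq + Uq) * (c b' a' ^+ r * c a b' ^+ (q - r)))).
    apply: ler_sum => a' _; apply: ler_sum => b' _; rewrite -mulr_suml.
    by rewrite ler_wpM2r ?young_row// mulr_ge0// exprn_ge0.
  rewrite exchange_big/=.
  apply: (@le_trans _ _ (\sum_(b' < l) (Uq + Uq) * (Ur * c a b' ^+ (q - r)))).
    apply: ler_sum => b' _; rewrite -mulr_sumr ler_wpM2l ?addr_ge0// -mulr_suml.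
    by rewrite ler_wpM2r ?exprn_ge0// HUr'.
  by rewrite -mulr_sumr ler_wpM2l ?addr_ge0// -mulr_sumr ler_wpM2l// HUs.
rewrite (_ : 4 * k%:R * Uq * Ur * Us = k%:R * ((Uq + Uq) * (Ur * Us)) + k%:R * ((Uq + Uq) * (Ur * Us))); last by ring.
apply: le_trans (lerD T1 T2).
rewrite -big_split/= le_eqVlt; apply/orP; left; apply/eqP; apply: eq_bigr => a _.
rewrite -big_split/=; apply: eq_bigr => b _.
rewrite -big_split/=; apply: eq_bigr => a' _.
rewrite -big_split/=; apply: eq_bigr => b' _.
by rewrite (csym b' b) (csym b' a') (csym b a') !exprMn; ring.
Qed.

End quadruple_sums.

Section stein_correlation.
Context {R : realType} {d : measure_display} {Omega : measurableType d}.
Variables (P : probability Omega R) (X : nat -> Omega -> R) (C : nat -> nat -> R).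
Hypothesis gaussX : forall n th, centered_gaussian P (lincomb X n th)
  (\sum_(i < n) \sum_(j < n) th i * th j * C i j).
Hypothesis Csym : forall i j, C i j = C j i.
Hypothesis Cdiag : forall i, C i i = 1.
Variable p : nat.

Local Notation amom := (allmom_fgrowth gaussX Cdiag).

Definition Ssum k (x : nat -> R) := \sum_(a < k) hm p.+1 (x a).

(** In Malliavin calculus, the inner product of [D S_k] and [- D L^(-1) S_l]: the operator [L^(-1)]
    contributes [1 / (p + 1)] and the two derivatives [(p + 1)^2]. *)
Definition Tsum k l (x : nat -> R) :=
  p.+1%:R * \sum_(a < k) \sum_(b < l) C a b * (hm p (x a) * hm p (x b)).

Definition vcov k l : R := p.+1`!%:R * \sum_(a < k) \sum_(b < l) C a b ^+ p.+1.

Lemma smooth_Ssum k : smooth (Ssum k)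
  (fun c x => \sum_(a < k) p.+1%:R * hm p (x a) * c a).
Proof.
exact: (@smooth_sum _ _ _ _ (fun (a : 'I_k) x => hm p.+1 (x a))
  (fun (a : 'I_k) c x => p.+1%:R * hm p (x a) * c a) (fun a => smooth_hm p.+1 a)).
Qed.

Lemma allmom_hm n a : allmom P (fun w => hm n (X a w)).
Proof. by have s := smooth_hm (R := R) n a; apply: (amom (smooth_meas s) (smooth_growth s)). Qed.

Lemma allmom_Ssum k : allmom P (fun w => Ssum k (X ^~ w)).
Proof. by have s := smooth_Ssum k; apply: (amom (smooth_meas s) (smooth_growth s)). Qed.

Lemma allmom_Tsum k l : allmom P (fun w => Tsum k l (X ^~ w)).
Proof.
apply: allmomM; first exact: allmom_cst.
apply: allmom_sum => a; apply: allmom_sum => b; apply: allmomM; first exact: allmom_cst.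
by apply: allmomM; exact: allmom_hm.
Qed.

Lemma Ex_SS k l : Ex P (fun w => Ssum k (X ^~ w) * Ssum l (X ^~ w)) = vcov k l.
Proof.
rewrite (@eq_Ex _ _ _ _ _ (fun w => \sum_(a < k) \sum_(b < l) hm p.+1 (X a w) * hm p.+1 (X b w))).
  have I a b : intg P (fun w => hm p.+1 (X a w) * hm p.+1 (X b w)).
    by apply: allmom_intg; apply: allmomM; exact: allmom_hm.
  rewrite Ex_sum => [|a]; last by apply: intg_sum => b; exact: I.
  rewrite /vcov mulr_sumr; apply: eq_bigr => a _; rewrite Ex_sum => [|b]; last exact: I.
  by rewrite mulr_sumr; apply: eq_bigr => b _; exact: (H2_diag gaussX Csym Cdiag).
by move=> w; rewrite /Ssum mulr_suml; apply: eq_bigr => a _; rewrite mulr_sumr.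
Qed.

Lemma Ex_T k l : Ex P (fun w => Tsum k l (X ^~ w)) = vcov k l.
Proof.
have I a b : intg P (fun w => hm p (X a w) * hm p (X b w)).
  by apply: allmom_intg; apply: allmomM; exact: allmom_hm.
rewrite ExZ; last by apply: intg_sum => a; apply: intg_sum => b; apply: intgZ; exact: I.
rewrite Ex_sum => [|a]; last by apply: intg_sum => b; apply: intgZ; exact: I.
rewrite /vcov !mulr_sumr; apply: eq_bigr => a _.
rewrite Ex_sum => [|b]; last by apply: intgZ; exact: I.
rewrite !mulr_sumr; apply: eq_bigr => b _; rewrite ExZ; last exact: I.
have := H2_diag gaussX Csym Cdiag p a b; rewrite /H2 => ->.
by rewrite factS natrM exprS; ring.
Qed.

Lemma var_T k l : Ex P (fun w => (Tsum k l (X ^~ w) - vcov k l) ^+ 2) =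
  p.+1%:R ^+ 2 * \sum_(a < k) \sum_(b < l) \sum_(a' < k) \sum_(b' < l)
    C a b * C a' b' * cov4 P X p p p p a b a' b'.
Proof.
have Imm a b := allmomM (allmom_hm p a) (allmom_hm p b).
pose D a b w := hm p (X a w) * hm p (X b w) - H2 P X p p a b.
have AD a b : allmom P (D a b) by apply: allmomB; [exact: Imm|exact: allmom_cst].
have E1 w : Tsum k l (X ^~ w) - vcov k l = p.+1%:R * \sum_(a < k) \sum_(b < l) C a b * D a b w.
  rewrite /Tsum -Ex_T ExZ; last first.
    by apply: intg_sum => a; apply: intg_sum => b; apply: intgZ; apply: allmom_intg; exact: Imm.
  rewrite -mulrBr; congr (_ * _).
  rewrite Ex_sum => [|a]; last first.
    by apply: intg_sum => b; apply: intgZ; apply: allmom_intg; exact: Imm.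
  rewrite -sumrB; apply: eq_bigr => a _.
  rewrite Ex_sum => [|b]; last by apply: intgZ; apply: allmom_intg; exact: Imm.
  rewrite -sumrB; apply: eq_bigr => b _; rewrite ExZ; last by apply: allmom_intg; exact: Imm.
  by rewrite -mulrBr.
have E2 w : (Tsum k l (X ^~ w) - vcov k l) ^+ 2 = p.+1%:R ^+ 2 *
    \sum_(a < k) \sum_(b < l) \sum_(a' < k) \sum_(b' < l) C a b * C a' b' * (D a b w * D a' b' w).
  rewrite E1 exprMn; congr (_ * _); rewrite expr2 mulr_suml; apply: eq_bigr => a _.
  rewrite mulr_suml; apply: eq_bigr => b _.
  rewrite mulr_sumr; apply: eq_bigr => a' _.
  by rewrite mulr_sumr; apply: eq_bigr => b' _; ring.
rewrite (eq_Ex _ E2).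
have I a b a' b' : intg P (fun w => C a b * C a' b' * (D a b w * D a' b' w)).
  by apply: intgZ; apply: allmom_intg; apply: allmomM.
have I1 a b a' : intg P (fun w => \sum_(b' < l) C a b * C a' b' * (D a b w * D a' b' w)).
  by apply: intg_sum => b'.
have I2 a b : intg P (fun w => \sum_(a' < k) \sum_(b' < l) C a b * C a' b' * (D a b w * D a' b' w)).
  by apply: intg_sum => b'.
have I3 a : intg P (fun w => \sum_(b < l) \sum_(a' < k) \sum_(b' < l)
    C a b * C a' b' * (D a b w * D a' b' w)).
  by apply: intg_sum => b'.
rewrite ExZ; last by apply: intg_sum => a.
congr (_ * _); rewrite Ex_sum//; apply: eq_bigr => a _; rewrite Ex_sum//; apply: eq_bigr => b _.
rewrite Ex_sum//; apply: eq_bigr => a' _; rewrite Ex_sum//; apply: eq_bigr => b' _.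
rewrite ExZ; last by apply: allmom_intg; exact: allmomM.
congr (_ * _); rewrite /cov4.
have A4 := allmom_intg (allmomM (Imm a b) (Imm a' b')).
rewrite (@eq_Ex _ _ _ _ _ (fun w => ((hm p (X a w) * hm p (X b w)) * (hm p (X a' w) * hm p (X b' w))
   - H2 P X p p a b * (hm p (X a' w) * hm p (X b' w))) -
   (H2 P X p p a' b' * (hm p (X a w) * hm p (X b w)) - H2 P X p p a b * H2 P X p p a' b'))); last first.
  by move=> w; rewrite /D; ring.
have Iab := allmom_intg (Imm a b); have Iab' := allmom_intg (Imm a' b').
rewrite ExB; [|by apply: intgB => //; exact: intgZ|by apply: intgB; [exact: intgZ|exact: intg_cst]].
rewrite ExB//; last exact: intgZ.
rewrite ExB; [|exact: intgZ|exact: intg_cst].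
rewrite (ExZ _ Iab) (ExZ _ Iab') Ex_cst -/(H2 P X p p a b) -/(H2 P X p p a' b').
rewrite (_ : Ex P _ = H4 P X p p p p a b a' b'); first by ring.
by apply: eq_Ex => w; rewrite -mulrA.
Qed.

(** The variance is a quadruple sum of four-point covariances, to which [cov4_diag_bound] and
    [quadruple_sum_le] apply. About [C] only the row sums of its powers are used, through [U]. *)
Lemma var_T_bound : exists2 K : R, 0 <= K & forall k l (U : nat -> R), (k <= l)%N ->
  (forall s i, (i < l)%N -> \sum_(j < l) `|C i j| ^+ s <= U s) ->
  Ex P (fun w => (Tsum k l (X ^~ w) - vcov k l) ^+ 2) <=
  K * (k%:R * U p.+1 * \sum_(1 <= r < p.+1) U r * U (p.+1 - r)%N).
Proof.
have [K K0 HK] := cov4_diag_bound gaussX Csym Cdiag p.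
exists (p.+1%:R ^+ 2 * K * 4); first by rewrite !mulr_ge0.
move=> k l U kl HU; rewrite var_T -(mulrA _ 4) -(mulrA (_ ^+ 2)).
apply: ler_wpM2l; first by rewrite exprn_ge0.
pose Q r (a b a' b' : nat) := (`|C a b| * `|C a' b'|) ^+ r *
  ((`|C a a'| * `|C b b'|) ^+ (p.+1 - r) + (`|C a b'| * `|C b a'|) ^+ (p.+1 - r)).
apply: (@le_trans _ _ (\sum_(a < k) \sum_(b < l) \sum_(a' < k) \sum_(b' < l)
    K * \sum_(1 <= r < p.+1) Q r a b a' b')).
  do 4!(apply: ler_sum => ? _).
  apply: le_trans (ler_norm _) _; rewrite normrM; apply: le_trans (HK _ _ _ _) _.
  by rewrite ler_wpM2l// /Q le_eqVlt; apply/orP; left; apply/eqP; apply: eq_bigr => r _; rewrite !normrM.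
have -> : \sum_(a < k) \sum_(b < l) \sum_(a' < k) \sum_(b' < l)
    K * \sum_(1 <= r < p.+1) Q r a b a' b' = K * \sum_(1 <= r < p.+1)
      \sum_(a < k) \sum_(b < l) \sum_(a' < k) \sum_(b' < l) Q r a b a' b'.
  rewrite [in RHS]exchange_big/= mulr_sumr; apply: eq_bigr => a _.
  rewrite [in RHS]exchange_big/= mulr_sumr; apply: eq_bigr => b _.
  rewrite [in RHS]exchange_big/= mulr_sumr; apply: eq_bigr => a' _.
  by rewrite [in RHS]exchange_big/= mulr_sumr.
rewrite ler_wpM2l// !mulr_sumr big_seq_cond [leRHS]big_seq_cond; apply: ler_sum => r.
rewrite andbT mem_index_iota => /andP[r1 rp].
have := @quadruple_sum_le R (fun i j => `|C i j|) p.+1 r k l (U p.+1) (U r) (U (p.+1 - r)%N)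
  (fun _ _ => normr_ge0 _) (fun i j => congr1 Num.norm (Csym i j)) (ltnW rp) kl
  (HU _) (HU _) (HU _).
by rewrite -!mulrA.
Qed.

(** Each summand [hm p.+1 (X a)] is integrated by parts against the product of [f] and [h]; the
    derivatives of [S_k] and [S_l] in direction [C a], summed over [a] with weights [hm p (X a)],
    are [T_kk] and [T_kl]. *)
Lemma stein_identity k l (al be : R) (f f' h h' : R -> R) :
  (forall y : R, is_derive y (1 : R) f (f' y)) -> continuous f' -> polygrowth f -> polygrowth f' ->
  (forall y : R, is_derive y (1 : R) h (h' y)) -> continuous h' -> polygrowth h -> polygrowth h' ->
  Ex P (fun w => Ssum k (X ^~ w) * (f (al * Ssum k (X ^~ w)) * h (be * Ssum l (X ^~ w)))) =
  Ex P (fun w => al * (f' (al * Ssum k (X ^~ w)) * h (be * Ssum l (X ^~ w)) * Tsum k k (X ^~ w)) +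
                 be * (f (al * Ssum k (X ^~ w)) * h' (be * Ssum l (X ^~ w)) * Tsum k l (X ^~ w))).
Proof.
move=> df cf' gf gf' dh ch' gh gh'.
have sf := smooth_comp df cf' gf gf' (smoothZ al (smooth_Ssum k)).
have sh := smooth_comp dh ch' gh gh' (smoothZ be (smooth_Ssum l)).
have sM := smoothM sf sh.
have AM := amom (smooth_meas sM) (smooth_growth sM).
rewrite (@eq_Ex _ _ _ _ _ (fun w => \sum_(a < k) hm p.+1 (X a w) *
   (f (al * Ssum k (X ^~ w)) * h (be * Ssum l (X ^~ w))))); last first.
  by move=> w; rewrite {1}/Ssum mulr_suml.
rewrite Ex_sum => [|a]; last first.
  by apply: allmom_intg; apply: allmomM; [exact: allmom_hm|exact: AM].
under eq_bigr => a _ do rewrite (hm_ibp gaussX Csym Cdiag p a sM).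
rewrite -Ex_sum => [|a]; last first.
  apply: allmom_intg; apply: allmomM; first exact: allmom_hm.
  exact: (amom (smooth_dmeas sM (C a)) (smooth_dgrowth sM (C a))).
apply: eq_Ex => w; set x := X ^~ w.
set F := f _; set F' := f' _; set G := h _; set G' := h' _.
have E n : \sum_(a < k) hm p (x a) * (\sum_(b < n) p.+1%:R * hm p (x b) * C a b) = Tsum k n x.
  rewrite /Tsum mulr_sumr; apply: eq_bigr => a _; rewrite !mulr_sumr; apply: eq_bigr => b _; ring.
rewrite -(E k) -(E l) !mulr_sumr -big_split/=; apply: eq_bigr => a _.
by rewrite /x; ring.
Qed.

(** Only [h(G_k)] is replaced, by [f'(G_k) - G_k f(G_k)]; [h(G_l)] stays as a test function. With
    [al^2 vcov k k = 1], the terms in [f'] merge into [- al^2 (T_kk - vcov k k)] times a bounded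
    factor, and the rest is [T_kl] times a bounded factor. *)
Lemma stein_correlation_bound k l (al be M : R) (f f' h h' : R -> R) :
  0 <= al -> 0 <= be -> al ^+ 2 * vcov k k = 1 ->
  (forall y : R, is_derive y (1 : R) f (f' y)) -> continuous f' ->
  (forall y : R, is_derive y (1 : R) h (h' y)) -> continuous h' ->
  (forall y, `|f y| <= M) -> (forall y, `|f' y| <= M) ->
  (forall y, `|h y| <= M) -> (forall y, `|h' y| <= M) ->
  (forall y, f' y - y * f y = h y) ->
  `|Ex P (fun w => h (al * Ssum k (X ^~ w)) * h (be * Ssum l (X ^~ w)))| <=
  M ^+ 2 * (al ^+ 2 * Num.sqrt (Ex P (fun w => (Tsum k k (X ^~ w) - vcov k k) ^+ 2)) +
    al * be * (`|vcov k l| + Num.sqrt (Ex P (fun w => (Tsum k l (X ^~ w) - vcov k l) ^+ 2)))).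
Proof.
move=> al0 be0 alv df cf' dh ch' fM f'M hM h'M fh.
have pg (u : R -> R) : (forall y, `|u y| <= M) -> polygrowth u.
  by move=> uM; exists M, 0%N => y; rewrite mulr1.
have cf := continuous_is_derive df; have ch := continuous_is_derive dh.
have AS := allmom_Ssum.
have mc (u : R -> R) (g : Omega -> R) : continuous u -> measurable_fun setT g ->
    measurable_fun setT (fun w => u (g w)).
  by move=> cu mg; apply: measurableT_comp => //; exact: continuous_measurable_fun.
have mS k' (t : R) : measurable_fun setT (fun w => t * Ssum k' (X ^~ w)).
  by apply: measurable_funM => //; exact: allmom_meas (AS k').
pose A w := f' (al * Ssum k (X ^~ w)) * h (be * Ssum l (X ^~ w)).
pose B w := f (al * Ssum k (X ^~ w)) * h' (be * Ssum l (X ^~ w)).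
have mA : measurable_fun setT A by apply: measurable_funM; exact: mc.
have mB : measurable_fun setT B by apply: measurable_funM; exact: mc.
have A2 w : `|A w| <= M ^+ 2 by rewrite normrM expr2 ler_pM.
have B2 w : `|B w| <= M ^+ 2 by rewrite normrM expr2 ler_pM.
have AA := allmom_bounded P mA A2.
have AB := allmom_bounded P mB B2.
have := @stein_identity k l al be f f' h h' df cf' (pg _ fM) (pg _ f'M) dh ch' (pg _ hM) (pg _ h'M).
have AT := allmom_Tsum.
have IfS : intg P (fun w => Ssum k (X ^~ w) * (f (al * Ssum k (X ^~ w)) * h (be * Ssum l (X ^~ w)))).
  apply: allmom_intg; apply: allmomM; first exact: AS.
  apply: (@allmom_bounded _ _ _ _ _ (M ^+ 2)).
    by apply: measurable_funM; exact: mc.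
  by move=> w; rewrite normrM expr2 ler_pM.
have IAT : intg P (fun w => al * (A w * Tsum k k (X ^~ w)) + be * (B w * Tsum k l (X ^~ w))).
  by apply: intgD; apply: intgZ; apply: allmom_intg; exact: allmomM.
move=> H.
have -> : Ex P (fun w => h (al * Ssum k (X ^~ w)) * h (be * Ssum l (X ^~ w))) =
   Ex P (fun w => - (al ^+ 2) * (A w * (Tsum k k (X ^~ w) - vcov k k)) - al * be * (B w * Tsum k l (X ^~ w))).
  rewrite (@eq_Ex _ _ _ _ _ (fun w => A w - al * (Ssum k (X ^~ w) *
     (f (al * Ssum k (X ^~ w)) * h (be * Ssum l (X ^~ w)))))); last first.
    by move=> w; rewrite -[h (al * _)]fh /A; ring.
  rewrite ExB; [|exact: allmom_intg|exact: intgZ].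
  rewrite (ExZ al IfS) H -/A -/B -(ExZ al IAT) -ExB; [|exact: allmom_intg|exact: intgZ].
  apply: eq_Ex => w; rewrite -/(A w) -/(B w) -{1}[A w]mul1r -alv; ring.
have AD k' : allmom P (fun w => Tsum k k' (X ^~ w) - vcov k k').
  by apply: allmomB; [exact: AT|exact: allmom_cst].
have IA : intg P (fun w => - (al ^+ 2) * (A w * (Tsum k k (X ^~ w) - vcov k k))).
  by apply: intgZ; apply: allmom_intg; apply: allmomM.
have IB : intg P (fun w => al * be * (B w * Tsum k l (X ^~ w))).
  by apply: intgZ; apply: allmom_intg; apply: allmomM.
have In k' := intg_norm (allmom_intg (AD k')).
apply: le_trans (normr_Ex (intgB IA IB)) _.
apply: (@le_trans _ _ (Ex P (fun w => M ^+ 2 * (al ^+ 2 * `|Tsum k k (X ^~ w) - vcov k k| +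
   al * be * (`|vcov k l| + `|Tsum k l (X ^~ w) - vcov k l|))))).
  apply: le_Ex => [||w].
  - by apply: intg_norm; exact: intgB.
  - apply: intgZ; apply: intgD; apply: intgZ => //; apply: intgD => //; exact: intg_cst.
  apply: le_trans (ler_normB _ _) _; rewrite [leRHS]mulrDr; apply: lerD.
    rewrite normrM normrN (ger0_norm (sqr_ge0 al)) [leRHS]mulrCA.
    apply: ler_wpM2l; first exact: sqr_ge0.
    by rewrite normrM; apply: ler_wpM2r.
  rewrite normrM ger0_norm ?mulr_ge0// [leRHS]mulrCA; apply: ler_wpM2l; first exact: mulr_ge0.
  rewrite normrM; apply: ler_pM => //.
  by rewrite -{1}[Tsum k l _](subrK (vcov k l)) [leRHS]addrC ler_normD.
rewrite ExZ; last first.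
  by apply: intgD; apply: intgZ => //; apply: intgD => //; exact: intg_cst.
rewrite ler_wpM2l ?sqr_ge0// ExD; last 2 first.
- exact: intgZ.
- by apply: intgZ; apply: intgD => //; exact: intg_cst.
rewrite !ExZ//; last by apply: intgD => //; exact: intg_cst.
rewrite ExD ?Ex_cst//; last exact: intg_cst.
apply: lerD; first by rewrite ler_wpM2l ?sqr_ge0// Ex_norm_le_sqrt.
by rewrite ler_wpM2l ?mulr_ge0// lerD2l Ex_norm_le_sqrt.
Qed.

End stein_correlation.

(** * Covariance of fractional Gaussian noise *)

Section power_sums.
Variable R : realType.
Implicit Types (e th : R) (m n : nat).

Lemma powR_mvt e (x y : R) : 0 < x -> x < y ->
  exists2 z, x < z < y & y `^ e - x `^ e = e * z `^ (e - 1) * (y - x).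
Proof.
move=> x0 xy.
have d (z : R) : x <= z -> is_derive z (1 : R) (fun z => z `^ e) (e * z `^ (e - 1)).
  by move=> xz; apply: is_derive1_powR; exact: lt_le_trans xz.
have [||z + ->] := @MVT _ (fun z => z `^ e) (fun z => e * z `^ (e - 1)) x y xy.
- by move=> z; rewrite in_itv/= => /andP[/ltW xz _]; exact: d.
- apply: derivable_within_continuous => z; rewrite in_itv/= => /andP[xz _].
  by have [] := d z xz.
- by rewrite in_itv/= => xzy; exists z.
Qed.

Lemma powR_le_neg e (x y : R) : e <= 0 -> 0 < x -> x <= y -> y `^ e <= x `^ e.
Proof.
move=> e0 x0 xy; have y0 : 0 < y by exact: lt_le_trans xy.
have E (t : R) : t `^ e = (t `^ (- e))^-1 by rewrite -powRN opprK.
rewrite (E x) (E y) lef_pV2 ?posrE ?powR_gt0//.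
by rewrite ge0_ler_powR ?nnegrE ?oppr_ge0// ltW.
Qed.

Lemma powR_step e m : (0 < m)%N -> exists2 z : R, m%:R < z < m.+1%:R &
  m.+1%:R `^ e - m%:R `^ e = e * z `^ (e - 1).
Proof.
move=> m0; have [||z zm H] := @powR_mvt e m%:R m.+1%:R; rewrite ?ltr0n ?ltr_nat//.
by exists z => //; rewrite H -natr1 addrAC subrr add0r mulr1.
Qed.

Lemma sum_powR_lt1 th n : 0 <= th < 1 ->
  \sum_(m < n) (m.+1%:R : R) `^ (- th) <= n%:R `^ (1 - th) / (1 - th).
Proof.
move=> /andP[t0 t1]; have t10 : 0 < 1 - th by rewrite subr_gt0.
elim: n => [|n IH]; first by rewrite big_ord0 divr_ge0 ?powR_ge0// ltW.
rewrite big_ord_recr/= -lerBrDr; apply: le_trans IH _.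
rewrite lerBrDr -lerBrDl -mulrBl ler_pdivlMr//.
have [->|n0] := posnP n.
  by rewrite mulr1n !powR1 powR0 ?gt_eqF// subr0 mul1r; lra.
have [z /andP[z1 z2] ->] := powR_step (1 - th) n0.
rewrite mulrC ler_wpM2l ?(ltW t10)// (_ : 1 - th - 1 = - th); last by ring.
apply: powR_le_neg; rewrite ?oppr_le0//; last exact: ltW.
by apply: lt_trans z1; rewrite ltr0n.
Qed.

Lemma sum_powR_gt1 th n : 1 < th ->
  \sum_(m < n) (m.+1%:R : R) `^ (- th) <= 1 + (th - 1)^-1.
Proof.
move=> t1; have t10 : 0 < th - 1 by rewrite subr_gt0.
case: n => [|n]; first by rewrite big_ord0 addr_ge0// invr_ge0 ltW.
(* The induction carries the sharper bound by 1 plus the integral of [x^(- th)] over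
   [[1, n + 1]]. *)
suff H : \sum_(m < n.+1) (m.+1%:R : R) `^ (- th) <=
    1 + (1 - n.+1%:R `^ (1 - th)) / (th - 1).
  by apply: le_trans H _; rewrite lerD2l ler_pdivrMr// mulVf ?gt_eqF// gerBl powR_ge0.
elim: n => [|n IH]; first by rewrite big_ord1 !powR1 subrr mul0r addr0.
rewrite big_ord_recr/= -lerBrDr; apply: le_trans IH _.
have main : n.+2%:R `^ (- th) * (th - 1) <= n.+1%:R `^ (1 - th) - n.+2%:R `^ (1 - th).
  have [z /andP[z1 z2] E] := powR_step (1 - th) (ltn0Sn n).
  have -> : n.+1%:R `^ (1 - th) - n.+2%:R `^ (1 - th) = (th - 1) * z `^ (1 - th - 1).
    by rewrite -opprB E; ring.
  rewrite mulrC ler_wpM2l ?(ltW t10)//.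
  rewrite (_ : 1 - th - 1 = - th); last by ring.
  apply: powR_le_neg; rewrite ?oppr_le0; [lra| |exact: ltW].
  by apply: lt_trans z1; rewrite ltr0n.
by move: main; rewrite -ler_pdivlMr// !mulrBl; lra.
Qed.

Definition harm n : R := \sum_(i < n) i.+1%:R^-1.

Lemma harmS n : harm n.+1 = harm n + n.+1%:R^-1.
Proof. by rewrite /harm big_ord_recr. Qed.

Lemma harm_ge1 n : (0 < n)%N -> 1 <= harm n.
Proof.
by case: n => // n _; rewrite /harm big_ord_recl/= invr1 lerDl; apply: sumr_ge0.
Qed.

Lemma harm_mono m n : (m <= n)%N -> harm m <= harm n.
Proof.
move=> /subnKC <-; elim: (n - m)%N => [|k IH]; first by rewrite addn0.
by rewrite addnS harmS (le_trans IH)// lerDl invr_ge0.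
Qed.

Lemma harm_ge0 n : 0 <= harm n.
Proof. by rewrite sumr_ge0// => i _; rewrite invr_ge0. Qed.

(** At each step the left side grows by [(harm (n + 1) + n / (n + 1)) / 2], at most [harm (n + 1)].
    This provides the factor [n log n] in the critical variance. *)
Lemma sum_harm_ge n : n%:R * harm n / 2 <= \sum_(k < n) harm k.+1.
Proof.
elim: n => [|n IH]; first by rewrite big_ord0 !mul0r.
rewrite big_ord_recr/= -lerBlDr; apply: le_trans IH.
have h1 := harm_ge1 (ltn0Sn n); move: h1; rewrite harmS.
have : (n.+1%:R : R) * n.+1%:R^-1 = 1 by rewrite divff.
have : 0 <= (n.+1%:R : R)^-1 by rewrite invr_ge0.
set i := _^-1; rewrite -natr1; nra.
Qed.

Lemma harm_le_powR (de : R) n : 0 < de <= 1 -> harm n <= n%:R `^ de / de.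
Proof.
move=> /andP[d0 d1].
apply: (@le_trans _ _ (\sum_(m < n) (m.+1%:R : R) `^ (- (1 - de)))).
  apply: ler_sum => i _; rewrite -[X in X <= _]powR_inv1// ler_powR//; first by rewrite ler1n.
  by rewrite lerN2 lerBlDr lerDl ltW.
have := @sum_powR_lt1 (1 - de) n; rewrite (_ : 1 - (1 - de) = de); [apply|by ring].
by apply/andP; split; lra.
Qed.

Lemma sqrt_step m : m.+1%:R^-1 <= 2 * (Num.sqrt m.+1%:R - Num.sqrt m%:R) / Num.sqrt m.+1%:R :> R.
Proof.
set a := Num.sqrt m.+1%:R; set b := Num.sqrt m%:R.
have a0 : 0 < a by rewrite sqrtr_gt0.
have b0 : 0 <= b by rewrite sqrtr_ge0.
have aa : a ^+ 2 = m.+1%:R by rewrite sqr_sqrtr.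
have bb : b ^+ 2 = m%:R by rewrite sqr_sqrtr.
rewrite -aa ler_pdivlMr// expr2 invfM -mulrA mulVf ?gt_eqF// mulr1.
rewrite -(ler_pM2r a0) mulVf ?gt_eqF//.
have : a ^+ 2 = b ^+ 2 + 1 by rewrite aa bb natr1.
nra.
Qed.

(** The ratio of logarithms costs at most a multiple of [(l / k)^(1/2)], so half of a decay [k / l]
    survives. Each [1 / j] with [k < j <= l] is at most [2 (sqrt j - sqrt (j - 1)) / sqrt k], which
    telescopes. *)
Lemma harm_ratio k l : (0 < k <= l)%N ->
  harm l <= 2 * harm k * (Num.sqrt l%:R / Num.sqrt k%:R).
Proof.
move=> /andP[k0 kl]; pose s (n : nat) : R := Num.sqrt n%:R.
have s0 n : (0 < n)%N -> 0 < s n by move=> n0; rewrite sqrtr_gt0 ltr0n.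
suff H : harm l <= harm k + 2 * (s l / s k) - 2.
  have t1 : 1 <= s l / s k by rewrite ler_pdivlMr ?s0// mul1r ler_sqrt// ler_nat.
  have := harm_ge1 k0; move: H t1; rewrite -/(s l) -/(s k); set t := s l / s k; nra.
move: kl => /subnKC <-; elim: (l - k)%N => [|j IH].
  by rewrite addn0 divff ?gt_eqF ?s0// mulr1 addrK.
rewrite addnS harmS; set n := (k + j)%N in IH *.
have H1 := sqrt_step n.
have sk := s0 _ k0.
have H2 : 2 * (s n.+1 - s n) / s n.+1 <= 2 * (s n.+1 - s n) / s k.
  have nn : s n <= s n.+1 by rewrite ler_sqrt// ler_nat.
  rewrite ler_wpM2l//; first by rewrite mulr_ge0// subr_ge0.
  by rewrite lef_pV2 ?posrE ?s0// ler_sqrt// ler_nat /n; exact: leq_trans (leq_addr _ _) (leqnSn _).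
have H3 : n.+1%:R^-1 <= 2 * (s n.+1 / s k) - 2 * (s n / s k).
  by apply: le_trans (le_trans H1 H2) _; rewrite le_eqVlt; apply/orP; left; apply/eqP; ring.
move: IH H3; move: (s n.+1 / s k) (s n / s k) (n.+1%:R^-1) (harm n) (harm k) => A B I h g; lra.
Qed.

(** Discrete form of the integral of [h^(-1/2)]: [1 / (n + 1) = a^2 - b^2 <= 2 a (a - b)], with [a]
    and [b] the roots of consecutive harmonic numbers. *)
Lemma sum_harm_sqrt n : \sum_(k < n) k.+1%:R^-1 / Num.sqrt (harm k.+1) <= 2 * Num.sqrt (harm n).
Proof.
elim: n => [|n IH]; first by rewrite big_ord0 mulr_ge0// sqrtr_ge0.
rewrite big_ord_recr/= -lerBrDr; apply: le_trans IH _; rewrite lerBrDr -lerBrDl -mulrBr.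
set a := Num.sqrt (harm n.+1); set b := Num.sqrt (harm n).
have a0 : 0 < a by rewrite sqrtr_gt0 (lt_le_trans ltr01)// harm_ge1.
have b0 : 0 <= b by rewrite sqrtr_ge0.
have aa : a ^+ 2 = harm n.+1 by rewrite sqr_sqrtr// harm_ge0.
have bb : b ^+ 2 = harm n by rewrite sqr_sqrtr// harm_ge0.
rewrite ler_pdivrMr//.
have : n.+1%:R^-1 = a ^+ 2 - b ^+ 2 by rewrite aa bb harmS addrC addKr.
have := sqr_ge0 (a - b); move=> ? ->; nra.
Qed.

End power_sums.

Section fbm_covariance.
Variable R : realType.
Variable H : R.
Hypothesis H01 : 0 < H < 1.

(* Covariance of two increments of fractional Brownian motion at distance [m]. *)
Let powR2_ge1 (t : R) : 0 <= t -> 1 <= 2 `^ t.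
Proof.
move=> t0; apply: (@le_trans _ _ (2 `^ 0)); first by rewrite powRr0.
by rewrite ler_powR ?ler1n.
Qed.

Let powR2_le1 (t : R) : t <= 0 -> 2 `^ t <= 1.
Proof.
move=> t0; apply: (@le_trans _ _ (2 `^ 0)); last by rewrite powRr0.
by rewrite ler_powR ?ler1n.
Qed.

Definition rho (m : nat) : R :=
  (m.+1%:R `^ (2 * H) + `|m%:R - 1| `^ (2 * H) - 2 * m%:R `^ (2 * H)) / 2.

Let H0 : 0 < H. Proof. by case/andP: H01. Qed.
Let H2n0 : 2 * H != 0. Proof. by rewrite mulf_neq0// gt_eqF. Qed.

Lemma rho0 : rho 0 = 1.
Proof. by rewrite /rho sub0r normrN normr1 !powR1 powR0// mulr0 subr0 -[1 + 1]/2 divff. Qed.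

Lemma rho1 : rho 1 = 2 `^ (2 * H - 1) - 1.
Proof.
rewrite /rho subrr normr0 powR0// powR1 addr0 mulr1 mulrBl divff//.
by rewrite powRB ?pnatr_eq0 ?implybT// powRr1.
Qed.

(** [rho] is half the second difference of [x^(2 H)], evaluated by two applications of the mean
    value theorem. Distances 0 and 1 are excluded, as their second differences reach the point 0 or
    beyond. *)
Lemma rhoSS m : exists2 z : R, m.+1%:R < z < m.+3%:R &
  rho m.+2 = H * (2 * H - 1) * z `^ (2 * H - 2).
Proof.
pose g (x : R) := (x + 1) `^ (2 * H) - x `^ (2 * H).
pose g' (x : R) := 2 * H * (x + 1) `^ (2 * H - 1) - 2 * H * x `^ (2 * H - 1).
have dg (x : R) : m.+1%:R <= x -> is_derive x (1 : R) g (g' x).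
  move=> mx; have x0 : 0 < x by apply: lt_le_trans mx.
  have x10 : 0 < x + 1 by rewrite addr_gt0.
  have d1 : is_derive x (1 : R) (fun x => x `^ (2 * H)) (2 * H * x `^ (2 * H - 1)).
    exact: is_derive1_powR.
  have d2 : is_derive (x + 1) (1 : R) (fun x => x `^ (2 * H)) (2 * H * (x + 1) `^ (2 * H - 1)).
    exact: is_derive1_powR.
  have d3 : is_derive x (1 : R) (fun x => x + 1) (1 : R) by apply: is_derive_eq; rewrite addr0.
  have d4 := @is_derive1_comp R (fun x => x `^ (2 * H)) (fun x => x + 1) x _ _ d2 d3.
  rewrite mulr1 in d4.
  exact: is_deriveB d4 d1.
have mm : m.+1%:R < m.+2%:R :> R by rewrite ltr_nat.
have [||x + Hx] := @MVT _ g g' _ _ mm.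
- by move=> x; rewrite in_itv/= => /andP[/ltW mx _]; exact: dg.
- apply: derivable_within_continuous => x; rewrite in_itv/= => /andP[mx _].
  by have [] := dg x mx.
rewrite in_itv/= => /andP[x1 x2].
have x0 : 0 < x by apply: lt_trans x1.
have [|z /andP[z1 z2] Hz] := @powR_mvt _ (2 * H - 1) x (x + 1) x0; first by rewrite ltrDl.
exists z.
  rewrite (lt_trans x1 z1)/= (lt_trans z2)// -[m.+3%:R]natr1 ltrD2r//.
have e1 : m.+2%:R - m.+1%:R = 1 :> R by rewrite -natr1 addrAC subrr add0r.
rewrite e1 mulr1 in Hx.
have e2 : g' x = 2 * H * (2 * H - 1) * z `^ (2 * H - 2).
  rewrite /g' -mulrBr Hz (_ : x + 1 - x = 1); last by ring.
  by rewrite mulr1 mulrA; congr (_ * _ `^ _); ring.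
have e3 : rho m.+2 = (g m.+2%:R - g m.+1%:R) / 2.
  rewrite /rho /g.
  have -> : (m.+2%:R : R) - 1 = m.+1%:R by rewrite -natr1 addrK.
  rewrite ger0_norm// !natr1; congr (_ / 2); ring.
by rewrite e3 Hx e2; field.
Qed.

(** The true decay exponent is [2 - 2 H], but a smaller [a] may be chosen to place the sums of
    powers conveniently. The constant 9 is generous: [m + 3 <= 3 (m + 1)] costs a factor 3. *)
Lemma rho_le (a : R) m : 0 <= a <= 1 -> a <= 2 - 2 * H -> `|rho m| <= 9 * m.+1%:R `^ (- a).
Proof.
move=> /andP[a0 a1] aH.
have H1 : H < 1 by case/andP: H01.
have p2 (t : R) : 0 <= t <= 1 -> (1 <= (2 : R) `^ t <= 2).
  by move=> /andP[t0 t1]; rewrite powR2_ge1//= ler1_powR ?ler1n.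
have low : 1 / 2 <= (2 : R) `^ (- a).
  rewrite powRN div1r lef_pV2 ?posrE ?powR_gt0//.
  by have /andP[] := p2 a ltac:(by rewrite a0 a1).
case: m => [|[|m]].
- by rewrite rho0 normr1 powR1 mulr1 ler1n.
- rewrite rho1; have : `|(2 : R) `^ (2 * H - 1) - 1| <= 1; last by lra.
  have : 0 <= (2 : R) `^ (2 * H - 1) <= 2.
    by rewrite powR_ge0 ler1_powR ?ler1n//; lra.
  by move=> /andP[h1 h2]; rewrite ler_norml; apply/andP; split; lra.
have [z /andP[z1 z2] ->] := rhoSS m.
rewrite normrM (ger0_norm (powR_ge0 _ _)).
have zp : 0 < z by apply: lt_trans z1.
have c1 : `|H * (2 * H - 1)| <= 1.
  have h1 : 0 <= H * H by rewrite mulr_ge0 ?(ltW H0).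
  have h2 : H * H <= H by rewrite ler_piMr ?(ltW H0) ?(ltW H1).
  have -> : H * (2 * H - 1) = 2 * (H * H) - H by ring.
  by rewrite ler_norml; apply/andP; split; lra.
apply: (@le_trans _ _ (z `^ (2 * H - 2))); first by rewrite ler_piMl// powR_ge0.
apply: (@le_trans _ _ (m.+1%:R `^ (2 * H - 2))).
  by apply: powR_le_neg => //; [lra|exact: ltW].
apply: (@le_trans _ _ (m.+1%:R `^ (- a))).
  by rewrite ler_powR ?ler1n//; lra.
apply: (@le_trans _ _ ((m.+3%:R / 3) `^ (- a))).
  apply: powR_le_neg; rewrite ?oppr_le0// ?divr_gt0//.
  by rewrite ler_pdivrMr// -natrM ler_nat; lia.
rewrite powRM ?invr_ge0// mulrC ler_wpM2r ?powR_ge0//.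
rewrite (_ : (3 : R)^-1 = 3 `^ (-1)); last by rewrite powR_inv1.
rewrite -powRrM mulN1r opprK.
apply: (@le_trans _ _ (3 `^ 1)); first by rewrite ler_powR// ler1n.
by rewrite powRr1// ler_nat.
Qed.

Lemma rho_ge0 m : 1 / 2 <= H -> 0 <= rho m.
Proof.
move=> H12; case: m => [|[|m]].
- by rewrite rho0.
- by rewrite rho1 subr_ge0 powR2_ge1//; lra.
have [z _ ->] := rhoSS m; rewrite mulr_ge0 ?powR_ge0// mulr_ge0 ?(ltW H0)//; lra.
Qed.

(** The hypothesis holds at the critical index, where [H = 1 - 1 / (2 q)] with [q >= 2]. The factor
    1/4 is dictated by distance 1, where [sqrt 2 - 1 >= 1/4] is used. *)
Lemma rho_ge m : 3 / 4 <= H -> 1 / 4 * m.+1%:R `^ (2 * H - 2) <= rho m.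
Proof.
move=> H34; have H1 : H < 1 by case/andP: H01.
case: m => [|[|m]].
- by rewrite rho0 powR1; lra.
- rewrite rho1.
  have h1 : (2 : R) `^ (2 * H - 2) <= 1.
    by rewrite powR2_le1//; lra.
  have h2 : Num.sqrt 2 <= (2 : R) `^ (2 * H - 1).
    by rewrite -powR12_sqrt// ler_powR ?ler1n//; lra.
  have h3 : 5 / 4 <= Num.sqrt 2 :> R.
    by rewrite -(ger0_norm (_ : 0 <= 5 / 4 :> R)) ?divr_ge0// -sqrtr_sqr ler_sqrt//; lra.
  by lra.
have [z /andP[z1 z2] ->] := rhoSS m.
have zp : 0 < z by apply: lt_trans z1.
have : m.+3%:R `^ (2 * H - 2) <= z `^ (2 * H - 2).
  by apply: powR_le_neg => //; [lra|exact: ltW].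
have := powR_ge0 (m.+3%:R : R) (2 * H - 2).
set u := _ `^ _; set v := _ `^ _; have : 3 / 8 <= H * (2 * H - 1) by nra.
by nra.
Qed.

Lemma rho_lt_half m : H < 1 / 2 -> rho m.+1 <= 0.
Proof.
move=> H12; case: m => [|m].
  by rewrite rho1 subr_le0 powR2_le1//; lra.
have [z _ ->] := rhoSS m; rewrite mulr_le0_ge0 ?powR_ge0// mulr_ge0_le0 ?(ltW H0)//; lra.
Qed.

(** The second differences telescope to [((n + 1)^(2 H) - n^(2 H) - 1) / 2]. For [H < 1/2] this
    limits the total negative correlation on one side to 1/2. *)
Lemma sum_rho_ge n : - (1 / 2) <= \sum_(m < n) rho m.+1.
Proof.
suff -> : \sum_(m < n) rho m.+1 = (n.+1%:R `^ (2 * H) - n%:R `^ (2 * H) - 1) / 2.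
  have : (n%:R : R) `^ (2 * H) <= n.+1%:R `^ (2 * H).
    by rewrite ge0_ler_powR ?nnegrE ?mulr_ge0 ?(ltW H0)// ler_nat.
  by lra.
elim: n => [|n IH]; first by rewrite big_ord0 powR1 powR0// subr0 subrr mul0r.
have e : (n.+1%:R : R) - 1 = n%:R by rewrite -natr1 addrK.
by rewrite big_ord_recr/= IH /rho e ger0_norm//; field.
Qed.

End fbm_covariance.

(** * Row sums, lower bound on the variance and the correlation estimate *)

Section fbm_estimates.
Variables (R : realType) (H : R) (p : nat).
Hypothesis H01 : 0 < H < 1.
Hypothesis p0 : (0 < p)%N.
Hypothesis Hq : H <= Hcrit p.+1.

Let rh := @rho R H.

(** The absolute difference of two naturals: at least one of the truncated differences is 0. *)
Definition natdist (i j : nat) := ((i - j) + (j - i))%N.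

Definition incrcov (i j : nat) : R := rh (natdist i j).

Lemma natdistC i j : natdist i j = natdist j i.
Proof. by rewrite /natdist addnC. Qed.

Lemma sum_ord_le (f : nat -> R) m n : (forall j, 0 <= f j) -> (m <= n)%N ->
  \sum_(j < m) f j <= \sum_(j < n) f j.
Proof.
move=> f0 mn; rewrite (big_ord_widen n f mn) big_mkcond/=.
by apply: ler_sum => j _; case: ifP.
Qed.

Lemma sum_rev (g : nat -> R) a : \sum_(b < a.+1) g (a - b)%N = \sum_(m < a.+1) g m.
Proof.
rewrite (reindex_inj rev_ord_inj)/=; apply: eq_bigr => b _; congr g.
by have := ltn_ord b; lia.
Qed.

Lemma row_sum_le (g : nat -> R) i l : (forall m, 0 <= g m) -> (i < l)%N ->
  \sum_(j < l) g (natdist i j) <= 2 * \sum_(m < l) g m.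
Proof.
move=> g0 il; rewrite mulr_natl mulr2n.
rewrite -(big_mkord xpredT (fun j => g (natdist i j))) (big_cat_nat (n := i.+1))//=.
apply: lerD.
  rewrite big_mkord (eq_bigr (fun j : 'I_i.+1 => g (i - j)%N)) ?sum_rev ?sum_ord_le// => j _.
  by congr g; rewrite /natdist; have := ltn_ord j; lia.
rewrite -{1}[i.+1]add0n big_addn big_mkord.
apply: (@le_trans _ _ (\sum_(j < l - i.+1) g j.+1)).
  by apply: ler_sum => j _; rewrite (_ : natdist i (j + i.+1) = j.+1)// /natdist; lia.
apply: (@le_trans _ _ (\sum_(m < (l - i.+1).+1) g m)).
  by rewrite [leRHS]big_ord_recl/= lerDr.
by apply: sum_ord_le => //; lia.
Qed.

(** Growth of the variance of [V_n] divided by [n], up to constants. The harmonic number stands for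
    the logarithm and is positive already at [n = 1]. *)
Definition lam n : R := if H == Hcrit p.+1 then harm R n else 1.

Lemma lam_ge1 n : (0 < n)%N -> 1 <= lam n.
Proof. by move=> n0; rewrite /lam; case: ifP => // _; exact: harm_ge1. Qed.

Lemma lam_harm k l : (k <= l)%N -> lam l * harm R k <= lam k * harm R l.
Proof.
move=> kl; rewrite /lam; case: ifP => _; first by rewrite mulrC.
by rewrite !mul1r harm_mono.
Qed.

Lemma lam_ratio k l : (0 < k <= l)%N ->
  lam l <= 2 * lam k * (Num.sqrt l%:R / Num.sqrt k%:R).
Proof.
move=> kl; rewrite /lam; case: ifP => _; first exact: harm_ratio.
case/andP: kl => k0 kl; rewrite mulr1.
have : 1 <= Num.sqrt l%:R / Num.sqrt k%:R :> R.
  by rewrite ler_pdivlMr ?sqrtr_gt0 ?ltr0n// mul1r ler_sqrt// ler_nat.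
by lra.
Qed.

Lemma HcritE : Hcrit p.+1 = 1 - (2 * p.+1%:R)^-1 :> R.
Proof. by []. Qed.

(** [a p < 1] makes the sums of powers [r <= p] of [rho] grow at most like a power of the length,
    while [a (p + 1)] equal to 1 or above makes the sums of powers [p + 1] harmonic or bounded. *)
Lemma decay_exponent : exists a : R, [/\ 0 < a, a * p%:R < 1,
  (forall m, `|rh m| <= 9 * m.+1%:R `^ (- a)),
  H = Hcrit p.+1 -> a * p.+1%:R = 1 &
  H != Hcrit p.+1 -> 1 < a * p.+1%:R <= 2].
Proof.
have q0 : 0 < p.+1%:R :> R by [].
have pq : (p%:R : R) + 1 = p.+1%:R by rewrite natr1.
have p1 : 1 <= p%:R :> R by rewrite ler1n.
have [Hc|Hn] := eqVneq H (Hcrit p.+1).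
  exists (p.+1%:R^-1); split => //.
  - by rewrite mulrC ltr_pdivrMr// mul1r ltr_nat.
  - move=> m; apply: rho_le => //.
      by rewrite invr_ge0 (ltW q0)/= invf_le1// ler1n.
    by rewrite Hc HcritE invfM; set u := p.+1%:R^-1; lra.
  - by move=> _; rewrite mulVf// gt_eqF.
have Hlt : H < Hcrit p.+1 by rewrite lt_neqAle Hn.
have r0 : 0 < 2 * p%:R + 1 :> R by rewrite ltr_pwDr// mulr_ge0.
(* The number [2 / (2 p + 1)] lies strictly between [1 / (p + 1)] and [1 / p], and subcriticality
   means [1 / (p + 1) < 2 - 2 H]. *)
pose a := Num.min (2 - 2 * H) (2 / (2 * p%:R + 1)).
have H2 : p.+1%:R^-1 < 2 - 2 * H.
  by move: Hlt; rewrite HcritE invfM; set u := p.+1%:R^-1; lra.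
have a1 : p.+1%:R^-1 < a.
  rewrite lt_min H2/= ltr_pdivlMr// -[2]divr1 mulrC ltr_pdivrMr//. rewrite divr1 -pq; lra.
have a2 : a <= 2 / (2 * p%:R + 1) by rewrite ge_min lexx orbT.
have a3 : a <= 2 - 2 * H by rewrite ge_min lexx.
have a0 : 0 < a by apply: lt_trans a1; rewrite invr_gt0.
have a4 : a * (2 * p%:R + 1) <= 2 by rewrite -ler_pdivlMr.
exists a; split => //.
- by nra.
- by move=> m; apply: rho_le => //; apply/andP; split; [exact: ltW|nra].
- by move=> Hc; rewrite Hc eqxx in Hn.
- move=> _; apply/andP; split; last by rewrite -pq; nra.
  by rewrite mulrC -ltr_pdivrMl// mulr1.
Qed.

Lemma powR_exprn (x a : R) s : 0 <= x -> (x `^ (- a)) ^+ s = x `^ (- (a * s%:R)).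
Proof. by move=> x0; rewrite -powR_mulrn ?powR_ge0// -powRrM mulNr. Qed.

(** The products [U r * U (p.+1 - r)] are of order [l^(2 - a (p + 1))], whatever [r] is. In both
    regimes this gains a factor [1 / harm l] over [l lam l], and that gain forces the variance of
    the normalized [T] to 0. *)
Lemma incrcov_row_sums : exists2 K : R, 0 <= K & forall l, (0 < l)%N -> exists U : nat -> R,
  [/\ forall s i, (i < l)%N -> \sum_(j < l) `|incrcov i j| ^+ s <= U s,
    U p.+1 <= K * lam l &
    \sum_(1 <= r < p.+1) U r * U (p.+1 - r)%N <= K * (l%:R * lam l / harm R l)].
Proof.
have [a [a0 ap arho acrit asub]] := decay_exponent.
pose d0 := 1 - a * p%:R; have d00 : 0 < d0 by rewrite subr_gt0.
pose B := 2 * 9 ^+ p.+1 / d0 : R.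
have B0 : 0 <= B by rewrite divr_ge0 ?mulr_ge0 ?exprn_ge0// ltW.
pose de := a * p.+1%:R - 1.
(* In the critical case [de = 0], and its inverse is 0 by convention; the added ones cover that
   case. *)
pose K := 2 * 9 ^+ p.+1 * (1 + de^-1 + 1) + p%:R * (B * B) * (1 + `|de|^-1) : R.
have Up l s : 2 * \sum_(m < l) `|rh m| ^+ s <= 2 * 9 ^+ s * \sum_(m < l) m.+1%:R `^ (- (a * s%:R)).
  rewrite -mulrA ler_wpM2l// mulr_sumr; apply: ler_sum => m _.
  rewrite -powR_exprn// -exprMn lerXn2r// nnegrE ?mulr_ge0 ?powR_ge0//.
have de0 : 0 <= de.
  rewrite subr_ge0; have [/acrit->//|/asub/andP[/ltW]] := eqVneq H (Hcrit p.+1) => //.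
have dei : 0 <= de^-1 by rewrite invr_ge0.
have dea : 0 <= `|de|^-1 by rewrite invr_ge0.
have nineq : 0 <= 9 ^+ p.+1 :> R by rewrite exprn_ge0.
have pn0 : 0 <= p%:R :> R by [].
have Ka : 0 <= 2 * 9 ^+ p.+1 * (1 + de^-1 + 1) by rewrite !mulr_ge0 ?addr_ge0 ?addr_ge0.
have Kb : 0 <= p%:R * (B * B) * (1 + `|de|^-1) by apply: mulr_ge0; [apply: mulr_ge0 => //; exact: mulr_ge0|exact: addr_ge0].
have K0 : 0 <= K by rewrite addr_ge0.
exists K => //.
move=> l l0; exists (fun s => 2 * \sum_(m < l) `|rh m| ^+ s).
have nine : 1 <= 9 :> R by rewrite ler1n.
have hl := harm_ge1 R l0; have h0 : 0 < harm R l by apply: lt_le_trans hl.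
have K1 : 2 * 9 ^+ p.+1 * (1 + de^-1 + 1) <= K by rewrite lerDl.
have K2 : p%:R * (B * B) * (1 + `|de|^-1) <= K.
  by rewrite lerDr !mulr_ge0// ?addr_ge0// ?invr_ge0// exprn_ge0.
split.
- move=> s i il; exact: (row_sum_le (g := fun m => `|rh m| ^+ s)).
- apply: le_trans (Up l p.+1) _.
  apply: (@le_trans _ _ (2 * 9 ^+ p.+1 * (1 + de^-1 + 1) * lam l)); last first.
    by rewrite ler_wpM2r// (le_trans ler01)// lam_ge1.
  rewrite -[leRHS]mulrA ler_wpM2l ?mulr_ge0 ?exprn_ge0//.
  rewrite /lam; case: ifPn => [/eqP Hc|Hn].
    rewrite (acrit Hc) (eq_bigr (fun m : 'I_l => m.+1%:R^-1)).
      by rewrite -/(harm R l) ler_peMl ?(ltW h0)// -addrA lerDl addr_ge0// invr_ge0.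
    by move=> m _; rewrite powR_inv1.
  have /andP[h1 _] := asub Hn.
  by rewrite mulr1 (le_trans (sum_powR_gt1 _ h1))// lerDl.
apply: (@le_trans _ _ (p%:R * (B * B) * (1 + `|de|^-1) * (l%:R * lam l / harm R l))); last first.
  by rewrite ler_wpM2r// !mulr_ge0 ?invr_ge0// ?(ltW h0)// (le_trans ler01)// lam_ge1.
have lp : 0 < (l%:R : R) by rewrite ltr0n.
have Ur r : (0 < r)%N -> (r < p.+1)%N -> 2 * \sum_(m < l) `|rh m| ^+ r <= B * l%:R `^ (1 - a * r%:R).
  move=> r0 rp; apply: le_trans (Up l r) _.
  have ar : a * r%:R <= a * p%:R by rewrite ler_wpM2l ?(ltW a0)// ler_nat.
  have t01 : 0 <= a * r%:R < 1 by rewrite mulr_ge0 ?(ltW a0)//=; apply: le_lt_trans ar ap.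
  apply: (@le_trans _ _ (2 * 9 ^+ r * (l%:R `^ (1 - a * r%:R) / (1 - a * r%:R)))).
    by rewrite ler_wpM2l ?mulr_ge0 ?exprn_ge0// sum_powR_lt1.
  rewrite /B mulrA mulrAC [leRHS]mulrAC [2 * 9 ^+ p.+1 * _ / _]mulrAC ler_wpM2r ?powR_ge0//.
  rewrite ler_pM ?mulr_ge0 ?exprn_ge0 ?invr_ge0//.
  - by rewrite subr_ge0; case/andP: t01 => _ /ltW.
  - by rewrite ler_wpM2l// ler_weXn2l// ltnW.
  - rewrite lef_pV2 ?posrE ?subr_gt0//; first by rewrite lerB.
    by case/andP: t01.
(* The exponent is [1 - de]. If [de = 0], then [lam] and [harm] cancel; otherwise [lam = 1] and
   [harm l <= l^de / de], for which [de <= 1] was arranged. *)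
have main : (l%:R : R) `^ (2 - a * p.+1%:R) <= (1 + `|de|^-1) * (l%:R * lam l / harm R l).
  rewrite (_ : 2 - a * p.+1%:R = 1 + - de); last by rewrite /de; ring.
  rewrite powRD ?(gt_eqF lp) ?implybT// powRr1 ?ler0n// mulrCA -mulrA ler_wpM2l//.
  rewrite /lam; case: ifPn => [/eqP Hc|Hn].
    by rewrite /de (acrit Hc) subrr oppr0 powRr0 normr0 invr0 addr0 mul1r divff// gt_eqF.
  have /andP[h1 h2] := asub Hn.
  have d1 : 0 < de <= 1 by rewrite /de; apply/andP; split; lra.
  have := harm_le_powR l d1; case/andP: d1 => d1 _.
  rewrite powRN mul1r (gtr0_norm d1) => hh.
  have pp : 0 < (l%:R : R) `^ de by rewrite powR_gt0.
  rewrite -[X in X <= _]mul1r ler_pdivrMr// mulrAC ler_pdivlMr// mul1r.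
  apply: le_trans hh _; rewrite mulrC ler_wpM2r ?(ltW pp)// lerDr//.
have Kc : 0 <= p%:R * (B * B) by apply: mulr_ge0 => //; exact: mulr_ge0.
rewrite -mulrA; apply: le_trans (ler_wpM2l Kc main).
rewrite mulrAC -mulrA mulr_natl (_ : _ *+ p = \sum_(1 <= r < p.+1) (l%:R `^ (2 - a * p.+1%:R) * (B * B))); last first.
  by rewrite sumr_const_nat subn1.
rewrite big_seq [leRHS]big_seq; apply: ler_sum => r; rewrite mem_index_iota => /andP[r0 rp].
have s0 : (0 < p.+1 - r)%N by rewrite subn_gt0.
have sp : (p.+1 - r < p.+1)%N by rewrite ltn_subrL r0.
apply: le_trans (ler_pM _ _ (Ur r r0 rp) (Ur _ s0 sp)) _.
- by rewrite mulr_ge0// sumr_ge0// => m _; rewrite exprn_ge0.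
- by rewrite mulr_ge0// sumr_ge0// => m _; rewrite exprn_ge0.
rewrite [leLHS]mulrACA [leLHS]mulrC ler_wpM2r//; first exact: mulr_ge0.
rewrite -powRD ?(gt_eqF lp) ?implybT//.
rewrite natrB; last exact: ltnW.
by rewrite le_eqVlt; apply/orP; left; apply/eqP; congr (_ `^ _); ring.
Qed.

(** Three cases. At the critical index [rho^(p+1)] is at least a multiple of [1 / (m + 1)], and rows
    sum to harmonic numbers. For other [H >= 1/2] all terms are nonnegative and the diagonal
    suffices. For [H < 1/2] the off-diagonal part of a row is at most 1/2 in absolute value, against
    1 on the diagonal. *)
Lemma vcov_ge : exists2 ka : R, 0 < ka & forall n, ka * (n%:R * lam n) <= vcov incrcov p n n.
Proof.
suff [ka ka0 Hka] : exists2 ka : R, 0 < ka & forall n,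
    ka * (n%:R * lam n) <= \sum_(a < n) \sum_(b < n) incrcov a b ^+ p.+1.
  exists ka => // n; apply: le_trans (Hka n) _; rewrite ler_peMl ?ler1n ?fact_gt0//.
  by apply: le_trans (Hka n); rewrite !mulr_ge0 ?(ltW ka0)// /lam; case: ifP => // _; exact: harm_ge0.
have [Hc|Hn] := eqVneq H (Hcrit p.+1).
  have H34 : 3 / 4 <= H.
    rewrite Hc HcritE invfM.
    have : (p.+1%:R : R)^-1 <= 2^-1 by rewrite lef_pV2 ?posrE ?ltr0n// ler_nat.
    by set u := p.+1%:R^-1; lra.
  have e1 : (2 * H - 2) * p.+1%:R = -1.
    rewrite Hc HcritE invfM.
    transitivity (- (p.+1%:R^-1 * p.+1%:R) : R); last by rewrite mulVf.
    by set u := p.+1%:R^-1; field.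
  exists ((1 / 4) ^+ p.+1 / 2); first by rewrite divr_gt0// exprn_gt0.
  move=> n; rewrite /lam (introT eqP Hc).
  have := ler_wpM2l (exprn_ge0 p.+1 (_ : 0 <= 1 / 4 :> R)) (sum_harm_ge R n).
  move=> /(_ (divr_ge0 ler01 (ler0n _ _))) HH.
  apply: (@le_trans _ _ ((1 / 4) ^+ p.+1 * (n%:R * harm R n / 2))).
    by rewrite le_eqVlt; apply/orP; left; apply/eqP; field.
  apply: le_trans HH _; rewrite mulr_sumr; apply: ler_sum => a _.
  have r0 m : 0 <= rh m by apply: rho_ge0 => //; lra.
  apply: (@le_trans _ _ (\sum_(b < a.+1) rh (a - b) ^+ p.+1)).
    rewrite (sum_rev (fun m => rh m ^+ p.+1)) mulr_sumr; apply: ler_sum => m _.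
    apply: le_trans (_ : (1 / 4 * m.+1%:R `^ (2 * H - 2)) ^+ p.+1 <= _); last first.
      have q4 : 0 <= 1 / 4 :> R by lra.
      have hh := rho_ge H01 m H34.
      rewrite lerXn2r//; rewrite nnegrE//; apply: mulr_ge0 => //; exact: powR_ge0.
    rewrite [leRHS]exprMn ler_wpM2l ?exprn_ge0//.
    by rewrite -[_ `^ _ ^+ _]powR_mulrn ?powR_ge0// -powRrM e1 powR_inv1.
  apply: (@le_trans _ _ (\sum_(b < a.+1) incrcov a b ^+ p.+1)).
    apply: ler_sum => b _; rewrite le_eqVlt; apply/orP; left; apply/eqP; congr (rh _ ^+ _).
    by rewrite /natdist; have := ltn_ord b; lia.
  apply: (sum_ord_le (f := fun b => incrcov a b ^+ p.+1)) => [j|]; last exact: ltn_ord.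
  by rewrite exprn_ge0//; exact: r0.
exists (1 / 2); first by rewrite divr_gt0.
move=> n; rewrite /lam (negbTE Hn) mulr1 mulrC.
rewrite (_ : n%:R * _ = \sum_(a < n) (1 / 2)); last by rewrite sumr_const card_ord mulr_natl.
apply: ler_sum => a _.
have [H12|H12] := leP (1 / 2) H.
  rewrite (bigD1 a)//= {1}/incrcov (_ : natdist a a = 0%N) /rh; last by rewrite /natdist subnn.
  rewrite rho0 ?expr1n//; apply: (@le_trans _ _ 1); first by lra.
  by rewrite lerDl sumr_ge0// => b _; rewrite exprn_ge0//; exact: rho_ge0.
(* The off-diagonal terms in absolute value, with the diagonal set to 0 so that [row_sum_le]
   applies. *)
pose g m := if m is m'.+1 then `|rh m'.+1| ^+ p.+1 else 0.
have g0 m : 0 <= g m by case: m => //= m; rewrite exprn_ge0.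
have := row_sum_le g0 (ltn_ord a).
have sg : \sum_(m < n) g m <= 1 / 4.
  case: n a {g0} => [[]//|n] a; rewrite big_ord_recl/= add0r.
  have neg m : rh m.+1 <= 0 by exact: rho_lt_half.
  (* All the [rho m.+1] are nonpositive and their sums are at least [-1/2], so each one is. As
     [p + 1 >= 2], the power is then at most half of [|rho|], and the sum at most 1/4. *)
  have half m : `|rh m.+1| <= 1 / 2.
    rewrite ler0_norm// lerNl; apply: le_trans (sum_rho_ge H01 m.+1) _.
    by rewrite big_ord_recr/= gerDr; apply: sumr_le0.
  apply: (@le_trans _ _ (\sum_(m < n) 1 / 2 * - rh m.+1)).
    apply: ler_sum => m _; rewrite exprS mulrC ler_pM//; last by rewrite ler0_norm.
    move: p0; case: (p) => // p' _; rewrite exprS -[leRHS]mulr1 ler_pM// ?exprn_ge0// exprn_ile1//.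
    by apply: le_trans (half _) _; lra.
  rewrite -mulr_sumr sumrN; have := sum_rho_ge H01 n; rewrite /rh; lra.
have : 1 - \sum_(j < n) g (natdist a j) <= \sum_(b < n) incrcov a b ^+ p.+1.
  rewrite (bigD1 a)//= (_ : natdist a a = 0%N) /=; last by rewrite /natdist subnn.
  rewrite add0r [leRHS](bigD1 a)//= {1}/incrcov (_ : natdist a a = 0%N) /rh; last by rewrite /natdist subnn.
  rewrite rho0 ?expr1n// lerD2l -sumrN; apply: ler_sum => b ba.
  have : (0 < natdist a b)%N.
    by rewrite /natdist; move: ba => /eqP ba; apply/negPn/negP => hh; apply: ba; apply/val_inj => /=; lia.
  rewrite /incrcov; case: (natdist a b) => // m _ /=.
  by rewrite lerNl -normrX -normrN ler_norm.
by move: sg; lra.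
Qed.

Variables (d : measure_display) (Omega : measurableType d).
Variables (P : probability Omega R) (X : nat -> Omega -> R).
Hypothesis gaussX : forall n th, centered_gaussian P (lincomb X n th)
  (\sum_(i < n) \sum_(j < n) th i * th j * incrcov i j).

Let Csym i j : incrcov i j = incrcov j i.
Proof. by rewrite /incrcov natdistC. Qed.

Let Cdiag i : incrcov i i = 1.
Proof. by rewrite /incrcov /natdist subnn /rh rho0. Qed.

Lemma normalized_bound (ka al x v : R) : ka * x <= v -> al ^+ 2 * v = 1 ->
  al ^+ 2 * (ka * x) <= 1.
Proof. by move=> kv <-; apply: ler_wpM2l => //; exact: sqr_ge0. Qed.

(** [varb], used for the pairs [(k, k)] and [(k, l)], controls the fluctuations of [T], and [covb]
    the mean of [T_kl]. The normalizing constants enter only through [al^2 ka k lam_k <= 1], a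
    consequence of [vcov_ge]. *)
Lemma stein_sum_bound (M : R) (f f' h h' : R -> R) :
  (forall y : R, is_derive y (1 : R) f (f' y)) -> continuous f' ->
  (forall y : R, is_derive y (1 : R) h (h' y)) -> continuous h' ->
  (forall y, `|f y| <= M) -> (forall y, `|f' y| <= M) ->
  (forall y, `|h y| <= M) -> (forall y, `|h' y| <= M) ->
  (forall y, f' y - y * f y = h y) ->
  exists2 A : R, 0 <= A & forall k l (al be : R), (0 < k <= l)%N -> 0 <= al -> 0 <= be ->
    al ^+ 2 * vcov incrcov p k k = 1 -> be ^+ 2 * vcov incrcov p l l = 1 ->
    `|Ex P (fun w => h (al * Ssum p k (X ^~ w)) * h (be * Ssum p l (X ^~ w)))| <=
    A * ((Num.sqrt (harm R k))^-1 + Num.sqrt (Num.sqrt k%:R / Num.sqrt l%:R)).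
Proof.
move=> df cf' dh ch' fM f'M hM h'M fh.
have [ka ka0 Hka] := vcov_ge.
have [K2 K20 HK2] := incrcov_row_sums.
have [K1 K10 HK1] := var_T_bound gaussX Csym Cdiag p.
pose D := K1 * K2 ^+ 2 / ka ^+ 2.
have D0 : 0 <= D by rewrite divr_ge0 ?mulr_ge0 ?exprn_ge0// ltW.
pose E := p.+1`!%:R * K2 / ka * Num.sqrt 2.
have E0 : 0 <= E by rewrite !mulr_ge0 ?sqrtr_ge0// invr_ge0 ltW.
have M0 : 0 <= M by apply: le_trans (fM 0).
have varb k l (al be : R) : (0 < k <= l)%N -> 0 <= al -> 0 <= be ->
    al ^+ 2 * vcov incrcov p k k = 1 -> be ^+ 2 * vcov incrcov p l l = 1 ->
    al * be * Num.sqrt (Ex P (fun w => (Tsum incrcov p k l (X ^~ w) - vcov incrcov p k l) ^+ 2)) <=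
    Num.sqrt D * (Num.sqrt (harm R k))^-1.
  move=> /andP[k0 kl] al0 be0 alv bev; have l0 := leq_trans k0 kl.
  set V := Ex _ _.
  have hk := lt_le_trans ltr01 (harm_ge1 R k0); have hl := lt_le_trans ltr01 (harm_ge1 R l0).
  have lk := lt_le_trans ltr01 (lam_ge1 k0); have ll := lt_le_trans ltr01 (lam_ge1 l0).
  rewrite -(ger0_norm (mulr_ge0 al0 be0)) -sqrtr_sqr -sqrtrM ?sqr_ge0//.
  rewrite -sqrtrV ?(ltW hk)// -sqrtrM// ler_wsqrtr//.
  have [U [U1 U2 U3]] := HK2 l l0.
  have HV := HK1 k l U kl U1.
  have U0 : 0 <= U p.+1 by apply: le_trans (U1 p.+1 0%N l0); apply: sumr_ge0 => j _; exact: exprn_ge0.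
  set x := k%:R * lam k; set y := l%:R * lam l.
  have x0 : 0 <= x by rewrite mulr_ge0// ltW.
  have y0 : 0 <= y by rewrite mulr_ge0// ltW.
  have ax := normalized_bound (Hka k) alv; have by_ := normalized_bound (Hka l) bev.
  (* Rows of length [l] produce the ratio [lam l / harm l], which does not increase with the index
     and may be replaced by [lam k / harm k]. *)
  have HV2 : V <= K1 * K2 ^+ 2 * (x * y / harm R k).
    apply: le_trans HV _.
    apply: (@le_trans _ _ (K1 * (k%:R * (K2 * lam l) * (K2 * (y / harm R l))))).
      apply: ler_wpM2l => //; apply: ler_pM => //.
      - by rewrite mulr_ge0.
      - apply: sumr_ge0 => r _; apply: mulr_ge0.
          by apply: le_trans (U1 r 0%N l0); apply: sumr_ge0 => j _; exact: exprn_ge0.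
        by apply: le_trans (U1 (p.+1 - r)%N 0%N l0); apply: sumr_ge0 => j _; exact: exprn_ge0.
      - by apply: ler_wpM2l.
    have -> : K1 * (k%:R * (K2 * lam l) * (K2 * (y / harm R l))) =
        K1 * K2 ^+ 2 * (k%:R * y * (lam l / harm R l)).
      by rewrite expr2; ring.
    apply: ler_wpM2l; first by rewrite mulr_ge0 ?exprn_ge0.
    have -> : x * y / harm R k = k%:R * y * (lam k / harm R k) by rewrite /x; ring.
    apply: ler_wpM2l; first exact: mulr_ge0.
    by rewrite ler_pdivrMr// mulrAC ler_pdivlMr// lam_harm.
  apply: (@le_trans _ _ ((al * be) ^+ 2 * (K1 * K2 ^+ 2 * (x * y / harm R k)))).
    by apply: ler_wpM2l => //; exact: sqr_ge0.
  have -> : (al * be) ^+ 2 * (K1 * K2 ^+ 2 * (x * y / harm R k)) =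
     ((al ^+ 2 * (ka * x)) * (be ^+ 2 * (ka * y))) * (D / harm R k).
    by rewrite /D; field; rewrite !gt_eqF.
  have hD : 0 <= D / harm R k by apply: divr_ge0 => //; exact: ltW.
  rewrite ler_piMl//.
  by rewrite mulr_ile1// mulr_ge0 ?sqr_ge0// mulr_ge0// ltW.
have covb k l (al be : R) : (0 < k <= l)%N -> 0 <= al -> 0 <= be ->
    al ^+ 2 * vcov incrcov p k k = 1 -> be ^+ 2 * vcov incrcov p l l = 1 ->
    al * be * `|vcov incrcov p k l| <= E * Num.sqrt (Num.sqrt k%:R / Num.sqrt l%:R).
  move=> /andP[k0 kl] al0 be0 alv bev; have l0 := leq_trans k0 kl.
  have lk := lt_le_trans ltr01 (lam_ge1 k0); have ll := lt_le_trans ltr01 (lam_ge1 l0).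
  have [U [U1 U2 U3]] := HK2 l l0.
  have vb : `|vcov incrcov p k l| <= p.+1`!%:R * K2 * (k%:R * lam l).
    rewrite /vcov normrM ger0_norm// -mulrA ler_wpM2l//.
    apply: le_trans (ler_norm_sum _ _ _) _.
    apply: (@le_trans _ _ (\sum_(a < k) K2 * lam l)); last first.
      by rewrite sumr_const card_ord mulrCA [leRHS]mulr_natl.
    apply: ler_sum => a _; apply: le_trans (ler_norm_sum _ _ _) _.
    apply: le_trans U2; apply: le_trans (U1 p.+1 a (leq_trans (ltn_ord a) kl)).
    by rewrite le_eqVlt; apply/orP; left; apply/eqP; apply: eq_bigr => j _; rewrite normrX.
  have ax := normalized_bound (Hka k) alv; have by_ := normalized_bound (Hka l) bev.
  set sk := Num.sqrt k%:R; set sl := Num.sqrt l%:R.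
  have sk0 : 0 < sk by rewrite sqrtr_gt0 ltr0n.
  have sl0 : 0 < sl by rewrite sqrtr_gt0 ltr0n.
  have ke : k%:R = sk ^+ 2 by rewrite sqr_sqrtr.
  have le : l%:R = sl ^+ 2 by rewrite sqr_sqrtr.
  apply: (@le_trans _ _ (al * be * (p.+1`!%:R * K2 * (k%:R * lam l)))).
    by apply: ler_wpM2l => //; exact: mulr_ge0.
  rewrite /E -[leRHS]mulrA -sqrtrM//.
  have -> : al * be * (p.+1`!%:R * K2 * (k%:R * lam l)) =
     p.+1`!%:R * K2 / ka * (al * be * ka * (k%:R * lam l)).
    by field; rewrite gt_eqF.
  apply: ler_wpM2l; first by rewrite !mulr_ge0// invr_ge0 ltW.
  have W0 : 0 <= al * be * ka * (k%:R * lam l).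
    by apply: mulr_ge0; [rewrite !mulr_ge0// ltW|rewrite mulr_ge0// ltW].
  rewrite -(ger0_norm W0) -sqrtr_sqr ler_wsqrtr//.
  (* After squaring, normalization leaves [k lam_l / (l lam_k)], at most [2 sqrt (k / l)] by
     [lam_ratio]; hence the fourth root of [k / l]. *)
  have -> : (al * be * ka * (k%:R * lam l)) ^+ 2 =
     ((al ^+ 2 * (ka * (k%:R * lam k))) * (be ^+ 2 * (ka * (l%:R * lam l)))) * (k%:R * lam l / (l%:R * lam k)).
    by field; rewrite gt_eqF//= gt_eqF// ltr0n.
  apply: (@le_trans _ _ (k%:R * lam l / (l%:R * lam k))).
    have xx (u v : R) n : 0 < v -> 0 <= u ^+ 2 * (ka * (n%:R * v)).
      by move=> v0; rewrite mulr_ge0 ?sqr_ge0// mulr_ge0 ?(ltW ka0)// mulr_ge0// ltW.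
    rewrite ler_piMl//; first by rewrite divr_ge0// mulr_ge0// ltW.
    by rewrite mulr_ile1// xx.
  have k0l : (0 < k <= l)%N by rewrite k0.
  have lr := lam_ratio k0l; rewrite -/sk -/sl in lr.
  rewrite ler_pdivrMr ?mulr_gt0 ?ltr0n//.
  apply: (@le_trans _ _ (k%:R * (2 * lam k * (sl / sk)))); first by rewrite ler_wpM2l.
  rewrite ke le le_eqVlt; apply/orP; left; apply/eqP; field.
  by rewrite !gt_eqF.
exists (M ^+ 2 * (2 * Num.sqrt D + E)).
  by apply: mulr_ge0; [exact: exprn_ge0|rewrite addr_ge0// mulr_ge0// sqrtr_ge0].
move=> k l al be kl al0 be0 alv bev.
apply: le_trans (stein_correlation_bound gaussX Csym Cdiag _ al0 be0 alv df cf' dh ch' fM f'M hM h'M fh) _.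
rewrite -[leRHS]mulrA; apply: ler_wpM2l; first exact: exprn_ge0.
have kk : (0 < k <= k)%N by rewrite leqnn andbT; case/andP: kl.
have v1 := varb k k al al kk al0 al0 alv alv; rewrite -expr2 in v1.
have v2 := varb k l al be kl al0 be0 alv bev.
have v3 := covb k l al be kl al0 be0 alv bev.
set r1 := (Num.sqrt (harm R k))^-1 in v1 v2 *; set r2 := Num.sqrt (_ / _) in v3 *.
have r10 : 0 <= r1 by rewrite invr_ge0 sqrtr_ge0.
have r20 : 0 <= r2 by rewrite sqrtr_ge0.
have e1 : 0 <= E * r1 by exact: mulr_ge0.
have e2 : 0 <= Num.sqrt D * r2 by rewrite mulr_ge0 ?sqrtr_ge0.
by rewrite mulrDr mulrDl !mulrDr; lra.
Qed.

End fbm_estimates.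

(** * Almost sure convergence of logarithmic averages *)

Section harmonic_log.
Variable R : realType.

Lemma ln_step (n : nat) : ln (n.+2%:R : R) - ln n.+1%:R <= n.+1%:R^-1.
Proof.
rewrite -ln_div ?posrE ?ltr0n//.
rewrite (_ : n.+2%:R / n.+1%:R = 1 + n.+1%:R^-1); last first.
  by rewrite -natr1 mulrDl divff// mul1r.
by apply: le_ln1Dx; rewrite (@lt_le_trans _ _ 0)// ?oppr_lt0 ?invr_ge0.
Qed.

Lemma ln_step_ge (n : nat) : n.+2%:R^-1 <= ln (n.+2%:R : R) - ln n.+1%:R.
Proof.
rewrite -opprB lerNr -ln_div ?posrE ?ltr0n//.
rewrite (_ : n.+1%:R / n.+2%:R = 1 + (- n.+2%:R^-1)); last first.
  by apply: (mulIf (lt0r_neq0 (ltr0Sn R n.+1))); rewrite mulfVK// mulrBl mulVf// mul1r -[n.+2%:R]natr1 addrK.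
apply: le_ln1Dx; rewrite ltrN2 invf_lt1 ?ltr1n//.
Qed.

Lemma harm_ge_ln n : ln (n.+1%:R : R) <= harm R n.
Proof.
elim: n => [|n IH]; first by rewrite ln1 harm_ge0.
rewrite harmS; have := ln_step n; set u := _^-1; lra.
Qed.

Lemma harm_le_ln n : harm R n.+1 <= 1 + ln (n.+1%:R : R).
Proof.
elim: n => [|n IH]; first by rewrite harmS /harm big_ord0 ln1 add0r addr0 invr1.
rewrite harmS; have := ln_step_ge n; set u := _^-1; lra.
Qed.

Lemma harm_unbounded (x : R) : exists n, x <= harm R n.
Proof.
exists (Num.truncn (expR x)); apply: le_trans (harm_ge_ln _).
by rewrite -[leLHS]expRK ler_ln ?posrE ?expR_gt0// ltW// truncnS_gt.
Qed.

Lemma harm_sub (S : nat -> R) (M : R) : (forall n, `|S n.+1 - S n| <= M / n.+1%:R) ->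
  forall m n, (m <= n)%N -> `|S n - S m| <= M * (harm R n - harm R m).
Proof.
move=> HS m n /subnKC <-; elim: (n - m)%N => [|k IH].
  by rewrite addn0 !subrr normr0 mulr0.
rewrite addnS harmS (_ : S _ - S m = (S (m + k).+1 - S (m + k)%N) + (S (m + k)%N - S m)).
  by apply: le_trans (ler_normD _ _) _; have := HS (m + k)%N; set u := _^-1; lra.
by rewrite addrA subrK.
Qed.

(** While [harm] passes from [j^4] to [(j + 1)^4], [S] moves by at most [M] times the increment of
    [harm]; this is [O(j^3)], negligible against [j^4]. *)
Lemma harm_interpolation (S : nat -> R) (M : R) (N : nat -> nat) :
  (forall n, `|S n.+1 - S n| <= M / n.+1%:R) ->
  (forall j, j%:R ^+ 4 <= harm R (N j)) ->
  (forall j n, j%:R ^+ 4 <= harm R n -> (N j <= n)%N) ->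
  (fun j => S (N j.+1) / harm R (N j.+1)) @ \oo --> (0 : R) ->
  (fun n => S n / harm R n) @ \oo --> (0 : R).
Proof.
move=> HS HN Nmin cS.
have M0 : 0 <= M by rewrite -[M]divr1; apply: le_trans (HS 0%N).
apply/cvgrPdist_le => e e0.
have e20 : 0 < e / 2 by rewrite divr_gt0.
have /cvgrPdist_le/(_ _ e20)[J1 _ HJ1] := cS.
(* The constant 15 is [4 + 6 + 4 + 1]: [(x + 1)^4 - x^4 <= 15 x^3] for [x >= 1]. Beyond [J],
   [15 M <= (e / 2) x]. *)
pose J := maxn J1 (Num.truncn (15 * M / (e / 2))).
exists (N J.+2) => // n /= nN.
have hnJ : J.+2%:R ^+ 4 <= harm R n by apply: le_trans (HN J.+2) _; exact: harm_mono.
have ex : exists j : nat, harm R n < j%:R ^+ 4.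
  exists (Num.truncn (harm R n)).+1; apply: lt_le_trans (truncnS_gt _) _.
  by rewrite -natrX ler_nat -[leqLHS]expn1 leq_pexp2l.
case: (ex_minnP ex) => j' hj' jmin.
have jJ : (J.+2 < j')%N.
  rewrite ltnNge; apply/negP => jj.
  have : (j'%:R : R) ^+ 4 <= J.+2%:R ^+ 4 by rewrite lerXn2r ?nnegrE// ler_nat.
  by move=> h; have := lt_le_trans hj' (le_trans h hnJ); rewrite ltxx.
case: j' => [//|j] in hj' jmin jJ *; rewrite ltnS in jJ.
have hj : j%:R ^+ 4 <= harm R n.
  by rewrite leNgt; apply/negP => /jmin; rewrite ltnn.
have j0 : (0 < j)%N by apply: leq_trans jJ.
case: j => [//|j] in hj hj' jmin jJ j0 *.
have Nn := Nmin _ _ hj.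
have Nh := HN j.+1.
have hN0 : 0 < harm R (N j.+1) by apply: lt_le_trans Nh; rewrite exprn_gt0.
have hn0 : 0 < harm R n by apply: lt_le_trans hj; rewrite exprn_gt0.
have A1 : `|S (N j.+1)| <= e / 2 * harm R (N j.+1).
  have : (J1 <= j)%N by apply: (@leq_trans J); [exact: leq_maxl|exact: ltnW].
  move=> /HJ1 /=; rewrite sub0r normrN normrM normfV (gtr0_norm hN0).
  by rewrite ler_pdivrMr.
have A2 := harm_sub HS Nn.
have A3 : harm R (N j.+1) <= harm R n by exact: harm_mono.
set x : R := j.+1%:R in hj Nh.
have x1 : 1 <= x by rewrite ler1n.
have hx : harm R n - x ^+ 4 <= 15 * x ^+ 3.
  have : harm R n <= (x + 1) ^+ 4 by rewrite natr1 ltW.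
  have x2 : x <= x ^+ 2 by rewrite expr2 ler_peMl// (le_trans ler01).
  have x3 : x ^+ 2 <= x ^+ 3 by rewrite [leRHS]exprS ler_peMl// exprn_ge0// (le_trans ler01).
  have -> : (x + 1) ^+ 4 = x ^+ 4 + 4 * x ^+ 3 + 6 * x ^+ 2 + 4 * x + 1 by ring.
  by lra.
have xe : 15 * M <= e / 2 * x.
  rewrite -ler_pdivrMl// mulrC; apply/ltW; apply: lt_le_trans (truncnS_gt _) _.
  rewrite ler_nat; have : (Num.truncn (15 * M / (e / 2)) <= J)%N by exact: leq_maxr.
  by move=> hJ; apply: leq_trans jJ; rewrite ltnS (leq_trans hJ).
have x30 : 0 <= x ^+ 3 by rewrite exprn_ge0// (le_trans ler01).
have A4 : M * (harm R n - harm R (N j.+1)) <= e / 2 * harm R n.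
  apply: (@le_trans _ _ (M * (15 * x ^+ 3))); first by rewrite ler_wpM2l//; lra.
  apply: (@le_trans _ _ (e / 2 * x * x ^+ 3)).
    by rewrite mulrA (mulrC M) ler_wpM2r.
  by rewrite -mulrA -exprS ler_wpM2l// ltW.
rewrite sub0r normrN normrM normfV (gtr0_norm hn0) ler_pdivrMr//.
have : `|S n| <= `|S n - S (N j.+1)| + `|S (N j.+1)|.
  by rewrite -[X in `|X| <= _](subrK (S (N j.+1))) ler_normD.
have : e / 2 * harm R (N j.+1) <= e / 2 * harm R n by rewrite ler_wpM2l// ltW.
by lra.
Qed.

Lemma sum_inv_sqr_le n : \sum_(j < n) (j.+1%:R ^+ 2)^-1 <= 2 :> R.
Proof.
have h : (1 : R) < 2 by rewrite ltr1n.
have := sum_powR_gt1 n h; rewrite (_ : 2 - 1 = 1 :> R); last by ring.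
rewrite invr1 => H; apply: le_trans _ (le_trans H _); last by lra.
by apply: ler_sum => j _; rewrite powRN powR_mulrn.
Qed.

End harmonic_log.

Section almost_sure.
Variables (R : realType) (d : measure_display) (Omega : measurableType d).
Variable P : probability Omega R.

(** By monotone convergence the series of the [f n] has a finite integral, so it converges almost
    surely and its terms tend to 0. *)
Lemma ae_cvg0_summable (f : nat -> Omega -> R) (K : R) :
  (forall n w, 0 <= f n w) -> (forall n, intg P (f n)) ->
  (forall n, \sum_(j < n) Ex P (f j) <= K) ->
  {ae P, forall w, (fun n => f n w) @ \oo --> (0 : R)}.
Proof.
move=> f0 If HK.
pose g w := (\sum_(n <oo) (f n w)%:E)%E.
have mf n : measurable_fun setT (fun w => (f n w)%:E).
  by apply/measurable_EFinP; exact: intg_meas.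
have g0 w : (0 <= g w)%E by apply: nneseries_ge0 => n _ _; rewrite lee_fin.
have mg : measurable_fun setT g.
  by apply: ge0_emeasurable_sum => // n w _ _; rewrite lee_fin.
have ig : (\int[P]_w g w <= K%:E)%E.
  rewrite /g integral_nneseries//; last by move=> n w _; rewrite lee_fin.
  apply: lime_le; first by apply: is_cvg_nneseries => n _ _; apply: integral_ge0 => w _; rewrite lee_fin.
  apply: nearW => n /=; rewrite big_mkord.
  rewrite (eq_bigr (fun j : 'I_n => (Ex P (f j))%:E)); last by move=> j _; rewrite EFin_Ex.
  by rewrite sumEFin lee_fin; exact: HK.
have Ig : P.-integrable setT g.
  apply/integrableP; split => //.
  rewrite (eq_integral g); last by move=> w _; rewrite gee0_abs.
  by apply: le_lt_trans ig _; rewrite ltry.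
apply: filterS (integrable_ae measurableT Ig) => w /(_ Logic.I) gw.
apply: cvg_series_cvg_0; apply: nnseries_is_cvg => //.
by rewrite ltey_eq gw.
Qed.

Lemma ex_harm_pow4 (j : nat) : exists n, j%:R ^+ 4 <= harm R n.
Proof. exact: harm_unbounded. Qed.

Variables (xi : nat -> Omega -> R) (M A : R).
Hypothesis mxi : forall k, measurable_fun setT (xi k).
Hypothesis xiM : forall k w, `|xi k w| <= M.
Hypothesis A0 : 0 <= A.
Hypothesis xiA : forall k l, (k <= l)%N -> `|Ex P (fun w => xi k w * xi l w)| <=
  A * ((Num.sqrt (harm R k.+1))^-1 + Num.sqrt (Num.sqrt k.+1%:R / Num.sqrt l.+1%:R)).

Let S n w := \sum_(k < n) xi k w / k.+1%:R.

Lemma inv_sqrt4 k : k.+1%:R^-1 * Num.sqrt (Num.sqrt k.+1%:R) = k.+1%:R `^ (- (3 / 4)) :> R.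
Proof.
rewrite -!powR12_sqrt ?sqrtr_ge0// -powRrM -(@powR_inv1 _ k.+1%:R)// -powRD; last first.
  by rewrite pnatr_eq0 implybT.
by congr (_ `^ _); field.
Qed.

(** The double sum is twice the part [k <= l], at most. For fixed [l], the first term of the bound
    sums to [2 sqrt (harm n)], and the second to [l^(-1/4)] times the sum of [k^(-3/4)], at most 4.
    The outer weights [1 / l] give [harm n]. *)
Lemma log_sum_second_moment n : Ex P (fun w => S n w ^+ 2) <= 12 * A * (harm R n * Num.sqrt (harm R n)).
Proof.
case: n => [|n].
  rewrite (@eq_Ex _ _ _ _ _ (fun=> 0)) ?Ex_cst.
    by rewrite !mulr_ge0 ?harm_ge0// sqrtr_ge0.
  by move=> w; rewrite /S big_ord0 expr0n.
have hn1 := harm_ge1 R (ltn0Sn n); set N := n.+1 in hn1 *.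
have Ixx k l : intg P (fun w => xi k w * xi l w).
  apply: (@intg_bounded _ _ _ _ _ (M * M)) => [|w]; first exact: measurable_funM.
  by rewrite normrM ler_pM.
pose b k l : R := if (k <= l)%N then A * ((Num.sqrt (harm R k.+1))^-1 +
  Num.sqrt (Num.sqrt k.+1%:R / Num.sqrt l.+1%:R)) else 0.
have b0 k l : 0 <= b k l.
  by rewrite /b; case: ifP => // _; rewrite mulr_ge0// addr_ge0 ?sqrtr_ge0// invr_ge0 sqrtr_ge0.
have Eb k l : `|Ex P (fun w => xi k w * xi l w)| <= b k l + b l k.
  have [kl|lk] := leqP k l.
    by apply: le_trans (xiA kl) _; rewrite {1}/b kl lerDl.
  rewrite (@eq_Ex _ _ _ _ _ (fun w => xi l w * xi k w)); last by move=> w; rewrite mulrC.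
  by apply: le_trans (xiA (ltnW lk)) _; rewrite {2}/b (ltnW lk) lerDr.
have -> : Ex P (fun w => S N w ^+ 2) =
   \sum_(k < N) \sum_(l < N) (k.+1%:R^-1 * l.+1%:R^-1) * Ex P (fun w => xi k w * xi l w).
  rewrite (@eq_Ex _ _ _ _ _ (fun w => \sum_(k < N) \sum_(l < N) (k.+1%:R^-1 * l.+1%:R^-1) * (xi k w * xi l w))).
    rewrite Ex_sum => [|k]; last by apply: intg_sum => l; exact: intgZ.
    apply: eq_bigr => k _; rewrite Ex_sum => [|l]; last exact: intgZ.
    by apply: eq_bigr => l _; rewrite ExZ.
  move=> w; rewrite expr2 /S big_distrlr/=; apply: eq_bigr => k _; apply: eq_bigr => l _.
  by rewrite mulrACA mulrC.
apply: (@le_trans _ _ (\sum_(k < N) \sum_(l < N) (k.+1%:R^-1 * l.+1%:R^-1) * (b k l + b l k))).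
  apply: ler_sum => k _; apply: ler_sum => l _; apply: ler_wpM2l; first by rewrite mulr_ge0.
  by apply: le_trans (ler_norm _) (Eb _ _).
have -> : \sum_(k < N) \sum_(l < N) (k.+1%:R^-1 * l.+1%:R^-1) * (b k l + b l k) =
   2 * \sum_(l < N) \sum_(k < N) (k.+1%:R^-1 * l.+1%:R^-1) * b k l.
  under eq_bigr do under eq_bigr do rewrite mulrDr.
  under eq_bigr do rewrite big_split/=.
  rewrite big_split/= mulr_natl mulr2n; congr (_ + _); first by rewrite exchange_big.
  by apply: eq_bigr => k _; apply: eq_bigr => l _; rewrite (mulrC k.+1%:R^-1).
apply: (@le_trans _ _ (2 * \sum_(l < N) l.+1%:R^-1 * (A * (2 * Num.sqrt (harm R N)) + A * 4))).
  rewrite ler_wpM2l//; apply: ler_sum => l _.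
  under eq_bigr do rewrite (mulrC _ l.+1%:R^-1) -mulrA.
  rewrite -mulr_sumr ler_wpM2l//.
  apply: (@le_trans _ _ (\sum_(k < N) (A * (k.+1%:R^-1 / Num.sqrt (harm R k.+1)) +
     if (k <= l)%N then A * (k.+1%:R^-1 * Num.sqrt (Num.sqrt k.+1%:R / Num.sqrt l.+1%:R)) else 0))).
    apply: ler_sum => k _; rewrite /b; case: ifP => _.
      by rewrite le_eqVlt; apply/orP; left; apply/eqP; ring.
    by rewrite mulr0 addr0 mulr_ge0// mulr_ge0// invr_ge0 sqrtr_ge0.
  rewrite big_split/=; apply: lerD; first by rewrite -mulr_sumr ler_wpM2l// sum_harm_sqrt.
  rewrite -big_mkcond/=.
  rewrite (_ : \sum_(k < N | (k <= l)%N) _ = \sum_(k < l.+1) A * (k.+1%:R^-1 * Num.sqrt (Num.sqrt k.+1%:R / Num.sqrt l.+1%:R))); last first.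
    by rewrite (big_ord_widen N (fun k => A * (k.+1%:R^-1 * Num.sqrt (Num.sqrt k.+1%:R / Num.sqrt l.+1%:R))) (ltn_ord l)).
  rewrite -mulr_sumr ler_wpM2l//.
  have sl0 : 0 < Num.sqrt (Num.sqrt l.+1%:R) :> R by rewrite !sqrtr_gt0.
  under eq_bigr => k _ do rewrite sqrtrM ?sqrtr_ge0// sqrtrV ?sqrtr_ge0// mulrA inv_sqrt4.
  rewrite -mulr_suml ler_pdivrMr//.
  have th : 0 <= (3 / 4 : R) < 1 by apply/andP; split; lra.
  apply: le_trans (sum_powR_lt1 l.+1 th) _.
  rewrite (_ : 1 - 3 / 4 = 4^-1 :> R); last by field.
  rewrite invrK mulrC ler_wpM2l// -!powR12_sqrt ?sqrtr_ge0// -powRrM.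
  by rewrite le_eqVlt; apply/orP; left; apply/eqP; congr (_ `^ _); field.
rewrite -mulr_suml -/(harm R N).
have s1 : 1 <= Num.sqrt (harm R N) by rewrite -sqrtr1 ler_wsqrtr.
have : A * 4 <= A * (4 * Num.sqrt (harm R N)) by rewrite ler_wpM2l// ler_peMr.
move=> hA.
have -> : 12 * A * (harm R N * Num.sqrt (harm R N)) =
  2 * (harm R N * (A * (2 * Num.sqrt (harm R N)) + A * (4 * Num.sqrt (harm R N)))) by ring.
by rewrite ler_wpM2l// ler_wpM2l ?harm_ge0// lerD2l.
Qed.

(** By the second moment, [E[(S / harm)^2] <= 12 A harm^(-1/2)], which is at most [12 A / j^2] once
    [harm >= j^4], and the series over [j] is at most [24 A]. Fourth powers are still close enough
    for [harm_interpolation]. *)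
Lemma log_average_cvg0 :
  {ae P, forall w, (fun n => (\sum_(k < n) xi k w / k.+1%:R) / harm R n) @ \oo --> (0 : R)}.
Proof.
pose N j := ex_minn (ex_harm_pow4 j).
have HN j : j%:R ^+ 4 <= harm R (N j) by rewrite /N; case: ex_minnP.
have Nmin j n : j%:R ^+ 4 <= harm R n -> (N j <= n)%N.
  by rewrite /N; case: ex_minnP => m _; apply.
have hN j : 0 < harm R (N j.+1) by apply: lt_le_trans (HN _); rewrite exprn_gt0.
(* The index [j + 1] avoids [N 0 = 0], where [harm] vanishes. *)
pose f j w := (S (N j.+1) w / harm R (N j.+1)) ^+ 2.
have M0 (w : Omega) : 0 <= M by apply: le_trans (xiM 0%N w).
have aS n : allmom P (S n).
  apply: allmom_sum => k; apply: allmomM; last exact: allmom_cst.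
  exact: allmom_bounded.
have aS2 j : allmom P (f j) by apply: allmomX; apply: allmomM => //; exact: allmom_cst.
have fE : {ae P, forall w, (fun n => f n w) @ \oo --> (0 : R)}.
  apply: (@ae_cvg0_summable _ (24 * A)).
  - by move=> n w; exact: sqr_ge0.
  - by move=> n; exact: allmom_intg.
  move=> n; apply: (@le_trans _ _ (\sum_(j < n) 12 * A * (j.+1%:R ^+ 2)^-1)); last first.
    rewrite -mulr_sumr; apply: le_trans (ler_wpM2l _ (sum_inv_sqr_le R n)) _.
      by rewrite mulr_ge0.
    by rewrite (_ : 24 * A = 12 * A * 2)//; ring.
  apply: ler_sum => j _.
  rewrite (@eq_Ex _ _ _ _ _ (fun w => (harm R (N j.+1) ^+ 2)^-1 * S (N j.+1) w ^+ 2)); last first.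
    by move=> w; rewrite /f expr_div_n mulrC.
  rewrite ExZ; last by apply: allmom_intg; exact: allmomX.
  set h := harm R (N j.+1) in HN hN *; have h0 : 0 < h by exact: hN.
  rewrite mulrC ler_pdivrMr ?exprn_gt0//.
  apply: le_trans (log_sum_second_moment _) _; rewrite -/h -!mulrA !ler_wpM2l//.
  rewrite mulrC expr2 mulrA ler_wpM2r ?(ltW h0)//.
  set s := Num.sqrt h; have hs : h = s ^+ 2 by rewrite sqr_sqrtr// ltW.
  have s0 : 0 < s by rewrite sqrtr_gt0.
  rewrite mulrC ler_pdivlMr ?mulr_gt0// [leRHS]hs [leRHS]expr2 ler_wpM2l ?(ltW s0)// -expr2.
  have := HN j.+1; rewrite -[harm R (N j.+1)]/h hs (exprM _ 2 2).
  by rewrite ler_pXn2r ?nnegrE ?exprn_ge0// ltW.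
apply: filterS fE => w fw.
apply: (@harm_interpolation R (S ^~ w) M N _ HN Nmin).
  move=> n; rewrite /S big_ord_recr/= addrAC subrr add0r normrM normfV.
  by rewrite (ger0_norm (ler0n R _)) ler_wpM2r.
apply/cvgrPdist_le => e e0; have e20 : 0 < e ^+ 2 by rewrite exprn_gt0.
have /cvgrPdist_le/(_ _ e20)[J _ HJ] := fw.
exists J => // j /HJ /=; rewrite !sub0r !normrN /f normrX.
by rewrite ler_pXn2r// nnegrE// ltW.
Qed.

End almost_sure.

(** * Stein's equation *)

Section stein_equation.
Variable R : realType.
Local Notation mu := (@lebesgue_measure R).
Local Notation gam := (normal_prob (0 : R) 1).
Local Notation pdf := (normal_pdf (0 : R) 1).

Let pdfE (x : R) : pdf x = normal_peak 1 * expR (- (x ^+ 2 / 2)).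
Proof.
rewrite normal_pdf0E ?oner_eq0// expr1n; congr (_ * expR _).
by rewrite mulNr.
Qed.

Let peak0 : 0 < normal_peak (1 : R).
Proof. by rewrite normal_peak_gt0// oner_eq0. Qed.

Let pdf_gt0 (x : R) : 0 < pdf x.
Proof. by rewrite pdfE mulr_gt0// expR_gt0. Qed.

Lemma is_derive_normal_pdf (x : R) : is_derive x (1 : R) pdf (- x * pdf x).
Proof.
have -> : pdf = (fun y => normal_peak 1 * expR (- (y ^+ 2 / 2))) by apply/funext => y; exact: pdfE.
by apply: is_derive_eq; rewrite /GRing.scale/=; field.
Qed.

Lemma mvt_le (D D' : R -> R) (x y : R) : x <= y ->
  (forall z, x <= z -> is_derive z (1 : R) D (D' z)) -> (forall z, x <= z -> D' z <= 0) ->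
  D y <= D x.
Proof.
rewrite le_eqVlt => /predU1P[->//|xy] dD D0.
have [||z] := @MVT R D D' x y xy.
- by move=> z; rewrite in_itv/= => /andP[xz _]; exact/dD/ltW.
- apply: derivable_within_continuous => z; rewrite in_itv/= => /andP[xz _].
  by have [] := dD z xz.
rewrite in_itv/= => /andP[xz _] E.
by rewrite -subr_le0 E mulr_le0_ge0 ?D0 ?subr_ge0// ltW.
Qed.

(* Mills-type bound: the derivative of [M pdf x / x] dominates that of [F]. *)
Lemma mills_bound (F h : R -> R) (M : R) :
  (forall x : R, is_derive x (1 : R) F (h x * pdf x)) -> (forall x, `|h x| <= M) ->
  F n%:R @[n --> \oo] --> (0 : R) ->
  forall x, 1 <= x -> `|F x| <= M * (pdf x / x).
Proof.
move=> dF hM cF x x1.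
have M0 : 0 <= M by apply: le_trans (hM 0).
have key s : (s = 1 \/ s = -1) -> s * F x <= M * (pdf x / x).
  move=> s1.
  have sabs z : `|s * z| = `|z| by case: s1 => ->; rewrite ?mul1r// mulN1r normrN.
  (* [D] does not increase on [[x, +oo[], and [D n >= - s F(n)], which tends to 0; hence [D x >= 0].
     The sign [s] treats both sides of the absolute value at once. *)
  pose D z := M * (pdf z * z^-1) - s * F z.
  pose D' z := M * (- pdf z - pdf z / z ^+ 2) - s * (h z * pdf z).
  have dD z : x <= z -> is_derive z (1 : R) D (D' z).
    move=> xz; have z0 : 0 < z by apply: lt_le_trans xz; exact: lt_le_trans x1.
    have dp := is_derive_normal_pdf z.
    have di : is_derive z (1 : R) (fun y : R => y^-1) (- (z ^- 2) *: 1).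
      by apply: is_deriveV; rewrite gt_eqF.
    have H1 := is_deriveZ M (is_deriveM dp di).
    have H2 := is_deriveB H1 (is_deriveZ s (dF z)).
    apply: is_derive_eq H2 _.
    rewrite /D' /GRing.scale/=; field; exact: lt0r_neq0.
  have D'0 z : x <= z -> D' z <= 0.
    move=> xz; have e : `|s * (h z * pdf z)| = `|h z| * pdf z.
      by rewrite sabs normrM (gtr0_norm (pdf_gt0 z)).
    have := ler_norm (- (s * (h z * pdf z))); rewrite normrN e.
    have : `|h z| * pdf z <= M * pdf z by rewrite ler_wpM2r// ltW.
    have : 0 <= M * (pdf z / z ^+ 2) by rewrite mulr_ge0// divr_ge0 ?sqr_ge0// ltW.
    by rewrite /D' mulrBr mulrN; set a := M * (_ / _); lra.
  rewrite -subr_ge0 -/(D x); apply/ler_addgt0Pr => e e0; rewrite -lerBlDr sub0r.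
  have /cvgrPdist_le/(_ _ e0)[N _ HN] := cF.
  pose n := maxn N (Num.truncn x).+1.
  have xn : x <= n%:R.
    by apply/ltW/(lt_le_trans (truncnS_gt x)); rewrite ler_nat leq_maxr.
  have := HN n (leq_maxl _ _); rewrite /= sub0r normrN -sabs => Fn.
  apply: le_trans _ (mvt_le xn dD D'0).
  have n0 : 0 < (n%:R : R) by apply: lt_le_trans xn; apply: lt_le_trans x1.
  have : 0 <= M * (pdf n%:R * n%:R^-1) by rewrite mulr_ge0// mulr_ge0 ?invr_ge0// ltW.
  by have := ler_norm (s * F n%:R); rewrite /D; set a := M * _; lra.
rewrite ler_norml; apply/andP; split.
  by rewrite lerNl -mulN1r key//; right.
by rewrite -[F x]mul1r key//; left.
Qed.

Lemma cvg_integral_Nyitv (g : R -> R) : mu.-integrable setT (EFin \o g) ->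
  (Rintegral mu `]-oo, n%:R]%classic g) @[n --> \oo] --> Rintegral mu setT g /\
  (Rintegral mu `]-oo, - (n%:R : R)]%classic g) @[n --> \oo] --> (0 : R).
Proof.
move=> Ig; have mg := measurable_int _ Ig.
have gen (E : nat -> set R) (G : R -> R) : (forall n, measurable (E n)) -> measurable_fun setT G ->
    (forall x, (fun n => ((EFin \o g) \_ (E n)) x) @ \oo --> (G x)%:E) ->
    (Rintegral mu (E n) g) @[n --> \oo] --> Rintegral mu setT G.
  move=> mE mG cE.
  have mf_ n : measurable_fun setT ((EFin \o g) \_ (E n)).
    by apply: (measurable_restrictT _ _).1 => //; exact: measurable_funTS.
  have f_le : {ae mu, forall (x : R) n, setT x -> (`|((EFin \o g) \_ (E n)) x| <= (abse \o (EFin \o g)) x)%E}.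
    apply: aeW => x n _; rewrite patchE; case: ifP => //= _.
    by rewrite normr0 lee_fin.
  have mGE : measurable_fun setT (EFin \o G) by exact/measurable_EFinP.
  have fG : {ae mu, forall x : R, setT x ->
      (fun n => ((EFin \o g) \_ (E n)) x) @ \oo --> (EFin \o G) x}.
    by apply: aeW => x _; exact: cE.
  have [IG _ H] := @dominated_convergence _ _ _ mu _ measurableT _ _ _ mf_ mGE
    fG (integrable_abse Ig) f_le.
  rewrite /Rintegral; apply: fine_cvg.
  rewrite fineK; last exact: integrable_fin_num.
  by apply: cvg_trans H; apply: near_eq_cvg; apply: nearW => n /=; rewrite -integral_mkcond.
split.
  apply: gen => [n|//|x]; first exact: measurable_itv.
    by apply/measurable_EFinP.
  apply: cvg_near_cst; exists (Num.bound `|x|) => // n /= xn; rewrite patchE ifT//.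
  rewrite inE/= in_itv/= (le_trans (ler_norm x))// ltW// (lt_le_trans (archi_boundP _))//.
  by rewrite ler_nat.
rewrite (_ : 0 = Rintegral mu setT (fun=> 0 : R)); last by rewrite /Rintegral integral0.
apply: (gen _ (fun=> 0)) => [n|//|x]; first exact: measurable_itv.
apply: cvg_near_cst; exists (Num.bound `|x|) => // n /= xn; rewrite patchE ifF//.
apply/negP; rewrite inE/= in_itv/= lerNr => h.
have : `|x| < n%:R by rewrite (lt_le_trans (archi_boundP _))// ler_nat.
by rewrite ltNge; move/negP; apply; apply: le_trans h _; rewrite -normrN ler_norm.
Qed.

(** The solution is [f = F / pdf], where [F] is the integral of [h pdf] up to [x]. Since [h] has
    mean 0, [F] vanishes at both ends, and [mills_bound] gives [|x f| <= M] for [|x| >= 1]. On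
    [[-1, 1]] continuity bounds [f], and [f' = h + x f] inherits the bounds. *)
Lemma stein_solution (h : R -> R) (M : R) : continuous h -> (forall x, `|h x| <= M) ->
  Ex gam h = 0 ->
  exists (f f' : R -> R) (K : R), [/\ forall y : R, is_derive y (1 : R) f (f' y),
    continuous f', forall y, `|f y| <= K, forall y, `|f' y| <= K &
    forall y, f' y - y * f y = h y].
Proof.
move=> ch hM h0.
have M0 : 0 <= M by apply: le_trans (hM 0).
have mh : measurable_fun setT h by exact: continuous_measurable_fun.
have Ih : intg gam h by apply: intg_polygrowth => //; exists M, 0%N => x; rewrite mulr1.
have cp : continuous pdf.
  by move=> x; apply: continuous_is_derive; exact: is_derive_normal_pdf.
pose g x := h x * pdf x.
have cg : continuous g by move=> x; apply: continuousM; [exact: ch|exact: cp].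
have Ig : mu.-integrable setT (EFin \o g) by exact: ((@intg_normal_probP R 1 h mh).1 Ih).
have g0 : Rintegral mu setT g = 0 by rewrite -(@Ex_normal_prob R 1 h Ih).
pose F x := Rintegral mu `]-oo, x]%classic g.
have dF (x : R) : is_derive x (1 : R) F (g x).
  have Ix : mu.-integrable `]-oo, x + 1]%classic (EFin \o g).
    by apply: integrableS Ig => //; exact: measurable_itv.
  have xb := ltNyr x.
  have [dF F'] := @continuous_FTC1 R g (BInfty R true) x (x + 1) (ltr_pwDr ltr01 (lexx x)) Ix xb (cg x).

  apply: (DeriveDef dF); rewrite -derive1E; exact: F'.
have [c1 c2] := cvg_integral_Nyitv Ig; rewrite g0 in c1.
have B1 := mills_bound dF hM c1.
(* The inverse of the density, written out so that [u' = x u] is immediate. *)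
pose u (x : R) := (normal_peak 1)^-1 * expR (x ^+ 2 / 2).
have up x : pdf x * u x = 1.
  rewrite pdfE /u mulrACA divff ?gt_eqF// mul1r -expRD addNr expR0 //.
have u0 x : 0 < u x by apply: mulr_gt0; [rewrite invr_gt0|exact: expR_gt0].
have du (x : R) : is_derive x (1 : R) u (x * u x).
  by apply: is_derive_eq; rewrite /u /GRing.scale/=; field; rewrite gt_eqF.
(* The reflected function [F (- x)] satisfies the hypotheses of [mills_bound] with [- h (- x)], as
   the density is even. *)
have B2 (x : R) : 1 <= x -> `|F (- x)| <= M * (pdf x / x).
  move=> x1.
  have dFN (y : R) : is_derive y (1 : R) (fun z => F (- z)) (- h (- y) * pdf y).
    have dN : is_derive y (1 : R) (fun z : R => - z) (- 1) by apply: is_deriveN.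
    apply: is_derive_eq (@is_derive1_comp _ F (fun z : R => - z) y _ _ (dF (- y)) dN) _.
    rewrite /g /GRing.scale/= (_ : pdf (- y) = pdf y); last by rewrite !pdfE sqrrN.
    by ring.
  apply: (mills_bound (h := fun y => - h (- y)) dFN) => // y.
  by rewrite normrN.
pose f x := F x * u x; pose f' x := h x + x * f x.
have df (x : R) : is_derive x (1 : R) f (f' x).
  apply: is_derive_eq (is_deriveM (dF x) (du x)) _.
  rewrite /f' /f /g /GRing.scale/=.
  transitivity (h x * (pdf x * u x) + x * (F x * u x)); first by ring.
  by rewrite up mulr1.
have cf : continuous f by move=> x; exact: continuous_is_derive.
have xf x : 1 <= `|x| -> `|x * f x| <= M.
  move=> x1; have : `|F x| <= M * (pdf `|x| / `|x|).
    have [x0|x0] := leP 0 x; first by rewrite (ger0_norm x0) in x1 *; exact: B1.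
    by rewrite (ltr0_norm x0) in x1 *; have := B2 _ x1; rewrite opprK.
  have -> : pdf `|x| = pdf x by rewrite !pdfE real_normK ?num_real.
  move=> FM; rewrite /f normrM (normrM (F x)) (gtr0_norm (u0 x)).
  have xp : 0 < `|x| by apply: lt_le_trans x1.
  apply: (@le_trans _ _ (`|x| * (M * (pdf x / `|x|) * u x))).
    by rewrite ler_wpM2l// ler_wpM2r// ltW.
  rewrite le_eqVlt; apply/orP; left; apply/eqP.
  transitivity (M * (pdf x * u x)); last by rewrite up mulr1.
  by field; exact: lt0r_neq0.
have [K K0 HK] : exists2 K : R, 0 <= K & forall x, `|x| <= 1 -> `|f x| <= K.
  have [||c _ Hc] := @EVT_max R (fun x => `|f x|) (-1) 1.
  - by rewrite lerNl (le_trans _ ler01)// oppr_le0.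
  - apply: continuous_subspaceT => x; apply: continuous_comp; [exact: cf|exact: norm_continuous].
  exists `|f c| => // x x1; apply: Hc; rewrite in_itv/= -ler_norml //.
exists f, f', (M + M + K); split => //.
- by move=> x; apply: cvgD; [exact: ch|apply: cvgM; [exact: cvg_id|exact: cf]].
- move=> x; have [x1|/ltW x1] := lerP `|x| 1; first by have := HK x x1; lra.
  have := xf x x1; rewrite normrM => xM.
  have : `|f x| <= `|x| * `|f x| by rewrite ler_peMl.
  by lra.
- move=> x; apply: le_trans (ler_normD _ _) _; have := hM x.
  have [x1|/ltW x1] := lerP `|x| 1; last by have := xf x x1; lra.
  have := HK x x1; have : `|x * f x| <= `|f x| by rewrite normrM ler_piMl.
  by lra.
by move=> y; rewrite /f' addrK.
Qed.

End stein_equation.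

(** * Approximation by smooth steps *)

Section smooth_step.
Variable R : realType.

(** Serves to differentiate the square of the positive part uniformly in the point, the kink at 0
    included. *)
Lemma is_derive_quadratic (f : R -> R) (x df K : R) :
  (forall y, `|f y - f x - df * (y - x)| <= K * (y - x) ^+ 2) -> is_derive x (1 : R) f df.
Proof.
move=> H.
have K0 : 0 <= K by have := H (x + 1); rewrite (addrC x) addrK expr1n !mulr1; exact: le_trans.
have L : h^-1 *: (f (h *: 1 + x) - f x) @[h --> (0 : R)^'] --> df.
  apply/cvgrPdist_le => e e0.
  have d0 : 0 < e / (K + 1) by rewrite divr_gt0// ltr_wpDl.
  near=> h.
  have h0 : h != 0 by near: h; exact: nbhs_dnbhs_neq.
  have hd : `|h| <= e / (K + 1).
    by near: h; exact: dnbhs0_le.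
  have := H (h *: 1 + x); rewrite /GRing.scale/= mulr1 addrK => Hh.
  have -> : df - h^-1 * (f (h + x) - f x) = - (h^-1 * (f (h + x) - f x - df * h)).
    by field.
  rewrite normrN normrM normfV ler_pdivrMl ?normr_gt0// (le_trans Hh)//.
  rewrite -real_normK ?num_real// expr2 mulrA [leRHS]mulrC ler_wpM2r//.
  apply: (@le_trans _ _ ((K + 1) * `|h|)); first by rewrite ler_wpM2r// lerDl.
  by rewrite mulrC -ler_pdivlMr// ltr_wpDl.
by apply: DeriveDef; [apply/cvg_ex; exists df|exact/cvg_lim].
Unshelve. all: by end_near. Qed.

Definition pospart (x : R) : R := Num.max x 0.

Lemma pospartP x : (0 <= x /\ pospart x = x) \/ (x <= 0 /\ pospart x = 0).
Proof. by rewrite /pospart; case: (leP x 0) => x0; [right|left; split => //; exact: ltW]. Qed.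

Lemma is_derive_pospart2 (x : R) : is_derive x (1 : R) (fun y => pospart y ^+ 2) (2 * pospart x).
Proof.
apply: (@is_derive_quadratic _ _ _ 1) => y; rewrite mul1r ler_norml.
have hx := sqr_ge0 x; have hy := sqr_ge0 y; have hxy := sqr_ge0 (y - x).
have [[xp ->]|[xn ->]] := pospartP x; have [[yp ->]|[yn ->]] := pospartP y.
- by apply/andP; split; nra.
- by have xy : x * y <= 0 by [rewrite mulr_ge0_le0]; apply/andP; split; nra.
- by have xy : x * y <= 0 by [rewrite mulr_le0_ge0]; apply/andP; split; nra.
- by apply/andP; split; nra.
Qed.

(* A C^1 step from [0] to [1], glued from two parabolic arcs on [[0, 1]]. *)
Definition step (x : R) : R :=
  2 * (pospart x ^+ 2 - 2 * pospart (x - 2^-1) ^+ 2 + pospart (x - 1) ^+ 2).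

Definition dstep (x : R) : R :=
  4 * (pospart x - 2 * pospart (x - 2^-1) + pospart (x - 1)).

Lemma step_le0 x : x <= 0 -> step x = 0.
Proof.
move=> x0; rewrite /step.
have [[h1 ->]|[h1 ->]] := pospartP x; have [[h2 ->]|[h2 ->]] := pospartP (x - 2^-1);
have [[h3 ->]|[h3 ->]] := pospartP (x - 1); nra.
Qed.

Lemma step_ge1 x : 1 <= x -> step x = 1.
Proof.
move=> x0; rewrite /step.
have [[h1 ->]|[h1 ->]] := pospartP x; last by lra.
have [[h2 ->]|[h2 ->]] := pospartP (x - 2^-1); last by lra.
have [[h3 ->]|[h3 h4]] := pospartP (x - 1); first by field.
have x1 : x = 1 by lra.
by rewrite h4 x1; field.
Qed.

Lemma step_01 x : 0 <= step x <= 1.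
Proof.
rewrite /step; apply/andP; split;
have [[h1 ->]|[h1 ->]] := pospartP x; have [[h2 ->]|[h2 ->]] := pospartP (x - 2^-1);
have [[h3 ->]|[h3 ->]] := pospartP (x - 1); nra.
Qed.

Lemma dstep_bound x : `|dstep x| <= 2.
Proof.
rewrite /dstep ler_norml; apply/andP; split;
have [[h1 ->]|[h1 ->]] := pospartP x; have [[h2 ->]|[h2 ->]] := pospartP (x - 2^-1);
have [[h3 ->]|[h3 ->]] := pospartP (x - 1); lra.
Qed.

Lemma is_derive_step (x : R) : is_derive x (1 : R) step (dstep x).
Proof.
have sh (c : R) : is_derive x (1 : R) (fun y => pospart (y - c) ^+ 2) (2 * pospart (x - c)).
  have ds : is_derive x (1 : R) (fun y : R => y - c) 1.
    by apply: is_derive_eq; rewrite subr0.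
  have := @is_derive1_comp _ (fun y => pospart y ^+ 2) (fun y : R => y - c) x _ _
    (is_derive_pospart2 (x - c)) ds.
  by rewrite mulr1.
have h0 := is_derive_pospart2 x; have h1 := sh 2^-1; have h2 := sh 1.
rewrite (_ : step = fun y => 2 * (pospart y ^+ 2 - 2 * pospart (y - 2^-1) ^+ 2 + pospart (y - 1) ^+ 2))//.
have H := is_deriveZ 2 (is_deriveD (is_deriveB h0 (is_deriveZ 2 h1)) h2).
by apply: is_derive_eq H _; rewrite /dstep /GRing.scale/=; ring.
Qed.

Lemma continuous_pospart : continuous pospart.
Proof.
by move=> x; apply: continuous_max; [exact: cvg_id|exact: cvg_cst].
Qed.

Lemma continuous_dstep : continuous dstep.
Proof.
have sh (c : R) : continuous (fun y => pospart (y - c)).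
  move=> x; apply: (@continuous_comp _ _ _ (fun y => y - c) pospart); last exact: continuous_pospart.
  by apply: cvgB; [exact: cvg_id|exact: cvg_cst].
move=> x; apply: cvgM; first exact: cvg_cst.
apply: cvgD; last exact: sh.
apply: cvgB; first exact: continuous_pospart.
by apply: cvgM; [exact: cvg_cst|exact: sh].
Qed.

(** For [m > 0], a step rising from 0 to 1 between [- J + j / m] and [- J + (j + 1) / m]. Natural
    parameters keep the family countable. *)
Definition gridstep (m J j : nat) (x : R) := step (m%:R * (x + J%:R) - j%:R).

Lemma is_derive_gridstep m J j (x : R) :
  is_derive x (1 : R) (gridstep m J j) (m%:R * dstep (m%:R * (x + J%:R) - j%:R)).
Proof.
have ds : is_derive x (1 : R) (fun y : R => m%:R * (y + J%:R) - j%:R) m%:R.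
  by apply: is_derive_eq; rewrite /GRing.scale/=; ring.
have := @is_derive1_comp _ step (fun y : R => m%:R * (y + J%:R) - j%:R) x _ _
  (is_derive_step (m%:R * (x + J%:R) - j%:R)) ds.
by rewrite mulrC.
Qed.

Lemma continuous_gridstep m J j : continuous (gridstep m J j).
Proof. exact: continuous_is_derive (is_derive_gridstep m J j). Qed.

Lemma continuous_dgridstep m J j :
  continuous (fun x : R => m%:R * dstep (m%:R * (x + J%:R) - j%:R)).
Proof.
move=> x; apply: cvgM; first exact: cvg_cst.
apply: (@continuous_comp _ _ _ (fun y : R => m%:R * (y + J%:R) - j%:R) dstep); last exact: continuous_dstep.
apply: cvgB; last exact: cvg_cst.
by apply: cvgM; [exact: cvg_cst|apply: cvgD; [exact: cvg_id|exact: cvg_cst]].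
Qed.

(** At a given [y] at most one step is in transition: the earlier ones equal 1, and their increments
    telescope, while the later ones equal 0. The sum is thus a convex combination of two consecutive
    [u i]. *)
Lemma step_sum (u : nat -> R) (y : R) N : exists i c, [/\ 0 <= c <= 1,
  u 0%N + \sum_(j < N.+1) (u j.+1 - u j) * step (y - j%:R) = u i + c * (u i.+1 - u i) &
  0 <= y <= N.+1%:R -> i%:R <= y <= i.+1%:R].
Proof.
elim: N => [|N [i [c [c01 E yi]]]].
  exists 0%N, (step (y - 0%:R)); split => //; first exact: step_01.
  by rewrite big_ord_recr big_ord0/= add0r mulrC.
rewrite big_ord_recr/=; have [yN|yN] := leP y N.+1%:R.
  exists i, c; split => //; last by move=> /andP[y0 _]; apply: yi; rewrite y0.
  by rewrite [step (y - N.+1%:R)]step_le0 ?subr_le0// mulr0 addr0.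
exists N.+1, (step (y - N.+1%:R)); split; first exact: step_01.
  rewrite (eq_bigr (fun j : 'I_N.+1 => u j.+1 - u j)).
    by rewrite -(big_mkord xpredT (fun j => u j.+1 - u j)) telescope_sumr// addrA subrKC mulrC.
  move=> j _; rewrite step_ge1 ?mulr1// lerBrDr addrC natr1.
  by apply: le_trans (ltW yN); rewrite ler_nat; exact: ltn_ord.
by move=> /andP[_ ->]; rewrite ltW.
Qed.

Lemma convex_norm_le (a b c K : R) : 0 <= c <= 1 -> `|a| <= K -> `|b| <= K ->
  `|a + c * (b - a)| <= K.
Proof.
move=> /andP[c0 c1]; rewrite !ler_norml => /andP[a1 a2] /andP[b1 b2].
by apply/andP; split; nra.
Qed.

(** Uniform continuity around [[-J, J]]. Only [x] is confined, since a grid point next to [x] may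
    fall outside the interval. *)
Lemma uniform_grid (phi : R -> R) (J e : R) : continuous phi -> 0 < e ->
  exists m : nat, forall x y, `|x| <= J -> `|y - x| <= m.+1%:R^-1 -> `|phi y - phi x| <= e.
Proof.
move=> cphi e0.
have cK : compact (`[- J, J]%classic : set R) by exact: segment_compact.
have := (compact_near_coveringP _).1 cK nat \oo
  (fun m x => forall y, `|y - x| <= m.+1%:R^-1 -> `|phi y - phi x| <= e) _.
move=> H; have [|N _ HN] := H; last first.
  exists N => x y xJ yx; apply: (HN N (leqnn N)) => //=.
  by rewrite in_itv/= -ler_norml.
move=> x _.
have e20 : 0 < e / 2 by rewrite divr_gt0.
have /cvgrPdist_le/(_ _ e20)/nbhs_ballP[d /= d0 Hd] := cphi x.
have d20 : 0 < d / 2 by rewrite divr_gt0.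
exists (ball x (d / 2), [set m : nat | m.+1%:R^-1 < d / 2]) => /=.
  split; first exact: nbhsx_ballx.
  have : harmonic n @[n --> \oo] --> (0 : R) by exact: cvg_harmonic.
  move=> /cvgrPdist_lt/(_ _ d20); apply: filterS => n /=.
  by rewrite sub0r normrN ger0_norm ?invr_ge0.
move=> [x' m] /= [xx' md] y yx'.
have h1 : `|phi x - phi x'| <= e / 2.
  by apply: Hd; apply: lt_trans xx' _; rewrite ltr_pdivrMr//; lra.
have h2 : `|phi x - phi y| <= e / 2.
  apply: Hd; rewrite /ball/=; have : `|x - y| <= `|x - x'| + `|y - x'|.
    by rewrite (distrC y) -[x - y](subrKA x') ler_normD.
  by have : `|x - x'| < d / 2 by []; move: md yx'; set r := _^-1; lra.
have : `|phi y - phi x'| <= `|phi x - phi x'| + `|phi x - phi y|.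
  by rewrite [leRHS]addrC (distrC (phi x) (phi y)) -(subrKA (phi x) (phi y)) ler_normD.
by lra.
Qed.

End smooth_step.

(** * From countably many steps to every bounded continuous function *)

Section step_criterion.
Variables (R : realType) (x : nat -> R).
Local Notation gam := (normal_prob (0 : R) 1).

Definition logmean (f : R -> R) (n : nat) : R := (\sum_(k < n) f (x k) / k.+1%:R) / harm R n.

(** Measurability and boundedness are included to give Gaussian integrability, which makes the class
    stable under linear combinations. *)
Definition good (f : R -> R) := [/\ measurable_fun setT f, exists K, forall y, `|f y| <= K &
  logmean f @ \oo --> Ex gam f].

Let good_intg f : good f -> intg gam f.
Proof. by case=> mf [K fK] _; apply: intg_polygrowth => //; exists K, 0%N => y; rewrite mulr1. Qed.

Lemma logmean_cst c n : (0 < n)%N -> logmean (fun=> c) n = c.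
Proof.
by move=> n0; rewrite /logmean -mulr_sumr -/(harm R n) mulfK// gt_eqF// (lt_le_trans ltr01)// harm_ge1.
Qed.

Lemma logmeanD f g n : logmean (fun y => f y + g y) n = logmean f n + logmean g n.
Proof.
rewrite /logmean -mulrDl -big_split/=; congr (_ / _).
by apply: eq_bigr => k _; rewrite mulrDl.
Qed.

Lemma logmeanZ c f n : logmean (fun y => c * f y) n = c * logmean f n.
Proof.
rewrite /logmean mulrA mulr_sumr; congr (_ / _).
by apply: eq_bigr => k _; rewrite mulrA.
Qed.

Lemma le_logmean f g n : (forall y, f y <= g y) -> logmean f n <= logmean g n.
Proof.
move=> fg; rewrite ler_wpM2r ?invr_ge0 ?harm_ge0//; apply: ler_sum => k _.
by rewrite ler_wpM2r.
Qed.

Lemma norm_logmean f n : `|logmean f n| <= logmean (fun y => `|f y|) n.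
Proof.
rewrite /logmean normrM normfV (ger0_norm (harm_ge0 R n)) ler_wpM2r ?invr_ge0 ?harm_ge0//.
apply: le_trans (ler_norm_sum _ _ _) _; apply: ler_sum => k _.
by rewrite normrM normfV (ger0_norm (ler0n R _)).
Qed.

Lemma good_cst c : good (fun=> c).
Proof.
split; [exact: measurable_cst|by exists (Num.norm c)|].
rewrite Ex_cst; apply: cvg_near_cst; exists 1%N => // n /= n0; exact: logmean_cst.
Qed.

Lemma goodD f g : good f -> good g -> good (fun y => f y + g y).
Proof.
move=> gf gg; have If := good_intg gf; have Ig := good_intg gg.
case: gf gg => [mf [K fK] cf] [mg [L gL] cg]; split.
- exact: measurable_funD.
- by exists (K + L) => y; rewrite (le_trans (ler_normD _ _))// lerD.
- rewrite ExD// (_ : logmean _ = fun n => logmean f n + logmean g n); first exact: cvgD.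
  by apply/funext => n; rewrite logmeanD.
Qed.

Lemma goodZ c f : good f -> good (fun y => c * f y).
Proof.
move=> gf; have If := good_intg gf.
case: gf => [mf [K fK] cf]; split.
- exact: measurable_funM.
- by exists (`|c| * K) => y; rewrite normrM ler_wpM2l.
- rewrite ExZ// (_ : logmean _ = fun n => c * logmean f n).
    by apply: cvgM => //; exact: cvg_cst.
  by apply/funext => n; rewrite logmeanZ.
Qed.

Lemma good_sum (I : Type) (s : seq I) (F : I -> R -> R) :
  (forall i, good (F i)) -> good (fun y => \sum_(i <- s) F i y).
Proof.
move=> gF; elim: s => [|i s IH].
  by under eq_fun do rewrite big_nil; exact: good_cst.
by under eq_fun do rewrite big_cons; exact: goodD.
Qed.

Hypothesis good_gridstep : forall m J j, good (gridstep m J j).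

(** Steps on a fine grid give an interpolation [psi] of [phi] with [|psi - phi| <= e1 + 2 M T]. The
    tail function [T] is itself a combination of steps and has small Gaussian mean; the convergence
    of its averages supplies the tightness. *)
Lemma good_continuous (phi : R -> R) : continuous phi ->
  (exists M : R, forall y, `|phi y| <= M) -> logmean phi @ \oo --> Ex gam phi.
Proof.
have ar1 (a b c : R) : `|a - b| <= c -> a <= c -> b <= 2 * c.
  by rewrite ler_norml => /andP[? ?] ?; lra.
have ar2 (a b c g z1 z2 w1 w2 : R) : a <= g + z1 -> b <= g -> c <= g + z2 -> z1 <= w1 ->
  z2 <= w2 -> a + b + c <= 4 * g + w1 + w2 - g by lra.
move=> cphi [M phiM]; have M0 : 0 <= M by apply: le_trans (phiM 0).
have mphi : measurable_fun setT phi by exact: continuous_measurable_fun.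
have Iphi : intg gam phi by apply: intg_polygrowth => //; exists M, 0%N => y; rewrite mulr1.
pose V := Ex gam (fun y => y ^+ 2).
have V0 : 0 <= V by apply: Ex_ge0 => y; exact: sqr_ge0.
have IV : intg gam (fun y : R => y ^+ 2).
  apply: intg_polygrowth; [exact: oner_neq0|by apply: measurable_funX|].
  by exists 1, 1%N => y; rewrite mul1r expr1 ger0_norm ?sqr_ge0// lerDr.
apply/cvgrPdist_le => e e0.
(* The error is made of three times [e1] (comparing [psi] with [phi] twice, and the convergence for
   [psi]), of [2 M e1] from the mean of [T] and of [4 M e1] from its average; one [e1] is spare. *)
pose e1 := e / (4 + 6 * M).
have D0 : 0 < 4 + 6 * M by lra.
have e10 : 0 < e1 by rewrite divr_gt0.
(* Chebyshev's argument: [T y <= 2 y^2 / K], so the mean of [T] is at most [2 V / K <= e1]. *)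
pose K := (Num.truncn (2 * V / e1)).+1.
(* Equal to 0 for [|y| <= K] and to 1 for [|y| >= K + 1]. *)
pose T (y : R) := (1 - gridstep 1 K.+1 0 y) + gridstep 1 0 K y.
have gT : good T.
  apply: goodD => //.
  rewrite (_ : (fun y => 1 - _) = fun y => 1 + (-1) * gridstep 1 K.+1 0 y).
    by apply: goodD; [exact: good_cst|exact: goodZ].
  by apply/funext => y; rewrite mulN1r.
have T0 y : 0 <= T y.
  rewrite /T /gridstep; have := step_01 (1%:R * (y + K.+1%:R) - 0%:R).
  have := step_01 (1%:R * (y + 0%:R) - K%:R).
  by move=> /andP[h1 h2] /andP[h3 h4]; lra.
have Kp : 1 <= K%:R :> R by rewrite ler1n.
have KS : K.+1%:R = K%:R + 1 :> R by rewrite natr1.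
have TE y : T y = 1 - step (y + K%:R + 1) + step (y - K%:R).
  by rewrite /T /gridstep !mul1r subr0 addr0 KS addrA.
have T1 y : K.+1%:R <= `|y| -> T y = 1.
  rewrite KS TE; have [y0|y0] := ger0P y => yK.
    by rewrite !step_ge1; lra.
  by rewrite !step_le0; lra.
have TV y : T y <= 2 / K%:R * y ^+ 2.
  have [yK|yK] := leP `|y| K%:R.
    rewrite TE step_ge1; last by move: yK; rewrite ler_norml => /andP[]; lra.
    rewrite step_le0; last by move: yK; rewrite ler_norml => /andP[]; lra.
    by rewrite subrr addr0 mulr_ge0 ?sqr_ge0// divr_ge0.
  apply: (@le_trans _ _ 2).
    rewrite TE; have /andP[? _] := step_01 (y + K%:R + 1).
    by have /andP[_ ?] := step_01 (y - K%:R); lra.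
  rewrite mulrAC ler_pdivlMr ?(lt_le_trans ltr01)// ler_wpM2l//.
  rewrite -real_normK ?num_real// expr2.
  by apply: le_trans (ltW yK) _; rewrite ler_peMl// (le_trans Kp)// ltW.
have IT := good_intg gT.
have ET : Ex gam T <= e1.
  apply: (@le_trans _ _ (Ex gam (fun y => 2 / K%:R * y ^+ 2))).
    by apply: le_Ex => //; exact: intgZ.
  have VK : 2 * V / e1 <= K%:R by apply/ltW/truncnS_gt.
  have K0 : 0 < K%:R :> R by apply: lt_le_trans Kp.
  rewrite ExZ// -/V [leLHS](_ : _ = 2 * V / K%:R); last by rewrite mulrAC.
  by rewrite ler_pdivrMr// [leRHS]mulrC -ler_pdivrMr.
have [m Hm] := uniform_grid K.+1%:R cphi e10.
pose u j := phi (- K.+1%:R + j%:R / m.+1%:R).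
pose N := (m.+1 * (2 * K.+1)).-1.
have NE : N.+1 = (m.+1 * (2 * K.+1))%N by rewrite /N prednK.
pose psi (y : R) := u 0%N + \sum_(j < N.+1) (u j.+1 - u j) * gridstep m.+1 K.+1 j y.
have gpsi : good psi.
  by apply: goodD; [exact: good_cst|apply: good_sum => j; exact: goodZ].
have Ipsi := good_intg gpsi.
have mp : 0 < m.+1%:R :> R by [].
(* For [|y| <= K + 1] the two grid values combined in [psi y] are within [e1] of [phi y]. Beyond,
   [T y = 1] and [2 M] bounds every difference of values of [phi]. *)
have psiphi y : `|psi y - phi y| <= e1 + 2 * M * T y.
  have [i [c [c01 E Hy]]] := step_sum u (m.+1%:R * (y + K.+1%:R)) N.
  have -> : psi y - phi y = (u i - phi y) + c * ((u i.+1 - phi y) - (u i - phi y)).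
    by rewrite /psi /gridstep E; ring.
  have [yK|yK] := leP `|y| K.+1%:R.
    apply: (@le_trans _ _ e1); last by rewrite lerDl mulr_ge0// mulr_ge0.
    have [] : i%:R <= m.+1%:R * (y + K.+1%:R) <= i.+1%:R.
      apply: Hy; move: yK; rewrite ler_norml => /andP[y1 y2].
      rewrite NE 2!natrM mulr_ge0//=; last by lra.
      by rewrite ler_wpM2l//; lra.
    move=> /andP[i1 i2].
    have i1' : i%:R / m.+1%:R <= y + K.+1%:R by rewrite ler_pdivrMr// mulrC.
    have i2' : y + K.+1%:R <= i.+1%:R / m.+1%:R by rewrite ler_pdivlMr// mulrC.
    have iS : i.+1%:R / m.+1%:R = i%:R / m.+1%:R + m.+1%:R^-1 :> R by rewrite -natr1 mulrDl mul1r.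
    have m0 : 0 <= m.+1%:R^-1 :> R by rewrite invr_ge0.
    apply: convex_norm_le => //; apply: Hm => //; rewrite ler_norml; apply/andP; split;
      rewrite ?iS in i2' *; move: i1' i2' m0; set a := _ / _; set b := _^-1; lra.
  apply: (@le_trans _ _ (2 * M)); last by rewrite T1 ?(ltW yK)// mulr1 lerDr ltW.
  have B z : `|phi z - phi y| <= 2 * M.
    by have := ler_normB (phi z) (phi y); have := phiM z; have := phiM y; lra.
  by apply: convex_norm_le => //; exact: B.
case: (gpsi) => _ _ /cvgrPdist_le/(_ _ e10)[N1 _ HN1].
case: (gT) => _ _ /cvgrPdist_le/(_ _ e10)[N2 _ HN2].
exists (maxn 1 (maxn N1 N2)) => // n /=; rewrite !geq_max => /andP[n0 /andP[nN1 nN2]].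
have A1 := HN1 n nN1; have A2 := HN2 n nN2; rewrite /= in A1 A2.
have A3 : `|Ex gam phi - Ex gam psi| <= e1 + 2 * M * Ex gam T.
  rewrite -ExB//; apply: le_trans (normr_Ex (intgB Iphi Ipsi)) _.
  have I1 : intg gam (fun y => e1 + 2 * M * T y) by apply: intgD; [exact: intg_cst|exact: intgZ].
  apply: (@le_trans _ _ (Ex gam (fun y => e1 + 2 * M * T y))).
    by apply: le_Ex => //; [exact/intg_norm/intgB|move=> y; rewrite distrC].
  by rewrite ExD ?Ex_cst ?ExZ//; [exact: intg_cst|exact: intgZ].
have A4 : `|logmean psi n - logmean phi n| <= e1 + 2 * M * logmean T n.
  have -> : logmean psi n - logmean phi n = logmean (fun y => psi y - phi y) n.
    rewrite (_ : (fun y => psi y - phi y) = fun y => psi y + (-1) * phi y).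
      by rewrite logmeanD logmeanZ mulN1r.
    by apply/funext => y; rewrite mulN1r.
  apply: le_trans (norm_logmean _ _) _; apply: le_trans (le_logmean n psiphi) _.
  by rewrite logmeanD logmeanZ logmean_cst.
have A5 : logmean T n <= 2 * e1.
  exact: ar1 A2 ET.
have A6 : `|Ex gam phi - logmean phi n| <= `|Ex gam phi - Ex gam psi| +
   `|Ex gam psi - logmean psi n| + `|logmean psi n - logmean phi n|.
  rewrite (_ : Ex gam phi - logmean phi n = (Ex gam phi - Ex gam psi) +
   (Ex gam psi - logmean psi n) + (logmean psi n - logmean phi n)); last by ring.
  by apply: le_trans (ler_normD _ _) _; rewrite lerD2r ler_normD.
have A7 : 2 * M * Ex gam T <= 2 * M * e1 by rewrite ler_wpM2l// mulr_ge0.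
have A8 : 2 * M * logmean T n <= 2 * M * (2 * e1) by rewrite ler_wpM2l// mulr_ge0.
have e1E : e = 4 * e1 + 2 * M * e1 + 2 * M * (2 * e1).
  have : e = e1 * (4 + 6 * M) by rewrite /e1 mulfVK// gt_eqF.
  by move=> {1}->; ring.
apply: le_trans A6 _; apply: le_trans (ar2 _ _ _ _ _ _ _ _ A3 A1 A4 A7 A8) _.
by rewrite -e1E gerBl ltW.
Qed.

End step_criterion.

(** * Fractional Brownian motion *)

Section fbm_increments.
Variables (R : realType) (d : measure_display) (Omega : measurableType d).
Variables (P : probability Omega R) (H : R) (B : R -> Omega -> R).
Hypothesis fB : is_fBm P H B.

Definition increment (k : nat) (w : Omega) := B k.+1%:R w - B k%:R w.

Lemma incrcovE i j : incrcov H i j =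
  fBm_cov H i.+1%:R j.+1%:R - fBm_cov H i.+1%:R j%:R - (fBm_cov H i%:R j.+1%:R - fBm_cov H i%:R j%:R).
Proof.
wlog ij : i j / (i <= j)%N.
  move=> W; have [/W//|/ltnW/W E] := leqP i j.
  rewrite /incrcov natdistC -/(incrcov H j i) E.
  have sym (t s : R) : fBm_cov H t s = fBm_cov H s t.
    by rewrite /fBm_cov distrC [s `^ _ + _]addrC.
  rewrite (sym j.+1%:R i%:R) (sym j%:R i.+1%:R) (sym j.+1%:R) (sym j%:R i%:R); ring.
move: ij => /subnKC <-; move: (j - i)%N => m {j}.
have -> : incrcov H i (i + m) = rho H m.
  by rewrite /incrcov; congr (rho H _); rewrite /natdist; lia.
rewrite /fBm_cov /rho.
have -> : `|i.+1%:R - (i + m).+1%:R| = m%:R :> R.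
  by rewrite -addSn natrD opprD addrA subrr sub0r normrN normr_nat.
have -> : `|i.+1%:R - (i + m)%:R| = `|m%:R - 1| :> R.
  by rewrite natrD -natr1 distrC; congr `|_|; ring.
have -> : `|i%:R - (i + m).+1%:R| = m.+1%:R :> R.
  by rewrite -addnS natrD opprD addrA subrr sub0r normrN normr_nat.
have -> : `|i%:R - (i + m)%:R| = m%:R :> R.
  by rewrite natrD opprD addrA subrr sub0r normrN normr_nat.
by field.
Qed.

Lemma increment_gauss n th : centered_gaussian P (lincomb increment n th)
  (\sum_(i < n) \sum_(j < n) th i * th j * incrcov H i j).
Proof.
case: fB => _ [_ [_ gB]].
(* A combination of [n] increments is a combination of [2 n] values of [B]: the right endpoints come
   first, then the left endpoints with opposite coefficients. *)
pose a (i : 'I_(n + n)) : R := if (i < n)%N then th i else - th (i - n)%N.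
pose ts (i : 'I_(n + n)) : R := if (i < n)%N then i.+1%:R else (i - n)%:R.
have al (i : 'I_n) : a (lshift n i) = th i by rewrite /a /= ltn_ord.
have ar (i : 'I_n) : a (rshift n i) = - th i.
  by rewrite /a /= ltnNge leq_addr/= addKn.
have tl (i : 'I_n) : ts (lshift n i) = i.+1%:R by rewrite /ts /= ltn_ord.
have tr (i : 'I_n) : ts (rshift n i) = i%:R.
  by rewrite /ts /= ltnNge leq_addr/= addKn.
have ts0 i : 0 <= ts i by rewrite /ts; case: ifP.
have := gB (n + n)%N ts a ts0.
have -> : (fun w => \sum_(i < n + n) a i * B (ts i) w) = lincomb increment n th.
  apply/funext => w; rewrite big_split_ord/= -big_split/=; apply: eq_bigr => i _.
  by rewrite al ar tl tr /increment mulrBr mulNr.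
congr centered_gaussian.
rewrite big_split_ord/= -big_split/=; apply: eq_bigr => i _.
rewrite !big_split_ord/= -!big_split/=; apply: eq_bigr => j _.
by rewrite !al !ar !tl !tr incrcovE; ring.
Qed.

End fbm_increments.

Section averages.
Variables (R : realType) (x : nat -> R).

Lemma cvg_ln_nat : (ln (n%:R : R))^-1 @[n --> \oo] --> (0 : R).
Proof.
apply/cvgrPdist_le => e e0.
exists (Num.truncn (expR e^-1)).+1 => // n /= hn.
have h : e^-1 <= ln n%:R :> R.
  rewrite -[leLHS]expRK ler_ln ?posrE ?expR_gt0//.
    by apply/ltW; apply: lt_le_trans (truncnS_gt _) _; rewrite ler_nat.
  by rewrite ltr0n (leq_trans _ hn).
have l0 : 0 < ln n%:R :> R by apply: lt_le_trans h; rewrite invr_gt0.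
by rewrite sub0r normrN ger0_norm ?invr_ge0 ?(ltW l0)// -[leRHS]invrK lef_pV2 ?posrE ?invr_gt0.
Qed.

Lemma cvg_harm_ln : harm R n / ln n%:R @[n --> \oo] --> (1 : R).
Proof.
apply: (@squeeze_cvgr _ _ _ _ (fun=> 1) (fun n => 1 + (ln (n%:R : R))^-1)); last 2 first.
- exact: cvg_cst.
- by rewrite -[X in _ --> X]addr0; apply: cvgD; [exact: cvg_cst|exact: cvg_ln_nat].
exists 2 => // n /= n2.
have l0 : 0 < ln n%:R :> R by rewrite ln_gt0// ltr1n.
case: n => [//|n] in n2 l0 *.
rewrite ler_pdivlMr// mul1r ler_pdivrMr// mulrDl mul1r mulVf ?gt_eqF//.
rewrite (le_trans _ (harm_ge_ln R n.+1))/=; last by rewrite ler_ln ?posrE// ler_nat.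
by rewrite addrC harm_le_ln.
Qed.

(** The harmonic normalization is exchanged for the logarithm, their ratio tending to 1, and the
    index is shifted from [k + 1] to [k]. *)
Lemma log_average_of_logmean (phi : R -> R) (G : nat -> R) (l : R) :
  (forall k, x k = G k.+1) -> logmean x phi @ \oo --> l ->
  (fun n : nat => (ln n%:R)^-1 * \sum_(1 <= k < n.+1) (k%:R)^-1 * phi (G k)) @ \oo --> l.
Proof.
move=> xG cl; rewrite -[l]mulr1.
apply: cvg_trans (cvgM cl cvg_harm_ln); apply: near_eq_cvg.
exists 1%N => // n /= n1; rewrite /logmean.
have h0 : harm R n != 0 by rewrite gt_eqF// (lt_le_trans ltr01)// harm_ge1.
rewrite mulrA mulfVK// mulrC; congr (_ * _).
rewrite big_add1/= big_mkord; apply: eq_bigr => k _.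
by rewrite xG mulrC.
Qed.

End averages.

(** * Almost sure convergence for one step function *)

Section clt.
Variables (R : realType) (d : measure_display) (Omega : measurableType d).
Variables (P : probability Omega R) (p : nat) (H : R) (B : R -> Omega -> R).
Variable sigma : nat -> R.
Hypothesis p0 : (0 < p)%N.
Hypothesis Hq : H <= Hcrit p.+1.
Hypothesis fB : is_fBm P H B.
Hypothesis Hsig : forall n : nat, (1 <= n)%N -> (H = Hcrit p.+1 -> (2 <= n)%N) ->
     0 < sigma n /\
     (\int[P]_w ((Gn p.+1 H B sigma n w) ^+ 2)%:E = 1)%E.

Let H01 : 0 < H < 1. Proof. by case: fB. Qed.
Let gX := increment_gauss fB.
Let Csym i j : incrcov H i j = incrcov H j i.
Proof. by rewrite /incrcov natdistC. Qed.
Let Cdiag i : incrcov H i i = 1.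
Proof. by rewrite /incrcov /natdist subnn rho0//. Qed.

Let nrm k := if H < Hcrit p.+1 then (sigma k * Num.sqrt k%:R)^-1
  else (sigma k * Num.sqrt (k%:R * ln k%:R))^-1.

Let GnE k w : Gn p.+1 H B sigma k w = nrm k * Ssum p k (fun a => increment B a w).
Proof.
have VE : Vn p.+1 B k w = Ssum p k (fun a => increment B a w).
  by apply: eq_bigr => a _; rewrite hermiteE.
by rewrite /Gn /nrm VE; case: ifP => _; rewrite mulrC.
Qed.

Let aS k : allmom P (fun w => Ssum p k (fun a => increment B a w)).
Proof. exact: (allmom_Ssum gX Cdiag). Qed.

Let nrm_spec k : (1 < k)%N -> 0 <= nrm k /\ nrm k ^+ 2 * vcov (incrcov H) p k k = 1.
Proof.
move=> k1; have [s0 I] := Hsig (ltnW k1) (fun=> k1); split.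
  by rewrite /nrm; case: ifP => _; rewrite invr_ge0 mulr_ge0 ?sqrtr_ge0// ltW.
rewrite -(Ex_SS gX Csym Cdiag) -ExZ; last by apply: allmom_intg; exact: allmomM.
have := congr1 fine I; rewrite -/(Rintegral P setT (fun w => Gn p.+1 H B sigma k w ^+ 2)) => /= <-.
by apply: eq_Ex => w; rewrite GnE exprMn -expr2.
Qed.

(** Stein's equation is solved for the centered step [h], whose boundedness and bounded derivative
    are what [stein_sum_bound] asks for; the correlations of the [h (G_k)] then satisfy the
    hypothesis of [log_average_cvg0]. *)
Lemma gridstep_asclt m J j : {ae P, forall w,
  logmean (fun k => Gn p.+1 H B sigma k.+1 w) (gridstep m J j) @ \oo -->
  Ex (normal_prob (0 : R) 1) (gridstep m J j)}.
Proof.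
set g := gridstep m J j; pose L := Ex (normal_prob (0 : R) 1) g.
have g01 (y : R) : `|g y| <= 1.
  by rewrite ger0_norm; have /andP[? ?] := step_01 (m%:R * (y + J%:R) - j%:R).
have cg : continuous g by exact: continuous_gridstep.
have mg : measurable_fun setT g by exact: continuous_measurable_fun.
have Ig : intg (normal_prob (0 : R) 1) g.
  by apply: intg_polygrowth; [exact: oner_neq0| |exists 1, 0%N => y; rewrite mulr1].
pose h y := g y - L.
have ch : continuous h by move=> y; apply: cvgB; [exact: cg|exact: cvg_cst].
have hM y : `|h y| <= 1 + `|L| by rewrite (le_trans (ler_normB _ _))// lerD2r.
have h0 : Ex (normal_prob (0 : R) 1) h = 0.
  by rewrite ExB ?Ex_cst ?subrr//; exact: intg_cst.
have [f [f' [K [df cf' fK f'K stein]]]] := stein_solution ch hM h0.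
pose h' y : R := m%:R * dstep (m%:R * (y + J%:R) - j%:R).
have dh (y : R) : is_derive y (1 : R) h (h' y).
  apply: is_derive_eq (is_deriveB (is_derive_gridstep m J j y) (is_derive_cst L y 1)) _.
  by rewrite subr0.
have ch' : continuous h' by exact: continuous_dgridstep.
have K0 : 0 <= K by apply: le_trans (fK 0).
have m0 : 0 <= m%:R :> R by [].
pose M := 1 + `|L| + K + m%:R * 2.
have M0 : 0 <= M by rewrite !addr_ge0// mulr_ge0.
have [fM f'M hM' h'M] : [/\ forall y, `|f y| <= M, forall y, `|f' y| <= M,
    forall y, `|h y| <= M & forall y, `|h' y| <= M].
  have n0 := normr_ge0 L; have m20 : 0 <= m%:R * 2 :> R by rewrite mulr_ge0.
  rewrite /M; set z := m%:R * 2 in m20 *; split => y.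
  - by have := fK y; lra.
  - by have := f'K y; lra.
  - by have := hM y; lra.
  - have : `|h' y| <= z by rewrite normrM normr_nat ler_wpM2l// dstep_bound.
    by lra.
have [A A0 HA] := stein_sum_bound H01 p0 Hq gX df cf' dh ch' fM f'M hM' h'M stein.
pose xi k w := h (Gn p.+1 H B sigma k.+1 w).
have mxi k : measurable_fun setT (xi k).
  apply: (@measurableT_comp _ _ _ _ _ _ h); first exact: continuous_measurable_fun.
  rewrite (_ : Gn _ _ _ _ _ = fun w => nrm k.+1 * Ssum p k.+1 (fun a => increment B a w)).
    by apply: measurable_funM => //; exact: allmom_meas (aS _).
  by apply/funext => w; rewrite GnE.
have xiM k w : `|xi k w| <= M by exact: hM'.
have xiA k l : (k <= l)%N -> `|Ex P (fun w => xi k w * xi l w)| <=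
    (A + M ^+ 2) * ((Num.sqrt (harm R k.+1))^-1 + Num.sqrt (Num.sqrt k.+1%:R / Num.sqrt l.+1%:R)).
  move=> kl; set r := ((Num.sqrt _)^-1 + _); have r0 : 0 <= r by rewrite addr_ge0 ?invr_ge0 ?sqrtr_ge0.
  (* Index 0 stands for [G_1], which in the critical case is a division by [ln 1 = 0] and is not
     normalized. The bracket [r] is at least 1 there, because [harm 1 = 1], so the added constant
     [M^2] covers this index. *)
  rewrite mulrDl; case: k => [|k] in kl r r0 *.
    have I : intg P (fun w => xi 0%N w * xi l w).
      apply: (@intg_bounded _ _ _ _ _ (M ^+ 2)); first exact: measurable_funM.
      by move=> w; rewrite normrM expr2 ler_pM.
    apply: le_trans (normr_Ex I) _.
    apply: (@le_trans _ _ (M ^+ 2)).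
      rewrite -[leRHS](Ex_cst P); apply: le_Ex; [exact: intg_norm|exact: intg_cst|].
      by move=> w; rewrite normrM expr2 ler_pM.
    apply: (@le_trans _ _ (M ^+ 2 * r)); last by rewrite lerDr mulr_ge0.
    rewrite ler_peMr ?exprn_ge0// /r harmS /harm big_ord0 add0r invr1 sqrtr1 invr1 lerDl.
    exact: sqrtr_ge0.
  apply: (@le_trans _ _ (A * r)); last by rewrite lerDl mulr_ge0// exprn_ge0.
  have [n1 v1] := nrm_spec (isT : (1 < k.+2)%N).
  have l1 : (1 < l.+1)%N by rewrite ltnS (leq_trans _ kl).
  have [n2 v2] := nrm_spec l1.
  have kl' : (0 < k.+2 <= l.+1)%N by [].
  apply: le_trans (HA k.+2 l.+1 _ _ kl' n1 n2 v1 v2).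
  rewrite le_eqVlt; apply/orP; left; apply/eqP; congr `|_|.
  by apply: eq_Ex => w; rewrite /xi !GnE.
have AM0 : 0 <= A + M ^+ 2 by rewrite addr_ge0// exprn_ge0.
have := log_average_cvg0 mxi xiM AM0 xiA; apply: filterS => w cw.
have cL : (fun n => logmean (fun k => Gn p.+1 H B sigma k.+1 w) h n + L) @ \oo --> L.
  by rewrite -[X in _ --> X]add0r; apply: cvgD; [exact: cw|exact: cvg_cst].
apply: cvg_trans cL; apply: near_eq_cvg; exists 1%N => // n /= n0.
rewrite -[X in _ + X](logmean_cst (fun k => Gn p.+1 H B sigma k.+1 w) L n0) -logmeanD.
by congr (logmean _ _ _); apply/funext => y; rewrite subrK.
Qed.

End clt.

Theorem mainTheorem9 (R : realType) (d : measure_display) (Omega : measurableType d)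
  (P : probability Omega R) (q : nat) (H : R) (B : R -> Omega -> R)
  (sigma : nat -> R) :
  (2 <= q)%N ->
  0 < H -> H <= Hcrit q ->
  is_fBm P H B ->
  (forall n : nat, (1 <= n)%N -> (H = Hcrit q -> (2 <= n)%N) ->
     0 < sigma n /\
     (\int[P]_w ((Gn q H B sigma n w) ^+ 2)%:E = 1)%E) ->
  {ae P, forall w : Omega, forall phi : R -> R,
     continuous phi -> (exists M : R, forall x, `|phi x| <= M) ->
     (fun n : nat => (ln n%:R)^-1 *
        \sum_(1 <= k < n.+1) (k%:R)^-1 * phi (Gn q H B sigma k w))
       @ \oo --> Rintegral (normal_prob (0:R) 1) setT phi}.
Proof.
case: q => [//|p]; rewrite ltnS => p0 _ Hq fB Hsig.
(* A countable union of null sets: outside it the convergence holds for all steps at once, before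
   any [phi] is chosen. *)
have AE : {ae P, forall w, forall m J j, 
  logmean (fun k => Gn p.+1 H B sigma k.+1 w) (gridstep m J j) @ \oo -->
  Ex (normal_prob (0 : R) 1) (gridstep m J j)}.
  apply/ae_foralln => m; apply/ae_foralln => J; apply/ae_foralln => j.
  exact: gridstep_asclt.
apply: filterS AE => w cw phi cphi bphi.
apply: (log_average_of_logmean (x := fun k => Gn p.+1 H B sigma k.+1 w)) => //.
apply: good_continuous => // m J j; split.
- by apply: continuous_measurable_fun; exact: continuous_gridstep.
- by exists 1 => y; rewrite ger0_norm; have /andP[? ?] := step_01 (m%:R * (y + J%:R) - j%:R).
- exact: cw.
Qed.
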